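(* Let $n\ge 1$ and $p>0$. Let $u:\mathbb{R}^n\to(-\infty,+\infty]$ be a convex function whose effective domain $\operatorname{dom}u$ is compact, such that $u$ is Lipschitz on $\operatorname{int}(\operatorname{dom}u)$ and of class $C^2_+$ in $\operatorname{int}(\operatorname{dom}u)$. Then there exists a constant $\delta_{p,n}$, depending only on $n$ and $p$, such that \[ \lim_{m\to+\infty} m^{\frac{2p}{n}}\,\triangle_p(u,P^c_{(m)},1)=\frac{\delta_{p,n}}{2^p}\left(\int_{\operatorname{dom}u}(\det D^2u(x))^{\frac{p}{n+2p}}\,\mathrm{d}x\right)^{\frac{n+2p}{n}}. \]
   Context: $C^2_+$ means twice continuously differentiable with positive definite Hessian $D^2u$. $P^c_{(m)}$ is the class of functions $l_m(x)=\max_{1\le j\le m}\psi_j(x)$ for at most $m$ affine functions $\psi_j:\mathbb{R}^n\to\mathbb{R}$ with $l_m\le u$ on $\operatorname{dom}u$, and for sufficiently large $m$, $\triangle_p(u,P^c_{(m)},1)=\inf\{\int_{\operatorname{dom}u}(u(x)-l_m(x))^p\,\mathrm{d}x: l_m\in P^c_{(m)}\}$. *)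

(* Defs.v *)
From HB Require Import structures.
From mathcomp Require Import all_boot all_order all_algebra.
From mathcomp Require Import all_classical all_reals all_analysis.
Set Implicit Arguments. Unset Strict Implicit. Unset Printing Implicit Defensive.
Import Order.TTheory GRing.Theory Num.Theory.
Import numFieldNormedType.Exports.
Local Open Scope classical_set_scope.
Local Open Scope ring_scope.

Section Defs.
Variable R : realType.

(* n-dimensional Lebesgue integral of a function with values in \bar R,
   written out as the iterated one-dimensional Lebesgue integral
   (Tonelli); only used for nonnegative integrands. *)
Fixpoint integral_Rn (n : nat) : ('rV[R]_n -> \bar R) -> \bar R :=
  match n return ('rV[R]_n -> \bar R) -> \bar R with
  | 0 => fun f => f 0
  | n'.+1 => fun f =>
      (\int[@lebesgue_measure R]_(t in setT)
          integral_Rn (fun v : 'rV[R]_n' => f (row_mx (const_mx t : 'rV[R]_1) v)))%E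
  end.

Definition integral_on (n : nat) (A : set 'rV[R]_n) (f : 'rV[R]_n -> \bar R) :=
  integral_Rn (fun x => if `[< A x >] then f x else 0%E).

Definition edom (n : nat) (u : 'rV[R]_n -> \bar R) : set 'rV[R]_n :=
  [set x | (u x < +oo)%E].

Definition convex_ext (n : nat) (u : 'rV[R]_n -> \bar R) : Prop :=
  (forall x, u x != -oo%E) /\
  forall (x y : 'rV[R]_n) (t : R), 0 < t < 1 ->
    (u ((1 - t) *: x + t *: y)%R <= (1 - t)%:E * u x + t%:E * u y)%E.

Definition lipschitz_in (n : nat) (A : set 'rV[R]_n) (f : 'rV[R]_n -> R) : Prop :=
  exists L : R, forall x y, A x -> A y -> `|f x - f y| <= L * `|x - y|.

Definition unitv (n : nat) (i : 'I_n) : 'rV[R]_n := delta_mx 0 i.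

Definition partial (n : nat) (i : 'I_n) (f : 'rV[R]_n -> R) : 'rV[R]_n -> R :=
  fun x => 'D_(unitv i) f x.

Definition hessian (n : nat) (f : 'rV[R]_n -> R) (x : 'rV[R]_n) : 'M[R]_n :=
  \matrix_(i, j) partial j (partial i f) x.

Definition C2_on (n : nat) (U : set 'rV[R]_n) (f : 'rV[R]_n -> R) : Prop :=
  {within U, continuous f} /\
  (forall i, (forall x, U x -> derivable f x (unitv i)) /\
             {within U, continuous (partial i f)}) /\
  (forall i j, (forall x, U x -> derivable (partial i f) x (unitv j)) /\
               {within U, continuous (partial j (partial i f))}).

Definition posdef (n : nat) (M : 'M[R]_n) : Prop :=
  forall v : 'rV[R]_n, v != 0 -> 0 < (v *m M *m v^T) 0 0.

Definition C2plus_on (n : nat) (U : set 'rV[R]_n) (f : 'rV[R]_n -> R) : Prop :=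
  C2_on U f /\ forall x, U x -> posdef (hessian f x).

Definition affine_fun (n : nat) (a : 'rV[R]_n) (b : R) (x : 'rV[R]_n) : R :=
  (x *m a^T) 0 0 + b.

Definition Pc (n : nat) (u : 'rV[R]_n -> \bar R) (m : nat) : set ('rV[R]_n -> R) :=
  [set l | exists (k : nat) (a : 'I_k.+1 -> 'rV[R]_n) (b : 'I_k.+1 -> R),
     (k.+1 <= m)%N /\
     (forall x, l x = \big[Num.max/affine_fun (a ord0) (b ord0) x]_(j < k.+1)
                          affine_fun (a j) (b j) x) /\
     (forall x, edom u x -> ((l x)%:E <= u x)%E)].

Definition triangle_p (n : nat) (p : R) (u : 'rV[R]_n -> \bar R) (m : nat) : \bar R :=
  ereal_inf [set integral_on (edom u) (fun x => ((fine (u x) - l x) `^ p)%:E)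
            | l in Pc u m].

End Defs.

(* Main.v *)
Require Import Defs.
From HB Require Import structures.
From mathcomp Require Import all_boot all_order all_algebra.
From mathcomp Require Import all_classical all_reals all_analysis.
From mathcomp Require Import measurable_realfun ring lra.
Import Order.TTheory GRing.Theory Num.Theory.
Import numFieldNormedType.Exports.
Local Open Scope classical_set_scope.
Local Open Scope ring_scope.
Set Implicit Arguments. Unset Strict Implicit. Unset Printing Implicit Defensive.

(** Rescaling and subdividing the unit cube shows that the quantization error
    m^(2p/n) min_Y J(min_(y in Y) q_H(x - y)^p) of a quadratic form q_H has the
    limit zador H.  On a small dyadic cell where u is close to a quadratic,
    u - l is, up to a factor 1 +- eta, half the squared q_H-distance to the
    nearest contact point of the affine pieces of l: a piece that comes close to
    u at y in the cell is bounded by the tangent at the minimiser of u - l over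
    the cell, and by strong convexity it is relevant to one cell only.  Hoelder's
    inequality gives the optimal distribution of the m pieces among the cells,
    and tangents at near-optimal quantizers, with a uniform net of few tangents
    near the boundary, attain it.  Hence the limit is
    2^-p (integral of zador(D^2 u)^(n/(n+2p)))^((n+2p)/n).  Applying this to
    q_H on a cube and to |.|^2 on the image of the cube under S, where
    H = S S^T, yields zador H = zador 1 * (det H)^(p/n), and delta = zador 1.
    If dom u has empty interior it lies in a hyperplane and both sides vanish. *)

(** [integral_Rn] iterates one-dimensional integrals, and the gap [u - l] is uncontrolled on the
    boundary of the domain. For nonnegative integrands each integral is a lower integral, monotone
    and covariant under affine maps in all cases, but additive only where measurability ([nice]) is
    at hand. Hence lower bounds use nice minorants supported on cells inside the domain, and upper
    bounds use nice majorants valid on the interior together with a cover of the boundary. The order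
    of the integrals is never exchanged either: the substitution that produces [det H] uses a
    triangular factor. The gradient and the Hessian enter the main argument as abstract fields [a]
    and [H] with two-sided bounds on the Bregman divergence, so that one limit theorem serves both
    for [u] and for the quadratic functions that identify the constant. The exponent [1 + al], with
    [al = 2 * p / n], comes from scaling: a cube of side [h] carries an error proportional to
    [h ^ (n + 2 * p) = (h ^ n) ^ (1 + al)]. *)

Section LowerIntegral.
Import HBNNSimple.
Variable R : realType.
Local Notation mu := (@lebesgue_measure R).
Local Open Scope ereal_scope.

(** The integral of a nonnegative function is the supremum over the simple functions below it, so
    monotonicity needs no measurability. *)
Lemma ge0_le_lower_integral (f g : R -> \bar R) :
  (forall t, 0 <= f t) -> (forall t, f t <= g t) ->
  \int[mu]_t f t <= \int[mu]_t g t.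
Proof.
move=> f0 fg; have g0 t : 0 <= g t by exact: le_trans (f0 t) (fg t).
rewrite !ge0_integralTE//; apply: le_ereal_sup => _ [h hf <-].
by exists h => // t; exact: le_trans (hf t) (fg t).
Qed.

Let measurable_affine (a b : R) :
  @measurable_fun _ _ (measurableTypeR R) (measurableTypeR R) setT
    (fun t : R => (a * t + b)%R).
Proof.
have : measurable_fun [set: R] (fun t : R => (a * t + b)%R).
  by apply: measurable_funD => //; exact: mulrl_measurable.
by [].
Qed.

Let affine_image_measure (a b : R) :
  {measure set (measurableTypeR R) -> \bar R}.
Proof.
refine (Measure.clone _ _ _ (pushforward mu
  (fun t : R => (a * t + b)%R : measurableTypeR R)) _).
exact: measurable_affine.
Defined.

Lemma lebesgue_measure_affine (a b : R) (a0 : (0 < a)%R) (A : set R) :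
  measurable A ->
  mu A = mscale (NngNum (ltW a0)) (affine_image_measure a b) A.
Proof.
move=> mA; apply/lebesgue_measure_unique => //.
move=> _ [[x y]] _ <-; rewrite /mscale /=.
transitivity (a%:E * mu `] ((x - b) / a)%R, ((y - b) / a)%R]%classic); last first.
  congr (_ * mu _); apply/seteqP; split => t /=;
    by rewrite !in_itv/= ltr_pdivrMr// ler_pdivlMr// ltrBlDr lerBrDr mulrC.
rewrite !lebesgue_measure_itv/= !lte_fin.
rewrite ltr_pM2r ?invr_gt0// ltrD2r.
case: ifPn => _; last by rewrite mule0.
by rewrite -!EFinB -EFinM; congr EFin; field; rewrite gt_eqF.
Qed.

Lemma ge0_integral_affine_measurable (f : R -> \bar R) (a b : R) : (0 < a)%R ->
  measurable_fun setT f -> (forall t, 0 <= f t) ->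
  \int[mu]_t f t = a%:E * \int[mu]_t f (a * t + b)%R.
Proof.
move=> a0 mf f0.
have := @ge0_integral_pushforward _ _ _ _ R _ (measurable_affine a b) mu setT f
  measurableT mf.
rewrite preimage_setT => <- //.
rewrite (_ : \int[mu]_t f t =
    \int[mscale (NngNum (ltW a0)) (affine_image_measure a b)]_t f t).
  by rewrite ge0_integral_mscale.
by apply: eq_measure_integral => A mA _; exact: lebesgue_measure_affine.
Qed.

(** Only one inequality needs an argument, and it is checked on the simple functions below [f],
    which are measurable; the converse is the same inequality for the inverse substitution. *)
Lemma ge0_lower_integral_affine (f : R -> \bar R) (a b : R) : (0 < a)%R ->
  (forall t, 0 <= f t) ->
  \int[mu]_t f t = a%:E * \int[mu]_t f (a * t + b)%R.
Proof.
have le_affine (g : R -> \bar R) (c d : R) : (0 < c)%R -> (forall t, 0 <= g t) ->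
    \int[mu]_t g t <= c%:E * \int[mu]_t g (c * t + d)%R.
  move=> c0 g0; rewrite {1}ge0_integralTE//; apply: ge_ereal_sup => _ [h hg <-].
  have := @integral_nnsfun _ _ _ mu setT measurableT h; rewrite patch_setT => <-.
  rewrite (@ge0_integral_affine_measurable (EFin \o h) c d)//; first last.
  - by move=> t; rewrite lee_fin.
  - by apply/measurable_EFinP; first [exact: (measurable_funPT h)|exact: (measurable_funP h)].
  rewrite lee_pmul2l//; apply: ge0_le_lower_integral => t; last exact: hg.
  by rewrite lee_fin.
move=> a0 f0; apply/eqP; rewrite eq_le le_affine//=.
have ai0 : (0 < a^-1)%R by rewrite invr_gt0.
have := le_affine (fun t => f (a * t + b)%R) a^-1%R (- (b / a))%R ai0 (fun t => f0 _).
rewrite (_ : (fun t => f (a * (a^-1 * t - b / a) + b)%R) = f); last first.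
  by apply/funext => t; congr f; field; rewrite gt_eqF.
by move=> H; rewrite -(@lee_pmul2l _ (a^-1)%:E)// muleA -EFinM mulVf ?gt_eqF// mul1e.
Qed.

(** The value [f c] may be [+oo]; the convention [+oo * 0 = 0] covers this case. *)
Lemma lower_integral_point (f : R -> \bar R) (c : R) :
  0 <= f c -> (forall t, t != c -> f t = 0) -> \int[mu]_t f t = 0.
Proof.
move=> fc0 fc; rewrite (_ : f = fun t => f c * (\1_[set c] t)%:E).
  have mc : measurable_fun setT (fun t : R => (\1_[set c] t)%:E : \bar R).
    exact/measurable_EFinP.
  rewrite ge0_integralZl// integral_indic// setIT.
  by transitivity (f c * 0); [congr (_ * _); exact: lebesgue_measure_set1|rewrite mule0].
apply/funext => t; rewrite indicE; have [->|tc] := eqVneq t c.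
  by rewrite mem_set// mule1.
by rewrite fc// memNset ?mule0//= => tc'; rewrite tc' eqxx in tc.
Qed.

Lemma ge0_lower_integralZl (k : R) (h : R -> \bar R) :
  (0 < k)%R -> (forall t, 0 <= h t) ->
  \int[mu]_t (k%:E * h t) = k%:E * \int[mu]_t h t.
Proof.
have ZL (c : R) (g : R -> \bar R) : (0 < c)%R -> (forall t, 0 <= g t) ->
    \int[mu]_t (c%:E * g t) <= c%:E * \int[mu]_t g t.
  move=> c0 g0; rewrite [leLHS]ge0_integralTE; last first.
    by move=> t; rewrite mule_ge0// lee_fin ltW.
  apply: ge_ereal_sup => _ [s sh <-].
  have sE := @integral_nnsfun _ _ _ mu setT measurableT s; rewrite patch_setT in sE.
  rewrite -sE -[leLHS]mul1e -(@mulfV _ c) ?gt_eqF// EFinM -muleA lee_pmul2l//.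
  have ms : measurable_fun setT (fun t => (s t)%:E).
    by apply/measurable_EFinP; exact: (measurable_funPT s).
  have c1 : (0 < c^-1)%R by rewrite invr_gt0.
  rewrite -ge0_integralZl//; last 2 first.
    by move=> t _; rewrite lee_fin.
    by rewrite lee_fin ltW.
  apply: ge0_le_lower_integral => t; first by rewrite mule_ge0 ?lee_fin// invr_ge0 ltW.
  have := sh t; rewrite -(@lee_pmul2l _ c^-1%:E)//.
  by rewrite muleA -(EFinM c^-1 c) mulVf ?gt_eqF// mul1e.
move=> k0 h0; apply/eqP; rewrite eq_le ZL//=.
have k1 : (0 < k^-1)%R by rewrite invr_gt0.
rewrite -(@lee_pmul2l _ k^-1%:E)// muleA -EFinM mulVf ?gt_eqF// mul1e.
rewrite (le_trans _ (ZL _ (fun t => k%:E * h t) k1 _))//; last first.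
  by move=> t; rewrite mule_ge0// lee_fin ltW.
by under [leRHS]eq_integral do rewrite muleA -EFinM mulVf ?gt_eqF// mul1e.
Qed.

End LowerIntegral.

(** * Iterated integrals and substitutions that respect the order of the variables *)

Definition cons_row (R : realType) n (t : R) (v : 'rV[R]_n) : 'rV[R]_n.+1 :=
  row_mx (const_mx t : 'rV[R]_1) v.

Section IntegralRn.
Variable R : realType.
Local Notation mu := (@lebesgue_measure R).
Local Notation J := (@integral_Rn R _).

Lemma cons_row0 n (t : R) (v : 'rV[R]_n) : cons_row t v 0 ord0 = t.
Proof.
have := row_mxEl (const_mx t : 'rV[R]_1) v 0 ord0; rewrite [RHS]mxE => {2}<-.
by congr (row_mx _ _ _ _); exact: val_inj.
Qed.

Lemma cons_rowS n (t : R) (v : 'rV[R]_n) i : cons_row t v 0 (lift ord0 i) = v 0 i.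
Proof.
have <- := row_mxEr (const_mx t : 'rV[R]_1) v 0 i.
by congr (row_mx _ _ _ _); exact: val_inj.
Qed.

Lemma cons_row_affine n (a t c : R) (v w : 'rV[R]_n) :
  a *: cons_row t v + cons_row c w = cons_row (a * t + c) (a *: v + w).
Proof.
apply/rowP => i; rewrite mxE [X in X + _]mxE; case: (unliftP ord0 i) => [j|] ->.
  by rewrite !cons_rowS !mxE.
by rewrite !cons_row0.
Qed.

Lemma cons_rowE n (v : 'rV[R]_n.+1) :
  v = cons_row (v 0 ord0) (\row_i v 0 (lift ord0 i)).
Proof.
apply/rowP => i; case: (unliftP ord0 i) => [j|] ->.
  by rewrite cons_rowS mxE.
by rewrite cons_row0.
Qed.

Local Open Scope ereal_scope.

Lemma integral_RnS n (f : 'rV[R]_n.+1 -> \bar R) :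
  J f = \int[mu]_t J (fun v => f (cons_row t v)).
Proof. by []. Qed.

Lemma integral_Rn_ge0 n (f : 'rV[R]_n -> \bar R) : (forall x, 0 <= f x) -> 0 <= J f.
Proof.
elim: n f => [|n IH] f f0 //=.
by apply: integral_ge0 => t _; exact: IH.
Qed.

Lemma le_integral_Rn n (f g : 'rV[R]_n -> \bar R) :
  (forall x, 0 <= f x) -> (forall x, f x <= g x) -> J f <= J g.
Proof.
elim: n f g => [|n IH] f g f0 fg //=.
apply: ge0_le_lower_integral => t; last exact: IH.
exact: integral_Rn_ge0.
Qed.

Lemma integral_RnZl n (f : 'rV[R]_n -> \bar R) (k : R) :
  (0 <= k)%R -> (forall x, 0 <= f x) -> J (fun x => k%:E * f x) = k%:E * J f.
Proof.
rewrite le_eqVlt => /predU1P[<-|k0]; last first.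
  elim: n f => [|n IH] f f0 //=.
  under eq_integral => t _ do rewrite IH//.
  by rewrite ge0_lower_integralZl// => t; exact: integral_Rn_ge0.
move=> f0; rewrite mul0e; under eq_fun do rewrite mul0e.
by elim: n {f f0} => [//|n IH] /=; under eq_integral do rewrite IH; rewrite integral0.
Qed.

(* Affine substitutions preserving the order of the iterated integrals need no
   Tonelli argument, so they are valid for non-measurable integrands. *)
Lemma integral_Rn_affine n (f : 'rV[R]_n -> \bar R) (a : R) (c : 'rV[R]_n) :
  (0 < a)%R -> (forall x, 0 <= f x) ->
  J f = (a ^+ n)%:E * J (fun x => f (a *: x + c)%R).
Proof.
move=> a0; elim: n f c => [|n IH] f c f0.
  by rewrite /= expr0 mul1e; congr f; apply/rowP; case.
rewrite !integral_RnS.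
under eq_integral => t _ do
  rewrite (IH (fun v => f (cons_row t v)) (\row_i c 0%R (lift ord0 i)))//.
pose g t := J (fun v : 'rV_n => f (cons_row t (a *: v + \row_i c 0%R (lift ord0 i)))).
have g0 t : 0 <= g t by exact: integral_Rn_ge0.
have an0 : (0 < a ^+ n)%R by rewrite exprn_gt0.
have -> : \int[mu]_t J (fun v => f (a *: cons_row t v + c)%R) =
          \int[mu]_t g (a * t + c 0 ord0)%R.
  apply: eq_integral => t _; congr integral_Rn; apply/funext => v.
  by rewrite [c in LHS]cons_rowE cons_row_affine.
rewrite (@ge0_lower_integral_affine _ (fun t => (a ^+ n)%:E * g t) a (c 0%R ord0))//; last first.
  by move=> t; rewrite mule_ge0// lee_fin ltW.
by rewrite ge0_lower_integralZl// muleA -EFinM exprS.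
Qed.

(** A row [(t, v)] times the block matrix is [(s t, t r + v S)]. For a fixed outer [t] the inner map
    is [S] followed by a translation, and translations are harmless for every integrand. *)
Lemma integral_Rn_triangular n (f : 'rV[R]_n.+1 -> \bar R) (s d : R)
    (r : 'rV[R]_n) (S : 'M[R]_n) :
  (0 < s)%R -> (0 < d)%R -> (forall x, 0 <= f x) ->
  (forall g : 'rV[R]_n -> \bar R, (forall x, 0 <= g x) ->
     J g = d%:E * J (fun x => g (x *m S))) ->
  J f = (s * d)%:E *
    J (fun x => f (x *m (block_mx (s%:M : 'M[R]_1) r 0%R S : 'M[R]_n.+1))).
Proof.
move=> s0 d0 f0 HS; rewrite !integral_RnS.
rewrite (@ge0_lower_integral_affine _ _ s 0%R)//; last first.
  by move=> t; exact: integral_Rn_ge0.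
rewrite EFinM -muleA; congr (_ * _).
rewrite -ge0_lower_integralZl//; last by move=> t; exact: integral_Rn_ge0.
apply: eq_integral => t _.
rewrite addr0 (@integral_Rn_affine _ _ 1%R (t *: r))//.
rewrite expr1n mul1e HS//; congr (_ * integral_Rn _); apply/funext => v; congr f.
rewrite scale1r; apply/esym; etransitivity.
  exact: (mul_row_block (const_mx t : 'rV[R]_1) v (s%:M : 'M[R]_1) r 0%R S).
rewrite mulmx0 addr0; apply: (f_equal2 (@row_mx R 1 1 n)).
  by apply/matrixP => i j; rewrite !ord1 !mxE big_ord1 !mxE eqxx mulr1n mulrC.
rewrite addrC; congr (_ + _)%R; apply/matrixP => i j.
by rewrite !ord1 !mxE big_ord1 !mxE.
Qed.

(** Induction on the dimension. If [w] has a nonzero entry after the first, every slice is again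
    supported on a hyperplane; otherwise the hyperplane fixes the first coordinate and a single
    slice survives. *)
Lemma integral_Rn_hyperplane n (f : 'rV[R]_n -> \bar R) (w : 'rV[R]_n) (b : R) :
  w != 0%R -> (forall x, 0 <= f x) ->
  (forall x, (x *m w^T) 0%R 0%R != b -> f x = 0) -> J f = 0.
Proof.
elim: n f w b => [|n IH] f w b w0 f0 fw.
  by rewrite [w]thinmx0 eqxx in w0.
have dotE t (v : 'rV[R]_n) : ((cons_row t v *m w^T) 0%R 0%R =
    t * w 0%R ord0 + (v *m (\row_i w 0%R (lift ord0 i))^T) 0%R 0%R)%R.
  rewrite mxE big_ord_recl cons_row0 mxE; congr (_ + _)%R.
  by rewrite mxE; apply: eq_bigr => i _; rewrite cons_rowS !mxE.
rewrite integral_RnS.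
have [w'0|w'0] := eqVneq (\row_i w 0%R (lift ord0 i)) (0%R : 'rV[R]_n); last first.
  under eq_integral => t _.
    rewrite (IH _ (\row_i w 0%R (lift ord0 i)) (b - t * w 0%R ord0)%R)//; first over.
    by move=> v vb; apply: fw; rewrite dotE; apply: contra vb => /eqP <-; rewrite addrAC subrr add0r.
  by rewrite integral0.
have wn0 : w 0%R ord0 != 0%R.
  apply: contra w0 => /eqP w00; apply/eqP; rewrite [w]cons_rowE w00 w'0.
  by apply/rowP => i; case: (unliftP ord0 i) => [j|] ->; rewrite ?cons_rowS ?cons_row0 !mxE.
apply: (@lower_integral_point _ _ (b / w 0%R ord0)%R).
  by apply: integral_Rn_ge0.
move=> t tb; rewrite (_ : (fun v => _) = (fun v => 0%:E * 0)).
  by rewrite (@integral_RnZl _ (fun=> 0)) ?mul0e.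
apply/funext => v; rewrite mul0e; apply: fw; rewrite dotE w'0 trmx0 mulmx0 [X in (_ + X)%R]mxE addr0.
by apply: contra tb => /eqP <-; rewrite mulfK.
Qed.

End IntegralRn.

(** * Measurability along the iterated integral *)

Section Nice.
Variable R : realType.
Local Notation mu := (@lebesgue_measure R).
Local Notation J := (@integral_Rn R _).

(* The measurability needed to compute iterated integrals, propagated through
   the recursion that defines integral_Rn. *)
Fixpoint nice (n : nat) : ('rV[R]_n -> \bar R) -> Prop :=
  match n return ('rV[R]_n -> \bar R) -> Prop with
  | 0 => fun _ => True
  | n'.+1 => fun f => (forall t, nice (fun v => f (cons_row t v))) /\
      measurable_fun setT (fun t : R => J (fun v => f (cons_row t v)))
  end.

(** Half-open, so that the cells of a grid partition a cube. *)
Definition cube n (c : 'rV[R]_n) (s : R) : set 'rV[R]_n :=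
  [set x | forall i, c 0 i <= x 0 i < c 0 i + s].

Local Open Scope ereal_scope.

Lemma nice0 n : nice (fun _ : 'rV[R]_n => 0) /\ J (fun _ : 'rV[R]_n => 0) = 0.
Proof.
elim: n => [//|n [IH IH0]]; split => [|/=]; last first.
  by under eq_integral do rewrite IH0; rewrite integral0.
by split => //=; under eq_fun do rewrite IH0; exact: measurable_cst.
Qed.

Lemma niceD n (f g : 'rV[R]_n -> \bar R) : (forall x, 0 <= f x) ->
  (forall x, 0 <= g x) -> nice f -> nice g ->
  nice (fun x => f x + g x) /\ J (fun x => f x + g x) = J f + J g.
Proof.
elim: n f g => [//|n IH] f g f0 g0 [nf mf] [ng mg].
have E t := IH _ _ (fun v => f0 (cons_row t v)) (fun v => g0 (cons_row t v))
  (nf t) (ng t).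
split; last first.
  rewrite !integral_RnS; under eq_integral do rewrite (E _).2.
  by rewrite ge0_integralD// => t _; exact: integral_Rn_ge0.
split => [t|]; first exact: (E t).1.
by under eq_fun do rewrite (E _).2; exact: emeasurable_funD.
Qed.

Lemma nice_sum n (I : Type) (r : seq I) (P : pred I) (f : I -> 'rV[R]_n -> \bar R) :
  (forall i x, P i -> 0 <= f i x) -> (forall i, P i -> nice (f i)) ->
  nice (fun x => \sum_(i <- r | P i) f i x) /\
  J (fun x => \sum_(i <- r | P i) f i x) = \sum_(i <- r | P i) J (f i).
Proof.
move=> f0 nf; elim: r => [|i r [IHn IHJ]].
  by under eq_fun do rewrite big_nil; rewrite big_nil; exact: nice0.
rewrite big_cons; under eq_fun do rewrite big_cons.
case: ifPn => // Pi; rewrite -IHJ; apply: niceD => //.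
- by move=> x; exact: f0.
- by move=> x; apply: sume_ge0 => j Pj; exact: f0.
- exact: nf.
Qed.

Lemma niceZ n (f : 'rV[R]_n -> \bar R) (k : R) : (0 <= k)%R ->
  (forall x, 0 <= f x) -> nice f -> nice (fun x => k%:E * f x).
Proof.
move=> k0; elim: n f => [//|n IH] f f0 [nf mf]; split => [t|].
  exact: (IH (fun v => f (cons_row t v)) (fun v => f0 _) (nf t)).
under eq_fun do rewrite (integral_RnZl k0)//.
exact: measurable_funeM.
Qed.

(** Monotone convergence in one variable at a time; the slice integrals of [g] are measurable as
    limits of those of [f k]. *)
Lemma nice_sup n (f : nat -> 'rV[R]_n -> \bar R) (g : 'rV[R]_n -> \bar R) :
  (forall k x, 0 <= f k x) -> (forall x, nondecreasing_seq (fun k => f k x)) ->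
  (forall k, nice (f k)) -> (forall x, g x = ereal_sup (range (fun k => f k x))) ->
  nice g /\ J g = ereal_sup (range (fun k => J (f k))).
Proof.
elim: n f g => [|n IH] f g f0 ndf nf gE; first by split => //=; rewrite gE.
have E t := IH (fun k v => f k (cons_row t v)) (fun v => g (cons_row t v))
  (fun k v => f0 k _) (fun v => ndf _) (fun k => (nf k).1 t) (fun v => gE _).
have ndJ t : nondecreasing_seq (fun k => J (fun v => f k (cons_row t v))).
  by move=> k l kl; apply: le_integral_Rn => // v; exact: ndf.
have cvJ t : J (fun v => f k (cons_row t v)) @[k --> \oo] -->
    J (fun v => g (cons_row t v)).
  by rewrite (E t).2; exact: ereal_nondecreasing_cvgn.
split; first split => [t|]; first exact: (E t).1.
  apply: (@emeasurable_fun_cvg _ _ _ _ (fun k t => J (fun v => f k (cons_row t v)))).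
  - by move=> k; exact: (nf k).2.
  - by move=> t _; exact: cvJ.
rewrite integral_RnS.
under eq_integral => t _ do rewrite -(cvg_lim (@ereal_hausdorff R) (@cvJ t)).
rewrite (@monotone_convergence _ _ _ mu setT measurableT
  (fun k t => J (fun v => f k (cons_row t v))) (fun k => (nf k).2)
  (fun k t _ => integral_Rn_ge0 (fun v => f0 k _)) (fun t _ => @ndJ t)).
apply/cvg_lim => //; apply: ereal_nondecreasing_cvgn => k l kl.
apply: ge0_le_lower_integral => t; [exact: integral_Rn_ge0|exact: ndJ].
Qed.

Lemma cube_cons n (c : 'rV[R]_n.+1) (s t : R) (v : 'rV[R]_n) :
  \1_(cube c s) (cons_row t v) = (\1_`[c 0 ord0, c 0 ord0 + s[ t *
    \1_(cube (\row_i c 0 (lift ord0 i)) s) v)%R :> R.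
Proof.
rewrite !indicE -natrM mulnb; congr (_%:R); congr nat_of_bool.
apply/idP/idP => [/set_mem cv|/andP[/set_mem ct /set_mem cv]].
  apply/andP; split; apply/mem_set.
    by have := cv ord0; rewrite cons_row0 /= in_itv.
  by move=> i; have := cv (lift ord0 i); rewrite cons_rowS mxE.
apply/mem_set => i; case: (unliftP ord0 i) => [j|] ->.
  by have := cv j; rewrite cons_rowS mxE.
by rewrite cons_row0; move: ct; rewrite /= in_itv.
Qed.

Lemma nice_cube n (c : 'rV[R]_n) (s : R) : (0 <= s)%R ->
  nice (fun x => (\1_(cube c s) x)%:E) /\
  J (fun x => (\1_(cube c s) x)%:E) = (s ^+ n)%:E.
Proof.
move=> s0; elim: n c => [|n IH] c.
  by split => //=; rewrite expr0 indicE mem_set//; case.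
have E t : J (fun v => (\1_(cube c s) (cons_row t v))%:E) =
    (\1_`[c 0 ord0, c 0 ord0 + s[ t)%:E * (s ^+ n)%:E.
  under eq_fun do rewrite cube_cons EFinM.
  by rewrite integral_RnZl ?(IH _).2// => x; rewrite lee_fin.
have mI : measurable_fun setT (fun t : R => (\1_`[c 0 ord0, c 0 ord0 + s[ t)%:E : \bar R).
  exact/measurable_EFinP.
split; last first.
  rewrite integral_RnS; under eq_integral do rewrite E muleC.
  rewrite ge0_integralZl//; last by rewrite lee_fin exprn_ge0.
  rewrite integral_indic// setIT.
  transitivity ((s ^+ n)%:E * s%:E); last by rewrite -EFinM exprSr.
  congr (_ * _); have := @lebesgue_measure_itv R `[c 0 ord0, c 0 ord0 + s[%R.
  rewrite /= lte_fin ltrDl -EFinB addrAC subrr add0r => H; rewrite [LHS]H.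
  by case: ltP => // s0'; congr EFin; apply/eqP; rewrite eq_le s0.
split => [t|].
  under eq_fun do rewrite cube_cons EFinM.
  by apply: niceZ; [|by move=> x; rewrite lee_fin|exact: (IH _).1].
under eq_fun do rewrite E muleC; exact: measurable_funeM.
Qed.

End Nice.

(** * Dyadic grids *)

Section Grid.
Variable R : realType.
Local Notation J := (@integral_Rn R _).

Definition gcell n (c : 'rV[R]_n) (L : R) (N : nat) (z : 'rV['I_N]_n) : set 'rV[R]_n :=
  cube (\row_i (c 0 i + L / N%:R * (z 0 i)%:R)) (L / N%:R).

Let index_le (h y : R) (j j' : nat) : 0 < h ->
  h * j%:R <= y -> y < h * j'%:R + h -> (j <= j')%N.
Proof.
move=> h0 jy yj'; have := le_lt_trans jy yj'.
by rewrite -[X in _ < _ + X]mulr1 -mulrDr natr1 ltr_pM2l// ltr_nat.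
Qed.

Lemma gcell_inP n (c : 'rV[R]_n) (L : R) N (z : 'rV['I_N]_n) x : gcell c L z x <->
  forall i, L / N%:R * (z 0 i)%:R <= x 0 i - c 0 i < L / N%:R * (z 0 i)%:R + L / N%:R.
Proof.
by split => H i; have := H i; rewrite ?mxE => /andP[? ?]; apply/andP; split; lra.
Qed.

Lemma gcell_cover n (c : 'rV[R]_n) (L : R) N x : 0 < L -> (0 < N)%N ->
  cube c L x -> exists z : 'rV['I_N]_n, gcell c L z x.
Proof.
case: N => // N L0 _ cx.
have h0 : 0 < L / N.+1%:R by rewrite divr_gt0// ltr0n.
pose y i := (x 0 i - c 0 i) / (L / N.+1%:R).
have yP i : (Num.truncn (y i))%:R <= y i < (Num.truncn (y i)).+1%:R.
  apply: truncn_itv; rewrite divr_ge0 ?(ltW h0)// subr_ge0.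
  by have /andP[] := cx i.
have yN i : (Num.truncn (y i) < N.+1)%N.
  have /andP[+ _] := yP i; rewrite -(ltr_nat R) => /le_lt_trans; apply.
  rewrite /y ltr_pdivrMr// mulrC divfK ?gt_eqF ?ltr0n//.
  by have /andP[_] := cx i; lra.
exists (\row_i inord (Num.truncn (y i))); apply/gcell_inP => i.
rewrite mxE inordK//.
have -> : x 0 i - c 0 i = L / N.+1%:R * y i by rewrite mulrC divfK ?gt_eqF.
have /andP[y1 y2] := yP i.
rewrite ler_pM2l// y1/= -[X in _ < _ + X]mulr1 -mulrDr ltr_pM2l// natr1.
exact: y2.
Qed.

Lemma gcell_uniq n (c : 'rV[R]_n) (L : R) N (z z' : 'rV['I_N]_n) x : 0 < L ->
  gcell c L z x -> gcell c L z' x -> z = z'.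
Proof.
case: N z z' => [|N] z z' L0 /gcell_inP zx /gcell_inP zx'.
  by apply/rowP => i; case: (z 0 i).
have h0 : 0 < L / N.+1%:R by rewrite divr_gt0// ltr0n.
apply/rowP => i; apply/val_inj/eqP; rewrite eqn_leq.
have /andP[a b] := zx i; have /andP[a' b'] := zx' i.
by rewrite (index_le h0 a b') (index_le h0 a' b).
Qed.

Lemma gcell_sub_cube n (c : 'rV[R]_n) (L : R) N (z : 'rV['I_N]_n) : 0 < L ->
  gcell c L z `<=` cube c L.
Proof.
case: N z => [|N] z L0 x /gcell_inP zx i; first by case: (z 0 i).
have h0 : 0 < L / N.+1%:R by rewrite divr_gt0// ltr0n.
have /andP[a b] := zx i.
have h1 : 0 <= L / N.+1%:R * (z 0 i)%:R by rewrite mulr_ge0 ?(ltW h0).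
have h2 : L / N.+1%:R * (z 0 i)%:R + L / N.+1%:R <= L.
  rewrite -[X in _ + X]mulr1 -mulrDr natr1 -mulrA ler_piMr ?(ltW L0)//.
  by rewrite mulrC ler_pdivrMr ?ltr0n// mul1r ler_nat.
move: a b h0 h1 h2; set A := _ * (z 0 i)%:R; set h := L / _ => a b h0 h1 h2.
by apply/andP; split; lra.
Qed.

Lemma gcell_nested n (c : 'rV[R]_n) (L : R) N M (z : 'rV['I_N]_n) (z' : 'rV['I_M]_n) x :
  0 < L -> (0 < N)%N -> M = (2 * N)%N -> gcell c L z x -> gcell c L z' x ->
  gcell c L z' `<=` gcell c L z.
Proof.
move=> L0 N0 MN /gcell_inP zx /gcell_inP zx' w /gcell_inP zw.
have h0 : 0 < L / M%:R by rewrite divr_gt0// ltr0n MN muln_gt0.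
have hE : L / N%:R = L / M%:R * 2.
  by rewrite MN natrM; field; rewrite pnatr_eq0 -lt0n.
apply/gcell_inP => i.
have /andP[a b] := zx i; have /andP[a' b'] := zx' i; have /andP[a2 b2] := zw i.
rewrite hE in a b *; set h := L / M%:R in h0 a b a' b' a2 b2 *.
(* A common point forces the finer index to be [2 z] or [2 z + 1] in each coordinate. *)
have l1 : (2 * z 0%R i <= z' 0%R i)%N.
  by apply: (index_le h0 _ b'); rewrite natrM; lra.
have l2 : (z' 0%R i <= 2 * z 0%R i + 1)%N.
  by apply: (index_le h0 a'); rewrite natrD natrM; lra.
have m1 : h * (2 * (z 0 i)%:R) <= h * (z' 0 i)%:R.
  by rewrite ler_pM2l// -natrM ler_nat.
have m2 : h * (z' 0 i)%:R <= h * (2 * (z 0 i)%:R + 1).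
  by rewrite ler_pM2l// -natrM natr1 ler_nat; move: l2; rewrite addn1.
by apply/andP; split; lra.
Qed.

Lemma gcell_corner n (c : 'rV[R]_n) (L : R) N (z : 'rV['I_N]_n) : 0 < L ->
  gcell c L z (\row_i (c 0 i + L / N%:R * (z 0 i)%:R)).
Proof.
move=> L0 i; rewrite lexx/= ltrDl divr_gt0// ltr0n.
by case: (z 0 i) => j; case: N z.
Qed.

Lemma sum_gcell n (c : 'rV[R]_n) (L : R) N (z : 'rV['I_N]_n) (P : pred 'rV['I_N]_n)
    (a : 'rV['I_N]_n -> R) x : 0 < L -> gcell c L z x ->
  \sum_(y | P y) a y * \1_(gcell c L y) x = if P z then a z else 0.
Proof.
move=> L0 zx; rewrite big_mkcond (bigD1 z)//= big1 ?addr0; last first.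
  move=> y yz; case: ifP => // _; rewrite indicE memNset ?mulr0// => yx.
  by rewrite (gcell_uniq L0 yx zx) eqxx in yz.
by case: ifP => // _; rewrite indicE mem_set// mulr1.
Qed.

Lemma nice_gcells n (c : 'rV[R]_n) (L : R) N (P : pred 'rV['I_N]_n)
    (a : 'rV['I_N]_n -> R) : 0 < L -> (forall z, 0 <= a z) ->
  nice (fun x => (\sum_(z | P z) a z * \1_(gcell c L z) x)%:E) /\
  J (fun x => (\sum_(z | P z) a z * \1_(gcell c L z) x)%:E) =
    (\sum_(z | P z) a z * (L / N%:R) ^+ n)%:E.
Proof.
move=> L0 a0; under eq_fun do rewrite -sumEFin.
have h0 : 0 <= L / N%:R :> R by rewrite divr_ge0// ltW.
have E z : (fun x => (a z * \1_(gcell c L z) x)%:E) =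
  (fun x => ((a z)%:E * (\1_(gcell c L z) x)%:E)%E) by apply/funext => x; rewrite EFinM.
have [nS ->] : nice (fun x => \sum_(z | P z) ((a z * \1_(gcell c L z) x)%:E : \bar R))%E /\
  J (fun x => \sum_(z | P z) ((a z * \1_(gcell c L z) x)%:E : \bar R))%E =
  (\sum_(z | P z) J (fun x => (a z * \1_(gcell c L z) x)%:E))%E.
  apply: nice_sum => [z x _|z _]; first by rewrite lee_fin mulr_ge0.
  by rewrite E; apply: niceZ => //; exact: (nice_cube _ h0).1.
split=> //; rewrite -sumEFin; apply: eq_bigr => z _.
rewrite E integral_RnZl//.
by rewrite (nice_cube _ h0).2 EFinM.
Qed.

(* A function that is lower semicontinuous with respect to the dyadic cells is
   the increasing limit of its lower step functions. *)
Lemma dyadic_exhaustion n (c : 'rV[R]_n) (L : R) (F : 'rV[R]_n -> R)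
    (G : forall k, pred 'rV['I_(2 ^ k)]_n) : 0 < L -> (forall x, 0 <= F x) ->
  (forall k (z : 'rV['I_(2 ^ k)]_n) (z' : 'rV['I_(2 ^ k.+1)]_n), G k z ->
     gcell c L z' `<=` gcell c L z -> G k.+1 z') ->
  (forall x e, 0 < F x -> 0 < e -> exists k (z : 'rV['I_(2 ^ k)]_n),
     [/\ G k z, gcell c L z x & forall y, gcell c L z y -> F x - e <= F y]) ->
  nice (fun x => (F x)%:E) /\
  J (fun x => (F x)%:E) = ereal_sup (range (fun k =>
    (\sum_(z | G k z) inf (F @` gcell c L z) * (L / (2 ^ k)%:R) ^+ n)%:E)).
Proof.
move=> L0 F0 hG HF.
have hlb N (z : 'rV['I_N]_n) : has_lbound (F @` gcell c L z).
  by exists 0 => _ [x _ <-].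
have hn0 N (z : 'rV['I_N]_n) : F @` gcell c L z !=set0.
  by eexists; exists (\row_i (c 0 i + L / N%:R * (z 0 i)%:R)) => //; exact: gcell_corner.
have i0 N (z : 'rV['I_N]_n) : 0 <= inf (F @` gcell c L z).
  by apply: lb_le_inf => // _ [x _ <-].
have iF N (z : 'rV['I_N]_n) x : gcell c L z x -> inf (F @` gcell c L z) <= F x.
  by move=> zx; apply: ge_inf => //; exists x.
(* The lower step function of [F] on the good cells of level [k], zero elsewhere. It increases with
   [k] because goodness passes to subcells. *)
pose phi k x := \sum_(z | G k z) inf (F @` gcell c L z) * \1_(gcell c L z) x.
have phi0 k x : 0 <= phi k x by apply: sumr_ge0 => z _; rewrite mulr_ge0.
have phiN k x : ~ (exists z : 'rV['I_(2 ^ k)]_n, G k z /\ gcell c L z x) -> phi k x = 0.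
  move=> nz; apply: big1 => z Gz; rewrite indicE memNset ?mulr0// => zx.
  by apply: nz; exists z.
have e0 k : (0 < 2 ^ k)%N by rewrite expn_gt0.
have phiS k x : phi k x <= phi k.+1 x.
  have [[z [Gz zx]]|/phiN->//] := pselect (exists z : 'rV['I_(2 ^ k)]_n, G k z /\ gcell c L z x).
  have [z' z'x] := gcell_cover L0 (e0 k.+1) (gcell_sub_cube L0 zx).
  have zz' := gcell_nested L0 (e0 k) (expnS 2 k) zx z'x.
  rewrite /phi (sum_gcell _ _ L0 zx) (sum_gcell _ _ L0 z'x) Gz (hG _ _ _ Gz zz').
  by apply: lb_le_inf => // _ [y yz <-]; apply: iF; exact: zz'.
have phiF k x : phi k x <= F x.
  have [[z [Gz zx]]|/phiN->//] := pselect (exists z : 'rV['I_(2 ^ k)]_n, G k z /\ gcell c L z x).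
  by rewrite /phi (sum_gcell _ _ L0 zx) Gz; exact: iF.
have [||||nF JF] := @nice_sup _ _ (fun k x => (phi k x)%:E) (fun x => (F x)%:E).
- by move=> k x; rewrite lee_fin.
- by move=> x; apply/nondecreasing_seqP => k; rewrite lee_fin.
- by move=> k; exact: (nice_gcells _ _ L0 _).1.
- move=> x; apply/eqP; rewrite eq_le; apply/andP; split; last first.
    by apply: ge_ereal_sup => _ [k _ <-]; rewrite lee_fin.
  have [Fx0|Fx0] := ltP 0 (F x); last first.
    have -> : F x = 0 by apply/eqP; rewrite eq_le Fx0 F0.
    by apply: le_ereal_sup_tmp; exists (phi 0%N x)%:E; [exists 0%N|rewrite lee_fin].
  apply/lee_addgt0Pr => e e_gt0; have [k [z [Gz zx zF]]] := HF _ _ Fx0 e_gt0.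
  rewrite -leeBlDr// -EFinB; apply: le_ereal_sup_tmp; exists (phi k x)%:E; first by exists k.
  rewrite lee_fin /phi (sum_gcell _ _ L0 zx) Gz.
  by apply: lb_le_inf => // _ [y yz <-]; exact: zF.
split => //; rewrite JF; apply: (f_equal (fun g : nat -> \bar R => ereal_sup (range g))).
apply/funext => k.
exact: (nice_gcells _ _ L0 _).2.
Qed.

End Grid.

(** * Quantization of quadratic forms *)

Section Forms.
Variable R : realType.
Implicit Types (n : nat) (p : R).

Lemma ler_coord n (v : 'rV[R]_n) i : `|v 0 i| <= `|v|.
Proof.
rewrite [leRHS]/Num.norm /= mx_normrE; apply/bigmax_geP; right => /=.
by exists (0, i).
Qed.

Lemma normv_le n (v : 'rV[R]_n) (e : R) : 0 <= e ->
  (forall i, `|v 0 i| <= e) -> `|v| <= e.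
Proof.
move=> e0 ve; rewrite [leLHS]/Num.norm /= mx_normrE; apply/bigmax_leP; split => //.
by move=> [i j] _ /=; rewrite ord1.
Qed.

Lemma normv_lt n (v : 'rV[R]_n) (e : R) : 0 < e ->
  (forall i, `|v 0 i| < e) -> `|v| < e.
Proof.
move=> e0 ve; rewrite [ltLHS]/Num.norm /= mx_normrE; apply/bigmax_ltP; split => //.
by move=> [i j] _ /=; rewrite ord1.
Qed.

Lemma continuous_bigsum (T : topologicalType) (I : Type) (r : seq I) (f : I -> T -> R) :
  (forall i, continuous (f i)) -> continuous (fun x => \sum_(i <- r) f i x).
Proof.
move=> cf x; elim: r => [|i r IH].
  rewrite (_ : (fun y => _) = cst 0); first exact: cvg_cst.
  by apply/funext => y; rewrite big_nil.
rewrite (_ : (fun y => _) = (fun y => f i y + \sum_(j <- r) f j y)); last first.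
  by apply/funext => y; rewrite big_cons.
exact: (cvgD (cf i x) IH).
Qed.

Definition qf n (H : 'M[R]_n) (v : 'rV[R]_n) : R := (v *m H *m v^T) 0 0.

Definition psd n (H : 'M[R]_n) := forall v, 0 <= qf H v.

Lemma qfE n (H : 'M[R]_n) v : qf H v = \sum_i \sum_j v 0 i * H i j * v 0 j.
Proof.
rewrite /qf mxE exchange_big; apply: eq_bigr => j _ /=.
by rewrite [v^T _ _]mxE [(v *m H) _ _]mxE mulr_suml; exact: eq_bigr.
Qed.

Lemma qfZ n (H : 'M[R]_n) a v : qf H (a *: v) = a ^+ 2 * qf H v.
Proof.
by rewrite /qf linearZ /= -!scalemxAl -scalemxAr scalerA mxE -expr2.
Qed.

Lemma qf_le n (H : 'M[R]_n) v :
  qf H v <= (\sum_i \sum_j `|H i j|) * `|v| ^+ 2.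
Proof.
rewrite qfE mulr_suml; apply: ler_sum => i _; rewrite mulr_suml.
apply: ler_sum => j _; apply: (le_trans (ler_norm _)).
rewrite !normrM mulrAC mulrC expr2 ler_wpM2l// ler_pM//; exact: ler_coord.
Qed.

Lemma qf_continuous n (H : 'M[R]_n) : continuous (qf H).
Proof.
rewrite (_ : qf H = fun v => \sum_i \sum_j v 0 i * H i j * v 0 j); last first.
  by apply/funext => v; exact: qfE.
apply: continuous_bigsum => i; apply: continuous_bigsum => j v.
have ci := @coord_continuous R 1 n 0 i v; have cj := @coord_continuous R 1 n 0 j v.
exact: (cvgM (cvgM ci (cvg_cst (H i j))) cj).
Qed.

(** The first centre is kept apart from the list, so the minimum is never over an empty set. *)
Fixpoint minq n (H : 'M[R]_n) (y0 : 'rV[R]_n) (s : seq 'rV[R]_n) (x : 'rV[R]_n) : R :=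
  if s is y :: s' then Num.min (qf H (x - y0)) (minq H y s' x) else qf H (x - y0).

Lemma minq_continuous n (H : 'M[R]_n) y0 s : continuous (minq H y0 s).
Proof.
have cq (y : 'rV[R]_n) : continuous (fun x : 'rV[R]_n => qf H (x - y)).
  move=> x; apply: (@continuous_comp _ _ _ (fun x : 'rV[R]_n => x - y) (qf H)).
    exact: (cvgD (@cvg_id _ _) (cvg_cst (- y))).
  exact: qf_continuous.
elim: s y0 => [|y s IH] y0 x; first exact: cq.
exact: (continuous_min (cq y0 x) (IH y x)).
Qed.

Lemma minq_le n (H : 'M[R]_n) y0 s x y : y \in y0 :: s -> minq H y0 s x <= qf H (x - y).
Proof.
elim: s y0 => [|z s IH] y0; first by rewrite inE => /eqP ->.
by rewrite inE => /predU1P[->|/IH zy] /=; rewrite ge_min ?lexx// zy orbT.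
Qed.

Lemma minq_mem n (H : 'M[R]_n) y0 s x :
  exists2 y, y \in y0 :: s & minq H y0 s x = qf H (x - y).
Proof.
elim: s y0 => [|z s IH] y0; first by exists y0; rewrite ?mem_head.
have [y ys yE] := IH z; rewrite /= minElt.
case: ifP => _; first by exists y0; rewrite ?mem_head.
by exists y => //; rewrite inE ys orbT.
Qed.

Lemma minq_ge0 n (H : 'M[R]_n) y0 s x : psd H -> 0 <= minq H y0 s x.
Proof. by move=> pH; have [y _ ->] := minq_mem H y0 s x. Qed.

Lemma minq_affine n (H : 'M[R]_n) y0 s x (a : R) c : 0 < a ->
  minq H y0 s (a *: x + c) = a ^+ 2 *
    minq H (a^-1 *: (y0 - c)) [seq a^-1 *: (y - c) | y <- s] x.
Proof.
move=> a0; have E y : qf H (a *: x + c - y) = a ^+ 2 * qf H (x - a^-1 *: (y - c)).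
  rewrite -qfZ; congr qf; rewrite scalerBr scalerA mulfV ?gt_eqF// scale1r.
  by rewrite opprB addrA.
elim: s y0 => [|y s IH] y0 /=; first exact: E.
by rewrite E IH minr_pMr// exprn_ge0// ltW.
Qed.

(** Lower semicontinuity of the power in multiplicative form, because the constants [zador (H x) p]
    at nearby points are compared up to a factor. *)
Lemma powR_lsc (a e p : R) : 0 < a -> 0 < e -> 0 < p ->
  exists2 th, 0 < th < 1 & forall b, th * a <= b -> a `^ p - e <= b `^ p.
Proof.
move=> a0 e0 p0; have ap := powR_gt0 p a0.
have [ae|ae] := leP (a `^ p) e.
  exists 2^-1; first by rewrite invr_gt0 ltr0n/= invf_lt1// ltr1n.
  by move=> b _; rewrite (le_trans _ (powR_ge0 _ _))// subr_le0.
set t := 1 - e / a `^ p.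
have t0 : 0 < t by rewrite subr_gt0 ltr_pdivrMr// mul1r.
have t1 : t < 1 by rewrite ltrBlDr ltrDl divr_gt0.
have ip : 0 < p^-1 by rewrite invr_gt0.
exists (t `^ p^-1).
  rewrite powR_gt0//=; have := gt0_ltr_powR ip; move/(_ t 1).
  by rewrite !nnegrE ler01 (ltW t0) powR1; exact.
move=> b tb; have -> : a `^ p - e = (t `^ p^-1 * a) `^ p.
  rewrite powRM ?powR_ge0 ?(ltW a0)// -powRrM mulVf ?gt_eqF// powRr1 ?(ltW t0)//.
  by rewrite /t mulrBl mul1r divfK ?gt_eqF.
apply: ge0_ler_powR; rewrite ?nnegrE ?(ltW p0)//.
  by rewrite mulr_ge0 ?powR_ge0 ?(ltW a0).
by rewrite (le_trans _ tb)// mulr_ge0 ?powR_ge0 ?(ltW a0).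
Qed.

Lemma gcell_dist n (c : 'rV[R]_n) (L : R) N (z : 'rV['I_N]_n) x y : 0 < L ->
  (0 < N)%N -> gcell c L z x -> gcell c L z y -> `|y - x| < L / N%:R.
Proof.
move=> L0 N0 /gcell_inP zx /gcell_inP zy.
have h0 : 0 < L / N%:R by rewrite divr_gt0// ltr0n.
apply: normv_lt => // i; rewrite !mxE ltr_norml.
have := zx i; have := zy i; set h := L / N%:R; set A := h * _.
by move=> /andP[? ?] /andP[? ?]; apply/andP; split; lra.
Qed.

Lemma dyadic_small (L r : R) : 0 < L -> 0 < r -> exists k : nat, L / (2 ^ k)%:R < r.
Proof.
move=> L0 r0; exists (Num.truncn (L / r)).+1.
rewrite ltr_pdivrMr ?ltr0n ?expn_gt0// mulrC -ltr_pdivrMr//.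
have /andP[_ h] := truncn_itv (ltW (divr_gt0 L0 r0)).
by rewrite (lt_le_trans h)// ler_nat ltnW// ltn_expl.
Qed.

Lemma cube_gcell0 n (c : 'rV[R]_n) (L : R) x : cube c L x -> 0 < L ->
  forall k, exists2 z : 'rV['I_(2 ^ k)]_n, gcell c L z x & gcell c L z `<=` cube c L.
Proof.
move=> cx L0 k; have [z zx] := @gcell_cover _ _ c L (2 ^ k) x L0 (expn_gt0 2 k) cx.
by exists z => //; exact: gcell_sub_cube.
Qed.

End Forms.

Section Quantization.
Variable R : realType.
Local Notation J := (@integral_Rn R _).

Definition quant n (H : 'M[R]_n) (p : R) y0 s (c : 'rV[R]_n) (l : R) : \bar R :=
  J (fun x => (\1_(cube c l) x * minq H y0 s x `^ p)%:E).

Definition ccube n (c : 'rV[R]_n) (l : R) : set 'rV[R]_n :=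
  [set x | forall i, c 0 i <= x 0 i <= c 0 i + l].

(** A version of Zador's quantization constant of order [2 * p]; the weight compensates the decay of
    the error in the number of points. The centres are confined to the closed cube, which is where
    [affine_argmin] places the contact points. *)
Definition zador n (H : 'M[R]_n) (p : R) : R :=
  inf [set r | exists y0 s, (forall y, y \in y0 :: s -> ccube 0 1 y) /\
    r = (size s).+1%:R `^ (2 * p / n%:R) * fine (quant H p y0 s 0 1)].

Lemma cube_affine n (c : 'rV[R]_n) (l : R) x : 0 < l ->
  cube c l (l *: x + c) <-> cube 0 1 x.
Proof.
move=> l0; split => h i; have := h i; rewrite !mxE => /andP[h1 h2].
  rewrite add0r -(@ler_pM2l _ l)// mulr0 -(ltr_pM2l l0) mulr1.
  by apply/andP; split; lra.
have : l * 0 <= l * x 0 i by rewrite ler_pM2l.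
have : l * x 0 i < l * 1 by rewrite ltr_pM2l// -[ltRHS]add0r.
by move=> ? ?; apply/andP; split; lra.
Qed.

Lemma quant_scale n (H : 'M[R]_n) p y0 s c l : psd H -> 0 < l ->
  quant H p y0 s c l = ((l ^+ n * l `^ (2 * p))%:E *
    quant H p (l^-1 *: (y0 - c)) [seq l^-1 *: (y - c) | y <- s] 0 1)%E.
Proof.
move=> pH l0; rewrite /quant (integral_Rn_affine c l0); last first.
  by move=> x; rewrite lee_fin mulr_ge0// powR_ge0.
rewrite EFinM -muleA; congr (_ * _)%E.
rewrite -integral_RnZl ?powR_ge0//; last first.
  by move=> x; rewrite lee_fin mulr_ge0// powR_ge0.
congr integral_Rn; apply/funext => x; rewrite minq_affine//.
rewrite powRM ?minq_ge0 ?exprn_ge0 ?(ltW l0)// -EFinM; congr EFin.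
rewrite -[l ^+ 2]powR_mulrn ?(ltW l0)// -powRrM mulrCA; congr (_ * (_ * _)).
by rewrite !indicE; congr (_%:R); congr nat_of_bool; apply/idP/idP => /set_mem h;
  apply/mem_set; apply/(cube_affine c x l0).
Qed.

Lemma nice_quant n (H : 'M[R]_n) p y0 s c l : psd H -> 0 < p -> 0 < l ->
  nice (fun x => (\1_(cube c l) x * minq H y0 s x `^ p)%:E).
Proof.
move=> pH p0 l0.
pose F x := \1_(cube c l) x * minq H y0 s x `^ p.
have F0 x : 0 <= F x by rewrite mulr_ge0// powR_ge0.
have [|x e Fx0 e0|//] := @dyadic_exhaustion _ n c l F (fun _ _ => true) l0 F0 => //.
have cx : cube c l x.
  apply: contrapT => ncx; move: Fx0; rewrite /F indicE memNset//.
  by rewrite mul0r ltxx.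
have FE y : cube c l y -> F y = minq H y0 s y `^ p.
  by move=> cy; rewrite /F indicE mem_set// mul1r.
have m0 : 0 < minq H y0 s x.
  by apply: (gt0_powR p0); [exact: minq_ge0|rewrite -FE].
have [th /andP[th0 th1] thP] := powR_lsc m0 e0 p0.
have := @minq_continuous _ _ H y0 s x.
move/cvgrPdist_lt => /(_ ((1 - th) * minq H y0 s x)).
rewrite mulr_gt0 ?subr_gt0// => /(_ isT) /nbhs_ballP[r /= r0 rP].
have [k kr] := dyadic_small l0 r0.
have [z zx zc] := cube_gcell0 cx l0 k.
exists k, z; split => // y zy; rewrite !FE//; last exact: zc.
apply: thP; have : ball x r y.
  rewrite -ball_normE /ball_/= distrC; apply: lt_trans kr.
  by apply: (gcell_dist l0 _ zx zy); rewrite expn_gt0.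
by move=> /rP; rewrite ltr_norml => /andP[_]; lra.
Qed.

Lemma quant_fin n (H : 'M[R]_n) p y0 s : psd H -> 0 < p -> ccube 0 1 y0 ->
  quant H p y0 s 0 1 \is a fin_num.
Proof.
move=> pH p0 cy; set B := \sum_i \sum_j `|H i j|.
have B0 : 0 <= B by apply: sumr_ge0 => i _; apply: sumr_ge0.
rewrite ge0_fin_numE; last first.
  by apply: integral_Rn_ge0 => x; rewrite lee_fin mulr_ge0// powR_ge0.
apply: (@le_lt_trans _ _ (J (fun x => ((B `^ p)%:E * (\1_(cube 0 1) x)%:E)%E))).
  apply: le_integral_Rn => x; first by rewrite lee_fin mulr_ge0// powR_ge0.
  rewrite -EFinM lee_fin mulrC indicE.
  have [/set_mem cx|] := boolP (x \in cube 0 1); last by rewrite !mulr0.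
  rewrite !mulr1; apply: ge0_ler_powR; rewrite ?nnegrE ?(ltW p0) ?minq_ge0//.
  apply: (le_trans (minq_le H x (mem_head y0 s))).
  apply: (le_trans (qf_le _ _)); rewrite ler_piMr// expr_le1//.
  apply: normv_le => // i; rewrite !mxE ler_norml.
  have := cx i; have := cy i; rewrite !mxE => /andP[? ?] /andP[? ?].
  by apply/andP; split; lra.
rewrite integral_RnZl ?powR_ge0//.
by rewrite (nice_cube _ ler01).2 expr1n -EFinM ltry.
Qed.

Lemma quant_ge0 n (H : 'M[R]_n) p y0 s c l : (0 <= quant H p y0 s c l)%E.
Proof. by apply: integral_Rn_ge0 => x; rewrite lee_fin mulr_ge0// powR_ge0. Qed.

Lemma zador_ge0 n (H : 'M[R]_n) p : psd H -> 0 <= zador H p.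
Proof.
move=> pH; apply: lb_le_inf.
  exists (1%:R `^ (2 * p / n%:R) * fine (quant H p 0 [::] 0 1)), 0, [::]; split => //.
  by move=> y; rewrite inE => /eqP -> i; rewrite !mxE lexx add0r ler01.
move=> _ [y0 [s [_ ->]]]; rewrite mulr_ge0 ?powR_ge0//.
by apply: fine_ge0; exact: quant_ge0.
Qed.

Lemma zador_lb_unit n (H : 'M[R]_n) p y0 s : psd H -> 0 < p ->
  (forall y, y \in y0 :: s -> ccube 0 1 y) ->
  ((zador H p * (size s).+1%:R `^ (- (2 * p / n%:R)))%:E <= quant H p y0 s 0 1)%E.
Proof.
move=> pH p0 cs; have cy0 := cs _ (mem_head _ _).
rewrite -(fineK (quant_fin s pH p0 cy0)) lee_fin powRN ler_pdivrMr ?powR_gt0 ?ltr0n//.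
rewrite mulrC; apply: ge_inf; last by exists y0, s.
exists 0 => _ [y [t [_ ->]]]; rewrite mulr_ge0 ?powR_ge0//.
by apply: fine_ge0; exact: quant_ge0.
Qed.

Lemma ccube_rescale n (c y : 'rV[R]_n) (l : R) : 0 < l -> ccube c l y ->
  ccube 0 1 (l^-1 *: (y - c)).
Proof.
move=> l0 cy i; have /andP[h1 h2] := cy i; rewrite !mxE add0r mulrC.
rewrite divr_ge0 ?(ltW l0) ?subr_ge0//= ler_pdivrMr// mul1r.
by rewrite lerBlDl.
Qed.

Lemma zador_lb n (H : 'M[R]_n) p y0 s c l M : psd H -> 0 < p -> 0 < l ->
  (forall y, y \in y0 :: s -> ccube c l y) -> (size s < M)%N ->
  ((l ^+ n * l `^ (2 * p) * (zador H p * M%:R `^ (- (2 * p / n%:R))))%:E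
     <= quant H p y0 s c l)%E.
Proof.
move=> pH p0 l0 cs sM; rewrite quant_scale// EFinM lee_pmul2l//; last first.
  by rewrite lte_fin mulr_gt0 ?exprn_gt0 ?powR_gt0.
set s' := map _ _; set y' := _ *: _.
apply: (@le_trans _ _ (zador H p * (size s').+1%:R `^ (- (2 * p / n%:R)))%:E); last first.
  apply: zador_lb_unit => // y; rewrite inE => /predU1P[->|/mapP[w ws ->]].
    by apply: ccube_rescale => //; apply: cs; rewrite mem_head.
  by apply: ccube_rescale => //; apply: cs; rewrite inE ws orbT.
rewrite lee_fin ler_wpM2l ?zador_ge0// !powRN size_map lef_pV2 ?posrE ?powR_gt0 ?ltr0n//; last first.
  exact: leq_trans sM.
apply: ge0_ler_powR; rewrite ?nnegrE ?ler0n ?ler_nat//.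
by rewrite divr_ge0// mulr_ge0// ltW.
Qed.

(* Refining a quantizer of the unit cube on a k^n grid is what makes the
   infimum defining zador a limit. *)
Lemma quant_refine n (H : 'M[R]_n) p y0 s k : psd H -> 0 < p -> (0 < k)%N ->
  (forall y, y \in y0 :: s -> ccube 0 1 y) ->
  exists y0' s', [/\ forall y, y \in y0' :: s' -> ccube 0 1 y,
    (size s').+1 = (k ^ n * (size s).+1)%N &
    (quant H p y0' s' 0 1 <= (k%:R `^ (- (2 * p)))%:E * quant H p y0 s 0 1)%E].
Proof.
move=> pH p0 k0 cs.
have k0' : 0 < k%:R :> R by rewrite ltr0n.
(* A copy of the quantizer, scaled by [1 / k], goes into each of the [k ^ n] cells. On a given cell
   the copy inside it already bounds the minimum over all centres. *)
pose corner (z : 'rV['I_k]_n) : 'rV[R]_n := \row_i ((0 : 'rV[R]_n) 0 i + 1 / k%:R * (z 0 i)%:R).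
pose pt (z : 'rV['I_k]_n) (y : 'rV[R]_n) := k%:R^-1 *: y + corner z.
pose Y := [seq pt z y | z <- enum 'rV['I_k]_n, y <- y0 :: s].
have sY : size Y = (k ^ n * (size s).+1)%N.
  by rewrite size_allpairs -cardE card_mx card_ord mul1n.
have YP w : w \in Y -> ccube 0 1 w.
  move=> /allpairsP[[z y] /= [_ ys ->]] i; have /andP[h1 h2] := cs _ ys i.
  rewrite !mxE add0r in h1 h2 *; rewrite add0r mul1r.
  have hk : 0 <= k%:R^-1 :> R by rewrite invr_ge0 ltW.
  rewrite addr_ge0 ?mulr_ge0//= -mulrDr mulrC ler_pdivrMr// mul1r.
  have := ltn_ord (z 0 i); rewrite -(ler_nat R) -natr1 => hz; lra.
case YE : Y => [|y0' s'].
  by have := sY; rewrite YE => /esym/eqP; rewrite muln_eq0 expn_eq0 -[k == 0%N]negbK -lt0n k0.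
exists y0', s'; split; first by rewrite -YE.
  by rewrite -sY YE.
have kn : 0 < k%:R^-1 :> R by rewrite invr_gt0.
pose g z x := (\1_(cube (corner z) k%:R^-1) x * minq H (pt z y0) [seq pt z y | y <- s] x `^ p)%:E.
have g0 z x : (0 <= g z x)%E by rewrite lee_fin mulr_ge0// powR_ge0.
have Jg z : J (g z) = ((k%:R ^- n * k%:R `^ (- (2 * p)))%:E * quant H p y0 s 0 1)%E.
  rewrite -[J _]/(quant H p (pt z y0) [seq pt z y | y <- s] (corner z) k%:R^-1).
  rewrite quant_scale// exprVn; congr (_ * _)%E.
    congr (_ * _)%:E; rewrite powRN -powR_inv1 ?ler0n// -powRrM mulN1r powRN.
    by [].
  have E y : k%:R^-1^-1 *: (pt z y - corner z) = y.
    by rewrite /pt addrK scalerA invrK mulfV ?gt_eqF// scale1r.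
  rewrite E -map_comp (eq_map (g := id)) ?map_id// => y /=; exact: E.
have ng z : nice (g z) by exact: nice_quant.
have [_ JS] := @nice_sum _ _ _ (enum 'rV['I_k]_n) predT g (fun z x _ => g0 z x) (fun z _ => ng z).
apply: (@le_trans _ _ (J (fun x => \sum_(z <- enum 'rV['I_k]_n) g z x)%E)).
  apply: le_integral_Rn => x; first by rewrite lee_fin mulr_ge0// powR_ge0.
  rewrite indicE; have [/set_mem cx|_] := boolP (x \in cube 0 1); last first.
    by rewrite mul0r; apply: sume_ge0.
  have [z zx] := @gcell_cover _ _ 0 1 k x ltr01 k0 cx.
  rewrite big_enum (bigD1 z)//= mul1r.
  apply: (@le_trans _ _ (g z x)); last first.
    by rewrite leeDl// sume_ge0.
  rewrite /g indicE mem_set ?mul1r; last first.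
    by move=> i; have := zx i; rewrite !mxE ?div1r ?mul1r.
  rewrite lee_fin; apply: ge0_ler_powR; rewrite ?nnegrE ?minq_ge0 ?(ltW p0)//.
  have [w wz ->] := minq_mem H (pt z y0) [seq pt z y | y <- s] x.
  apply: minq_le; rewrite -YE; move: wz; rewrite -[_ :: _]/(map (pt z) (y0 :: s)).
  move=> /mapP[y ys ->]; apply/allpairsP; exists (z, y); split => //=.
  by rewrite mem_enum.
rewrite JS big_enum /= (eq_bigr _ (fun z _ => Jg z)) sumr_const card_mx card_ord mul1n.
have -> : forall (a : \bar R) m, a \is a fin_num -> (a *+ m)%R = (m%:R%:E * a)%E.
  move=> [a| |] m // _; elim: m => [|m IH]; first by rewrite mulr0n mul0e.
  by rewrite mulrS IH -!EFinM -[LHS]EFinD; congr EFin; rewrite -natr1; ring.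
  rewrite muleA -EFinM mulrA natrX mulfV ?mul1r// expf_neq0// gt_eqF//.
by rewrite fin_numM// quant_fin//; apply: cs; rewrite mem_head.
Qed.

End Quantization.

(** * Comparison of forms, and near-optimal quantizers of every large size *)

Section Zador.
Variable R : realType.

Lemma zador_mono n (H H' : 'M[R]_n) (p a : R) : psd H -> 0 < p -> 0 < a ->
  (forall v, a * qf H v <= qf H' v) -> a `^ p * zador H p <= zador H' p.
Proof.
move=> pH p0 a0 HH'.
have pH' : psd H' by move=> v; rewrite (le_trans _ (HH' v))// mulr_ge0// ltW.
apply: lb_le_inf.
  exists (1%:R `^ (2 * p / n%:R) * fine (quant H' p 0 [::] 0 1)), 0, [::]; split => //.
  by move=> y; rewrite inE => /eqP -> i; rewrite !mxE lexx add0r ler01.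
move=> _ [y0 [s [cs ->]]]; have cy0 := cs _ (mem_head _ _).
have := zador_lb_unit pH p0 cs.
rewrite -(fineK (quant_fin s pH p0 cy0)) lee_fin powRN ler_pdivrMr ?powR_gt0 ?ltr0n// mulrC => hz.
apply: (@le_trans _ _ (a `^ p * ((size s).+1%:R `^ (2 * p / n%:R) * fine (quant H p y0 s 0 1)))).
  by rewrite ler_wpM2l ?powR_ge0.
rewrite mulrCA ler_wpM2l ?powR_ge0// -lee_fin EFinM !fineK ?quant_fin//.
rewrite /quant -integral_RnZl ?powR_ge0//; last first.
  by move=> x; rewrite lee_fin mulr_ge0// powR_ge0.
apply: le_integral_Rn => x; first by rewrite lee_fin !mulr_ge0// powR_ge0.
rewrite -EFinM lee_fin mulrCA ler_wpM2l// -powRM ?minq_ge0 ?(ltW a0)//.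
apply: ge0_ler_powR; rewrite ?nnegrE ?minq_ge0 ?(ltW p0) ?mulr_ge0 ?minq_ge0 ?(ltW a0)//.
have [y ys ->] := minq_mem H' y0 s x.
by apply: le_trans (HH' _); rewrite ler_pM2l//; exact: minq_le.
Qed.

(** A nearly optimal set of [m] points is refined with the largest [k] such that [k ^ n * m <= M].
    Then [M < (k + 1) ^ n * m], and the loss [((k + 1) / k) ^ (2 * p)] is absorbed by the gap
    between [zador H p + e / 2] and [zador H p + e]. *)
Lemma zador_ub_unit n (H : 'M[R]_n) (p e : R) : (0 < n)%N -> psd H -> 0 < p -> 0 < e ->
  exists2 m0, (0 < m0)%N & forall m, (m0 <= m)%N -> exists y0 s,
    [/\ forall y, y \in y0 :: s -> ccube 0 1 y, (size s < m)%N &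
    (quant H p y0 s 0 1 <= ((zador H p + e) * m%:R `^ (- (2 * p / n%:R)))%:E)%E].
Proof.
move=> n0 pH p0 e0; set al := 2 * p / n%:R.
have al0 : 0 < al by rewrite divr_gt0 ?mulr_gt0 ?ltr0n.
have e2 : 0 < e / 2 by rewrite divr_gt0.
have zn0 := zador_ge0 p pH.
pose Z := [set r | exists y0 s, (forall y, y \in y0 :: s -> ccube (0 : 'rV[R]_n) 1 y) /\
    r = (size s).+1%:R `^ al * fine (quant H p y0 s 0 1)].
have hZ : has_inf Z.
  split; last first.
    exists 0 => _ [y [t [_ ->]]]; rewrite mulr_ge0 ?powR_ge0//.
    by apply: fine_ge0; exact: quant_ge0.
  exists (1%:R `^ al * fine (quant H p 0 [::] 0 1)), 0, [::]; split => //.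
  by move=> y; rewrite inE => /eqP -> i; rewrite !mxE lexx add0r ler01.
have [_ [y0 [s [cs ->]]] hq] := inf_adherent e2 hZ.
rewrite -/(zador H p) -/al in hq.
set m := (size s).+1 in hq.
have m0 : 0 < m%:R :> R by rewrite ltr0n.
have cy0 := cs _ (mem_head _ _).
have qfin := quant_fin s pH p0 cy0.
set q := fine _ in hq.
have q0 : 0 <= q by apply: fine_ge0; exact: quant_ge0.
pose r := (zador H p + e) / (zador H p + e / 2).
have d0 : 0 < zador H p + e / 2 by lra.
have r1 : 1 < r by rewrite ltr_pdivlMr// mul1r; lra.
(* Thus [(1 + w) ^ (2 * p) = r], and [k >= 1 / w] gives [k + 1 <= (1 + w) * k]. *)
pose w := r `^ (2 * p)^-1 - 1.
have p20 : 0 < 2 * p by rewrite mulr_gt0.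
have w0 : 0 < w.
  rewrite subr_gt0; have := @gt0_ltr_powR R (2 * p)^-1; rewrite invr_gt0 p20.
  move=> /(_ isT 1 r); rewrite !nnegrE ler01 (ltW (lt_trans ltr01 r1)) powR1; exact.
pose k0 := (Num.truncn w^-1).+1.
have k0w : w^-1 < k0%:R by have /andP[] := truncn_itv (ltW (etrans (invr_gt0 w) w0)).
exists (k0 ^ n * m)%N; first by rewrite muln_gt0 expn_gt0.
move=> M Mm.
have exk : exists k, (k ^ n * m <= M)%N by exists k0.
have bk k : (k ^ n * m <= M)%N -> (k <= M)%N.
  move=> /(leq_trans _); apply; case: k => // k.
  by rewrite (leq_trans _ (leq_pmulr _ _))// -[X in (X <= _)%N]expn1 leq_pexp2l.
have [k kM kmax] := ex_maxnP exk bk.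
have k0k : (k0 <= k)%N by exact: kmax.
have k_gt0 : (0 < k)%N by exact: leq_trans k0k.
have kr0 : 0 < k%:R :> R by rewrite ltr0n.
have Mk : (M < k.+1 ^ n * m)%N by rewrite ltnNge; apply/negP => /kmax; rewrite ltnn.
have [y0' [s' [cs' ss' qs']]] := quant_refine pH p0 k_gt0 cs.
exists y0', s'; split => //; first by rewrite ss'.
apply: (le_trans qs'); rewrite -(fineK qfin) -/q -EFinM lee_fin.
have M0 : (0 < M)%N by rewrite (leq_trans _ Mm)// muln_gt0 expn_gt0.
set A := k%:R `^ (2 * p); set B := m%:R `^ al in hq; set C := M%:R `^ al.
have A0 : 0 < A by exact: powR_gt0.
have C0 : 0 < C by rewrite powR_gt0// ltr0n.
have hC : C <= k.+1%:R `^ (2 * p) * B.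
  have -> : k.+1%:R `^ (2 * p) * B = (k.+1 ^ n * m)%:R `^ al.
    rewrite natrM powRM ?ler0n// natrX -powR_mulrn ?ler0n// -powRrM; congr (_ `^ _ * _).
    by rewrite /al; field; rewrite pnatr_eq0 -lt0n.
  by apply: ge0_ler_powR; rewrite ?nnegrE ?ler0n ?(ltW al0)// ler_nat ltnW.
have hD : k.+1%:R `^ (2 * p) <= r * A.
  have -> : r * A = ((1 + w) * k%:R) `^ (2 * p).
    rewrite powRM ?ler0n//; last by lra.
    rewrite /w addrC subrK -powRrM mulVf ?gt_eqF// powRr1//.
    by rewrite ltW// (lt_trans ltr01).
  apply: ge0_ler_powR; rewrite ?nnegrE ?ler0n ?(ltW p20) ?mulr_ge0 ?ler0n//; first by lra.
  rewrite -natr1 mulrDl mul1r lerD2l.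
  have wk : w^-1 <= k%:R by rewrite ltW// (lt_le_trans k0w)// ler_nat.
  by rewrite -(ler_pM2l w0) mulfV ?gt_eqF// in wk.
rewrite !powRN -/A -/al -/C mulrC ler_pdivrMr// mulrAC ler_pdivlMr//.
apply: (@le_trans _ _ (q * (k.+1%:R `^ (2 * p) * B))); first by rewrite ler_wpM2l.
rewrite mulrCA -[X in _ <= X](_ : r * A * (zador H p + e / 2) = _); last first.
  by rewrite /r mulrAC divfK ?gt_eqF.
by rewrite ler_pM ?powR_ge0 ?mulr_ge0 ?powR_ge0// mulrC ltW.
Qed.

Lemma zador_ub n (H : 'M[R]_n) (p e : R) : (0 < n)%N -> psd H -> 0 < p -> 0 < e ->
  exists2 m0, (0 < m0)%N & forall m c l, (m0 <= m)%N -> 0 < l -> exists y0 s,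
    [/\ forall y, y \in y0 :: s -> ccube c l y, (size s < m)%N &
    (quant H p y0 s c l <= (l ^+ n * l `^ (2 * p) *
      ((zador H p + e) * m%:R `^ (- (2 * p / n%:R))))%:E)%E].
Proof.
move=> n0 pH p0 e0; have [m0 m00 hm0] := zador_ub_unit n0 pH p0 e0.
exists m0 => // m c l mm l0; have [y0 [s [cs sm hq]]] := hm0 m mm.
exists (l *: y0 + c), [seq l *: y + c | y <- s]; split.
- have h y : ccube 0 1 y -> ccube c l (l *: y + c).
    move=> cy i; have /andP[h1 h2] := cy i; rewrite !mxE in h1 h2 *.
    rewrite add0r in h2; rewrite lerDr mulr_ge0 ?(ltW l0)//= addrC lerD2l.
    by rewrite ger_pMr.
  by move=> _ /(@mapP _ _ (fun y => l *: y + c) (y0 :: s))[y ys ->]; exact/h/cs.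
- by rewrite size_map.
rewrite quant_scale// [X in (_ <= X)%E]EFinM lee_pmul2l//; last first.
  by rewrite lte_fin mulr_gt0 ?exprn_gt0 ?powR_gt0.
have E y : l^-1 *: (l *: y + c - c) = y.
  by rewrite addrK scalerA mulVf ?gt_eqF// scale1r.
by rewrite E -map_comp (eq_map (g := id)) ?map_id// => y /=; exact: E.
Qed.

End Zador.

(** * Optimal allocation of a number of points among cells *)

Section Holder.
Variable R : realType.

Lemma ln_le_subr1 (x : R) : 0 < x -> ln x <= x - 1.
Proof.
move=> x0; rewrite -[leRHS]expRK ler_ln ?posrE ?expR_gt0//.
by apply: le_trans (expR_ge1Dx _); lra.
Qed.

Lemma powRN_tangent (x al : R) : 0 < x -> 0 < al -> 1 + al - al * x <= x `^ (- al).
Proof.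
move=> x0 al0; rewrite /powR gt_eqF//; apply: le_trans (expR_ge1Dx _).
have := ln_le_subr1 x0; rewrite -(ler_pM2l al0); lra.
Qed.

(** The tangent of [mu |-> c * mu ^ (- al)] at [mu = c ^ (1 / (1 + al)) / lam]. The point is chosen
    so that the slope [- al * lam ^ (1 + al)] does not depend on [c]: [lam] acts as a Lagrange
    multiplier. *)
Lemma powRN_tangent_scaled (c mu lam al : R) : 0 <= c -> 0 < mu -> 0 < lam -> 0 < al ->
  (1 + al) * c `^ (1 + al)^-1 * lam `^ al - al * (lam `^ al * lam) * mu <= c * mu `^ (- al).
Proof.
move=> c0 mu0 lam0 al0; have al1 : 0 < 1 + al by lra.
have la := powR_gt0 al lam0.
have [c_eq0|c_gt0] := eqVneq c 0.
  rewrite c_eq0 powR0 ?invr_eq0 ?gt_eqF// mulr0 !mul0r sub0r oppr_le0.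
  by rewrite !mulr_ge0// ltW.
have {c_gt0}c_gt0 : 0 < c by rewrite lt_def c_gt0.
set d := c `^ (1 + al)^-1; have d0 : 0 < d by exact: powR_gt0.
have cE : c = d * d `^ al.
  rewrite -{1}[d]powRr1 ?(ltW d0)// -powRD; last by rewrite gt_eqF.
  by rewrite -powRrM mulVf ?gt_eqF// powRr1 ?(ltW c_gt0).
have x0 : 0 < mu * lam / d by rewrite divr_gt0 ?mulr_gt0.
have := powRN_tangent x0 al0; rewrite -(ler_pM2l (mulr_gt0 d0 la)).
have -> : d * lam `^ al * (mu * lam / d) `^ (- al) = c * mu `^ (- al).
  rewrite !powRN !powRM ?(ltW mu0) ?(ltW lam0) ?invr_ge0 ?(ltW d0) ?mulr_ge0 ?(ltW mu0) ?(ltW lam0)//.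
  rewrite -[d^-1]powR_inv1 ?(ltW d0)// -powRrM mulN1r powRN cE.
  by field; rewrite !gt_eqF ?powR_gt0.
apply: le_trans; rewrite le_eqVlt; apply/orP; left; apply/eqP.
by field; rewrite gt_eqF.
Qed.

Lemma holder_allocation (I : finType) (P : pred I) (c mu : I -> R) (al : R) : 0 < al ->
  (forall i, P i -> 0 <= c i) -> (forall i, P i -> 0 < mu i) ->
  (\sum_(i | P i) c i `^ (1 + al)^-1) `^ (1 + al) * (\sum_(i | P i) mu i) `^ (- al)
    <= \sum_(i | P i) c i * mu i `^ (- al).
Proof.
move=> al0 c0 mu0; have al1 : 0 < 1 + al by lra.
set S := \sum_(i | P i) _; set M := \sum_(i | P i) _.
have S0 : 0 <= S by apply: sumr_ge0 => i _; exact: powR_ge0.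
have [SE|S_neq0] := eqVneq S 0.
  rewrite SE powR0 ?gt_eqF// mul0r; apply: sumr_ge0 => i Pi.
  by rewrite mulr_ge0 ?c0 ?powR_ge0.
have S_gt0 : 0 < S by rewrite lt_def S_neq0.
have M0 : 0 < M.
  rewrite lt_def sumr_ge0 ?andbT; last by move=> i Pi; rewrite ltW ?mu0.
  apply: contra S_neq0; rewrite psumr_eq0; last by move=> i Pi; rewrite ltW ?mu0.
  move=> /allP M0; apply/eqP; apply: big1 => i Pi.
  by have := M0 i (mem_index_enum i); rewrite Pi/= gt_eqF ?mu0.
(* With this multiplier the points of tangency sum to [M], so the tangents sum to the value of the
   optimal allocation. *)
pose lam := S / M; have lam0 : 0 < lam by rewrite divr_gt0.
apply: (@le_trans _ _ (\sum_(i | P i)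
  ((1 + al) * c i `^ (1 + al)^-1 * lam `^ al - al * (lam `^ al * lam) * mu i))); last first.
  by apply: ler_sum => i Pi; apply: powRN_tangent_scaled; rewrite ?c0 ?mu0.
rewrite sumrB -mulr_suml -!mulr_sumr -/S -/M le_eqVlt; apply/orP; left; apply/eqP.
rewrite powRD; last by rewrite gt_eqF.
rewrite powRr1// powRN.
have -> : lam `^ al = S `^ al / M `^ al.
  rewrite powRM ?(ltW S_gt0) ?invr_ge0 ?(ltW M0)//; congr (_ * _).
  by rewrite -[M^-1]powR_inv1 ?(ltW M0)// -powRrM mulN1r powRN.
by rewrite /lam; field; rewrite !gt_eqF ?powR_gt0.
Qed.

End Holder.

(** * Convex bodies *)

Section Body.
Variable R : realType.
Local Notation J := (@integral_Rn R _).

Definition interiorV n (A : set 'rV[R]_n) : set 'rV[R]_n := interior A.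

Lemma interiorP n (A : set 'rV[R]_n) x :
  (interiorV A) x <-> exists2 r : R, 0 < r & forall y, `|y - x| < r -> A y.
Proof.
split => [/nbhs_ballP[r /= r0 rA]|[r r0 rA]].
  by exists r => // y yx; apply: rA; rewrite -ball_normE /ball_/= distrC.
apply/nbhs_ballP; exists r => //= y; rewrite -ball_normE /ball_/= distrC.
exact: rA.
Qed.

Lemma dyadic_small_above (L r : R) (k1 : nat) : 0 < L -> 0 < r ->
  exists2 k : nat, (k1 <= k)%N & L / (2 ^ k)%:R < r.
Proof.
move=> L0 r0; have [k kr] := dyadic_small L0 r0; exists (k1 + k)%N; first exact: leq_addr.
apply: le_lt_trans kr; rewrite ler_pM2l// lef_pV2 ?posrE ?ltr0n ?expn_gt0//.
by rewrite ler_nat leq_pexp2l// leq_addl.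
Qed.

Lemma exprD1_le n : exists2 C : R, 0 <= C &
  forall th : R, 0 <= th <= 1 -> (1 + th) ^+ n <= 1 + C * th.
Proof.
elim: n => [|n [C C0 hC]]; first by exists 0 => // th _; rewrite expr0 mul0r addr0.
exists (1 + 2 * C) => [|th /andP[t0 t1]]; first by lra.
rewrite exprS; have h := hC th; rewrite t0 t1 in h.
apply: (@le_trans _ _ ((1 + th) * (1 + C * th))).
  by rewrite ler_wpM2l ?h//; lra.
have : C * th * th <= C * th by rewrite ler_piMr// mulr_ge0.
lra.
Qed.

Variables (n : nat) (A : set 'rV[R]_n).
Hypothesis convA : forall x y (t : R), A x -> A y -> 0 <= t <= 1 ->
  A ((1 - t) *: x + t *: y).
Variable x0 : 'rV[R]_n.
Hypothesis x0A : (interiorV A) x0.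
Variables (c : 'rV[R]_n) (L : R).
Hypotheses (L0 : 0 < L) (AL : A `<=` cube c L).

(** Every point near the contracted one divides the segment from [x] to some point [v] of the ball
    around [x0] in the ratio fixed by [th]. The radius of that ball is all that matters, so one [d]
    serves for the whole of [A]. *)
Lemma interior_shrink (th : R) : 0 < th -> exists2 d, 0 < d & forall x y, A x ->
  `|y - x| < d -> (interiorV A) (x0 + (1 + th)^-1 *: (y - x0)).
Proof.
move=> th0; have [r r0 rA] := (interiorP A x0).1 x0A.
have t1 : 0 < 1 + th by lra.
exists (th * (r / 2)) => [|x y Ax yx]; first by rewrite !mulr_gt0 ?invr_gt0.
apply/interiorP; exists (th / (1 + th) * (r / 2)) => [|w wd].
  by rewrite mulr_gt0 ?divr_gt0.
set w' := x0 + _ in wd.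
pose v := x0 + th^-1 *: (y - x) + ((1 + th) / th) *: (w - w').
have Av : A v.
  apply: rA; have -> : v - x0 = th^-1 *: (y - x) + ((1 + th) / th) *: (w - w').
    by apply/rowP => i; rewrite !mxE; ring.
  apply: (le_lt_trans (ler_normD _ _)); rewrite !normrZ.
  have -> : r = r / 2 + r / 2 by lra.
  rewrite ger0_norm ?invr_ge0 ?(ltW th0)// ger0_norm ?divr_ge0 ?(ltW th0) ?(ltW t1)//.
  apply: ltrD; first by rewrite mulrC ltr_pdivrMr// mulrC.
  rewrite -(@ltr_pM2l _ (th / (1 + th))) ?divr_gt0//.
  by rewrite mulrA -[th / (1 + th)]invf_div mulVf ?mul1r ?gt_eqF ?divr_gt0// invf_div.
have := @convA x v (th / (1 + th)) Ax Av.
have -> : (1 - th / (1 + th)) *: x + (th / (1 + th)) *: v = w.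
  by apply/rowP => i; rewrite /v /w' !mxE; field; rewrite !gt_eqF.
apply; rewrite divr_ge0 ?(ltW th0) ?(ltW t1)//= ler_pdivrMr// mul1r; lra.
Qed.

Definition cell_meets k (z : 'rV['I_(2 ^ k)]_n) := `[< exists x, A x /\ gcell c L z x >].

Section Cells.
Variable G : forall k, pred 'rV['I_(2 ^ k)]_n.
Hypothesis hG : forall k (z : 'rV['I_(2 ^ k)]_n) (z' : 'rV['I_(2 ^ k.+1)]_n), G z ->
  gcell c L z' `<=` gcell c L z -> G z'.
Hypothesis GA : forall k (z : 'rV['I_(2 ^ k)]_n), G z -> gcell c L z `<=` (interiorV A).
Hypothesis Gex : forall x, (interiorV A) x -> exists k (z : 'rV['I_(2 ^ k)]_n), G z /\ gcell c L z x.

Lemma integral_interior : J (fun x => (\1_(interiorV A) x)%:E) =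
  ereal_sup (range (fun k => (\sum_(z : 'rV['I_(2 ^ k)]_n | G z) (L / (2 ^ k)%:R) ^+ n)%:E)).
Proof.
have [//|x e|_ ->] := @dyadic_exhaustion _ n c L (\1_(interiorV A)) G L0 _ hG.
  rewrite indicE; have [/set_mem Ax|] := boolP (x \in (interiorV A)); last by rewrite ltxx.
  move=> _ e0; have [k [z [Gz zx]]] := Gex Ax.
  exists k, z; split => // y zy; rewrite indicE mem_set; last exact: GA zy.
  by rewrite gerBl ltW.
apply: (f_equal (fun g : nat -> \bar R => ereal_sup (range g))).
apply/funext => k; congr EFin; apply: eq_bigr => z Gz.
rewrite (_ : inf _ = 1) ?mul1r//.
rewrite (_ : [set _ | _ in _] = [set 1]) ?inf1//.
apply/seteqP; split => [_ [x zx <-]|_ ->].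
  by have -> : x \in interiorV A by apply/mem_set; exact: GA zx.
exists (\row_i (c 0 i + L / (2 ^ k)%:R * (z 0 i)%:R)); first exact: gcell_corner.
by rewrite mem_set//; apply: (GA Gz); exact: gcell_corner.
Qed.

Lemma good_above x k1 : interiorV A x ->
  exists k (z : 'rV['I_(2 ^ k)]_n), [/\ (k1 <= k)%N, G z & gcell c L z x].
Proof.
move=> Ax; have [k [z [Gz zx]]] := Gex Ax.
elim: k1 => [|k1 [k' [z' [kk' Gz' zx']]]]; first by exists k, z.
have [z2 zx2] := @gcell_cover _ _ c L (2 ^ k'.+1) x L0 (expn_gt0 2 _) (gcell_sub_cube L0 zx').
exists k'.+1, z2; split => //; apply: hG Gz' _.
by apply: (gcell_nested L0 _ (expnS 2 k') zx' zx2); rewrite expn_gt0.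
Qed.

End Cells.

(** The boundary of a convex body is negligible. At a fine level each cell that meets [A] lies in
    the dilation of the interior about [x0] by [1 + th], of volume at most [(1 + C * th) * v],
    whereas the good cells exhaust the volume [v] of the interior. *)
Lemma bad_cells_small (G : forall k, pred 'rV['I_(2 ^ k)]_n) (e : R) :
  (forall k (z : 'rV['I_(2 ^ k)]_n) (z' : 'rV['I_(2 ^ k.+1)]_n), G k z ->
    gcell c L z' `<=` gcell c L z -> G k.+1 z') ->
  (forall k (z : 'rV['I_(2 ^ k)]_n), G k z -> gcell c L z `<=` interiorV A) ->
  (forall x, interiorV A x -> exists k (z : 'rV['I_(2 ^ k)]_n), G k z /\ gcell c L z x) -> 0 < e -> exists k,
  \sum_(z : 'rV['I_(2 ^ k)]_n | cell_meets z && ~~ G k z) (L / (2 ^ k)%:R) ^+ n <= e.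
Proof.
move=> hG GA Gex e0; set V := J (fun x => (\1_(interiorV A) x)%:E).
have V0 : (0 <= V)%E by apply: integral_Rn_ge0 => x; rewrite lee_fin.
have VL : (V <= (L ^+ n)%:E)%E.
  rewrite -(nice_cube c (ltW L0)).2; apply: le_integral_Rn => x; rewrite lee_fin//.
  rewrite !indicE; have [/set_mem Ax|//] := boolP (x \in (interiorV A)).
  by rewrite mem_set//; apply: AL; exact: interior_subset Ax.
have Vfin : V \is a fin_num.
  by rewrite ge0_fin_numE// (le_lt_trans VL)// ltry.
set v := fine V; have v0 : 0 <= v by exact: fine_ge0.
have [C C0 hC] := exprD1_le n.
(* Each of [th] and [e'] may use up half of [e]: the dilation adds at most [C * th * v], and the
   good cells miss at most [e']. *)
pose e' := e / (2 * (1 + C)); have e'0 : 0 < e' by rewrite divr_gt0//; lra.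
pose th := Num.min 1 (e / (2 * (1 + C) * (1 + v))).
have d0 : 0 < 2 * (1 + C) * (1 + v) by rewrite !mulr_gt0//; lra.
have th0 : 0 < th by rewrite lt_min ltr01 divr_gt0.
have th1 : th <= 1 by rewrite ge_min lexx.
have [d dd0 hd] := interior_shrink th0.
have bound k : L / (2 ^ k)%:R < d ->
    \sum_(z : 'rV['I_(2 ^ k)]_n | cell_meets z && ~~ G k z) (L / (2 ^ k)%:R) ^+ n +
    \sum_(z : 'rV['I_(2 ^ k)]_n | G k z) (L / (2 ^ k)%:R) ^+ n <= (1 + C * th) * v.
  move=> kd; have Gm (z : 'rV['I_(2 ^ k)]_n) : G k z -> cell_meets z.
    move=> Gz; apply/asboolP; exists (\row_i (c 0 i + L / (2 ^ k)%:R * (z 0 i)%:R)).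
    by split; [apply: interior_subset; apply: (GA _ _ Gz)|]; exact: gcell_corner.
  have -> : \sum_(z : 'rV['I_(2 ^ k)]_n | cell_meets z && ~~ G k z) (L / (2 ^ k)%:R) ^+ n +
    \sum_(z : 'rV['I_(2 ^ k)]_n | G k z) (L / (2 ^ k)%:R) ^+ n =
    \sum_(z : 'rV['I_(2 ^ k)]_n | cell_meets z) 1 * (L / (2 ^ k)%:R) ^+ n.
    rewrite [RHS](bigID (G k))/= addrC; congr (_ + _).
      by apply: eq_bigr => z _; rewrite mul1r.
    apply: eq_big => [z|z _]; last by rewrite mul1r.
    by have [Gz|//] := boolP (G k z); rewrite ?andbT ?andbF// Gm.
  rewrite -lee_fin -(nice_gcells c (@cell_meets k) L0 (fun=> ler01)).2.
  have t1 : 0 < 1 + th by lra.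
  apply: (@le_trans _ _ (((1 + th) ^+ n)%:E * V)%E); last first.
    by rewrite -(fineK Vfin) -/v -EFinM lee_fin ler_wpM2r// hC// th1 ltW.
  pose g (x : 'rV[R]_n) := (\1_(interiorV A) (x0 + (1 + th)^-1 *: (x - x0)))%:E : \bar R.
  have -> : (((1 + th) ^+ n)%:E * V)%E = J g.
    rewrite [RHS](integral_Rn_affine (- (th *: x0)) t1); last by move=> x; rewrite lee_fin.
    congr (_ * integral_Rn _)%E; apply/funext => x; rewrite /g; congr (\1_ _ _)%:E.
    by apply/rowP => i; rewrite !mxE; field; rewrite gt_eqF.
  apply: le_integral_Rn => x.
    by rewrite lee_fin; apply: sumr_ge0 => z _; rewrite mul1r.
  rewrite lee_fin; have [cx|ncx] := pselect (cube c L x); last first.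
    rewrite big1 // => z _; rewrite indicE memNset ?mulr0// => zx.
    by apply: ncx; exact: gcell_sub_cube zx.
  have [z zx] := @gcell_cover _ _ c L (2 ^ k) x L0 (expn_gt0 2 k) cx.
  rewrite (sum_gcell _ _ L0 zx); case: ifPn => // /asboolP[y [Ay zy]].
  rewrite indicE mem_set//; apply: (hd y) => //; apply: lt_trans kd.
  by apply: gcell_dist zx => //; rewrite expn_gt0.
have [k2 k2d] := dyadic_small L0 dd0.
have lev k : (k2 <= k)%N -> L / (2 ^ k)%:R < d.
  move=> kk; apply: le_lt_trans k2d; rewrite ler_pM2l// lef_pV2 ?posrE ?ltr0n ?expn_gt0//.
  by rewrite ler_nat leq_pexp2l.
have good0 k : 0 <= \sum_(z : 'rV['I_(2 ^ k)]_n | G k z) (L / (2 ^ k)%:R) ^+ n.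
  by apply: sumr_ge0 => z _; rewrite exprn_ge0// divr_ge0// ltW.
have hthv : C * th * v <= e / 2.
  have h1 : th <= e / (2 * (1 + C) * (1 + v)) by rewrite ge_min lexx orbT.
  rewrite ler_pdivlMr// in h1.
  have h2 : C * th * v <= th * ((1 + C) * (1 + v)).
    have : 0 <= th * C by rewrite mulr_ge0// ltW.
    have : 0 <= th * v by rewrite mulr_ge0// ltW.
    lra.
  lra.
(* Coarse levels are discarded, since [bound] needs a mesh below [d]. If the supremum selects a
   level below [k2], its sum is empty, hence [v < e'], and level [k2] works because the whole
   dilated body is small. *)
pose G' k (z : 'rV['I_(2 ^ k)]_n) := (k2 <= k)%N && G k z.
have VE : V = ereal_sup (range (fun k =>
    (\sum_(z : 'rV['I_(2 ^ k)]_n | G' k z) (L / (2 ^ k)%:R) ^+ n)%:E)).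
  apply: integral_interior.
  - by move=> k z z' /andP[kk Gz] /(hG _ _ _ Gz) Gz'; rewrite /G' Gz' (leq_trans kk).
  - by move=> k z /andP[_]; exact: GA.
  - move=> x Ax; have [k [z [kk Gz zx]]] := good_above hG Gex k2 Ax.
    by exists k, z; rewrite /G' kk.
have : (V - e'%:E < V)%E by rewrite lteBlDr// lteDl// lte_fin.
rewrite {2}VE => /ereal_sup_gt[_ [k _ <-]]; rewrite -(fineK Vfin) -/v -EFinB lte_fin => vk.
have e'e : e' <= e / 2.
  by rewrite /e' invfM mulrA ler_piMr ?divr_ge0 ?(ltW e0)// invf_le1; lra.
have e'C : (1 + C) * e' = e / 2 by rewrite /e'; field; rewrite gt_eqF//; lra.
have [kk|kk] := leqP k2 k.
  exists k; have := bound k (lev k kk).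
  rewrite (eq_bigl (G k)) in vk; last by move=> z; rewrite /G' kk.
  lra.
have ve : v < e'.
  move: vk; rewrite big_pred0; first by lra.
  by move=> z; rewrite /G' leqNgt kk.
exists k2; have := bound k2 k2d; have := good0 k2.
have : (1 + C * th) * v <= (1 + C) * e'.
  rewrite ler_pM//; first by rewrite addr_ge0// mulr_ge0// ltW.
    by rewrite lerD2l ler_piMr.
  exact: ltW.
lra.
Qed.

Let inner k (z : 'rV['I_(2 ^ k)]_n) := `[< gcell c L z `<=` interiorV A >].

Lemma inner_cell_exists x k1 (r : R) : interiorV A x -> 0 < r ->
  exists k (z : 'rV['I_(2 ^ k)]_n), [/\ (k1 <= k)%N, gcell c L z x,
    L / (2 ^ k)%:R < r & gcell c L z `<=` interiorV A].
Proof.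
move=> Ax r0; have /interiorP[r' r'0 rA] : interiorV (interiorV A) x by exact: nbhs_interior.
have [k kk kr] : exists2 k, (k1 <= k)%N & L / (2 ^ k)%:R < Num.min r r'.
  by apply: dyadic_small_above; rewrite ?lt_min ?r0.
have [z zx] := @gcell_cover _ _ c L (2 ^ k) x L0 (expn_gt0 2 k) (AL (interior_subset Ax)).
move: kr; rewrite lt_min => /andP[kr kr'].
exists k, z; split => // y zy; apply: rA; apply: lt_trans kr'.
by apply: (gcell_dist L0 _ zx zy); rewrite expn_gt0.
Qed.

(* Only the values on the interior matter, even for integrands that are not
   measurable on the boundary: the boundary is covered infinitely often by
   cells of small total volume. *)
Lemma integral_on_interior (h phi : 'rV[R]_n -> \bar R) :
  (forall x, 0 <= h x)%E -> (forall x, 0 <= phi x)%E -> nice phi ->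
  (forall x, interiorV A x -> (h x <= phi x)%E) ->
  (integral_on A h <= J phi)%E.
Proof.
move=> h0 phi0 nphi hphi; apply/lee_addgt0Pr => e e0.
(* With volumes [e / 2 ^ (j + 1)] all the covers together cost at most [e]. *)
have Q j : exists k, \sum_(z : 'rV['I_(2 ^ k)]_n | cell_meets z && ~~ inner z)
    (L / (2 ^ k)%:R) ^+ n <= e / (2 ^ j.+1)%:R.
  apply: bad_cells_small.
  - by move=> k z z' /asboolP zA z'z; apply/asboolP => x /z'z /zA.
  - by move=> k z /asboolP.
  - move=> x Ax; have [k [z [_ zx _ zA]]] := inner_cell_exists 0 Ax ltr01.
    by exists k, z; split => //; exact/asboolP.
  - by rewrite divr_gt0// ltr0n expn_gt0.
have [K hK] := choice Q.
pose psi j x := (\sum_(z : 'rV['I_(2 ^ K j)]_n | cell_meets z && ~~ inner z)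
  1 * \1_(gcell c L z) x)%:E : \bar R.
have psi0 j x : (0 <= psi j x)%E by rewrite lee_fin; apply: sumr_ge0 => z _; rewrite mul1r.
have psiN j := nice_gcells c (fun z : 'rV['I_(2 ^ K j)]_n => cell_meets z && ~~ inner z) L0 (fun=> ler01).
pose Psi m x := (\sum_(j < m) psi j x)%E.
have PsiN m := @nice_sum _ n _ (index_enum 'I_m) predT (fun j : 'I_m => psi j)
  (fun j x _ => psi0 j x) (fun j _ => (psiN j).1).
have [||||nP JP] := @nice_sup _ n Psi (fun x => ereal_sup (range (fun m => Psi m x))).
- by move=> m x; exact: sume_ge0.
- by move=> x; apply/nondecreasing_seqP => m; rewrite /Psi big_ord_recr/= leeDl.
- by move=> m; exact: (PsiN m).1.
- by [].
set psiS := fun x => ereal_sup _ in nP JP.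
have psiS0 x : (0 <= psiS x)%E.
  by apply: le_ereal_sup_tmp; exists (Psi 0%N x); [exists 0%N|rewrite /Psi big_ord0].
have Je : (J psiS <= e%:E)%E.
  rewrite JP; apply: ge_ereal_sup => _ [m _ <-]; rewrite (PsiN m).2.
  apply: (@le_trans _ _ (\sum_(j < m) (e / (2 ^ j.+1)%:R)%:E)%E).
    by apply: lee_sum => j _; rewrite (psiN j).2 lee_fin; under eq_bigr do rewrite mul1r; exact: hK.
  rewrite sumEFin lee_fin; suff -> : \sum_(j < m) e / (2 ^ j.+1)%:R = e - e / (2 ^ m)%:R.
    by rewrite gerBl divr_ge0// ltW.
  elim: m => [|m IH]; first by rewrite big_ord0 expn0 divr1 subrr.
  rewrite big_ord_recr/= IH expnS natrM; field.
  by rewrite pnatr_eq0 -lt0n expn_gt0.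
apply: (@le_trans _ _ (J (fun x => phi x + psiS x)%E)); last first.
  by rewrite (niceD _ _ nphi nP).2// leeD2l.
apply: le_integral_Rn => x; first by case: ifP.
case: ifPn => [/asboolP Ax|_]; last by rewrite adde_ge0.
have [Aix|nAix] := pselect (interiorV A x).
  by rewrite (le_trans (hphi _ Aix))// leeDl.
(* At each level [K j] a point of [A] outside the interior lies in a cell that meets [A] and is not
   inner, so every [psi j] is at least 1 there. *)
suff -> : psiS x = +oo%E by rewrite addey ?leey// gt_eqF// (lt_le_trans _ (phi0 x)).
apply: eq_infty => r; pose m := (Num.truncn `|r|).+1.
apply: le_ereal_sup_tmp; exists (Psi m x); first by exists m.
have psi1 j : (1 <= psi j x)%E.
  have [z zx] := @gcell_cover _ _ c L (2 ^ K j) x L0 (expn_gt0 2 _) (AL Ax).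
  rewrite lee_fin (sum_gcell _ _ L0 zx).
  have -> : cell_meets z && ~~ inner z; last by [].
  apply/andP; split; first by apply/asboolP; exists x.
  by apply/asboolP => zA; apply: nAix; exact: zA.
apply: (@le_trans _ _ (\sum_(j < m) 1%:E)%E); last by apply: lee_sum => j _; exact: psi1.
rewrite sumEFin sumr_const card_ord lee_fin (le_trans (ler_norm r))// ltW//.
by have /andP[] := truncn_itv (normr_ge0 r).
Qed.

End Body.

Section Dot.
Variables (R : realType) (n : nat).
Implicit Types x y v w : 'rV[R]_n.

Definition dotv v w : R := (v *m w^T) 0 0.

Lemma dotvE v w : dotv v w = \sum_i v 0 i * w 0 i.
Proof. by rewrite /dotv mxE; apply: eq_bigr => i _; rewrite mxE. Qed.

Lemma dotvDl v v' w : dotv (v + v') w = dotv v w + dotv v' w.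
Proof. by rewrite /dotv mulmxDl mxE. Qed.

Lemma dotvZl (k : R) v w : dotv (k *: v) w = k * dotv v w.
Proof. by rewrite /dotv -scalemxAl mxE. Qed.

Lemma dotvNl v w : dotv (- v) w = - dotv v w.
Proof. by rewrite /dotv mulNmx mxE. Qed.

Lemma dotv_le v w : dotv v w <= n%:R * (`|v| * `|w|).
Proof.
have -> : n%:R * (`|v| * `|w|) = \sum_(i < n) `|v| * `|w|.
  by rewrite sumr_const card_ord mulr_natl.
rewrite dotvE; apply: ler_sum => i _; rewrite (le_trans (ler_norm _))// normrM.
by rewrite ler_pM// ler_coord.
Qed.

Lemma nat_root (m : nat) : (0 < n)%N -> (0 < m)%N ->
  exists k, [/\ (0 < k)%N, (k ^ n <= m)%N & (m < k.+1 ^ n)%N].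
Proof.
move=> n0 m0.
have exk : exists k, (k ^ n <= m)%N by exists 1%N; rewrite exp1n.
have bk k : (k ^ n <= m)%N -> (k <= m)%N.
  move=> /(leq_trans _); apply; case: k => // k.
  by rewrite -[X in (X <= _)%N]expn1 leq_pexp2l.
have [k km kmax] := ex_maxnP exk bk; exists k; split => //.
  by apply: kmax; rewrite exp1n.
by rewrite ltnNge; apply/negP => /kmax; rewrite ltnn.
Qed.

End Dot.

(** * Bregman divergences *)

Section Bregman.
Variables (R : realType) (n : nat) (u : 'rV[R]_n -> \bar R).
Variables (a : 'rV[R]_n -> 'rV[R]_n) (H : 'rV[R]_n -> 'M[R]_n).
Variables (c : 'rV[R]_n) (L : R) (x0 : 'rV[R]_n).
Let A := edom u.
Let f x := fine (u x).
Let O := interiorV A.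

Definition bregman x y : R := f x - f y - dotv (x - y) (a y).

Local Notation aff ab x := (affine_fun ab.1 ab.2 x).

Definition tangent y : 'rV[R]_n * R := (a y, f y - dotv y (a y)).

(** The point [w] varies independently of [y] and [y'], so that the form can be frozen anywhere in
    the cube. *)
Definition good_cube (eta : R) c' l := (forall y, ccube c' l y -> O y) /\
  forall y y' w, ccube c' l y -> ccube c' l y' -> ccube c' l w ->
    (1 - eta) / 2 * qf (H w) (y - y') <= bregman y y' <= (1 + eta) / 2 * qf (H w) (y - y').

Hypothesis n0 : (0 < n)%N.
Hypothesis L0 : 0 < L.
Hypothesis AL : A `<=` cube c L.
Hypothesis x0A : O x0.
Hypothesis h1 : forall x y, A x -> O y -> f y + dotv (x - y) (a y) <= f x.
Hypothesis h2 : exists B, forall y, O y -> `|a y| <= B.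

Lemma tangentE x y : f x - aff (tangent y) x = bregman x y.
Proof.
rewrite /bregman /affine_fun /tangent /= -/(dotv x (a y)) dotvDl dotvNl; ring.
Qed.

Lemma bregman_ge0 x y : A x -> O y -> 0 <= bregman x y.
Proof. by move=> Ax Oy; have := h1 Ax Oy; rewrite /bregman; lra. Qed.

(** Adding the divergence in the opposite order, which is nonnegative, leaves the pairing of [x - y]
    with [a x - a y]; then [4 * s * t <= (s + t) ^ 2] in each coordinate. *)
Lemma bregman_le x y : O x -> O y ->
  bregman x y <= 4^-1 * \sum_i ((x + a x) 0 i - (y + a y) 0 i) ^+ 2.
Proof.
move=> Ox Oy; have := bregman_ge0 (interior_subset Oy) Ox.
have : bregman x y + bregman y x = \sum_i (x 0 i - y 0 i) * (a x 0 i - a y 0 i).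
  have -> : bregman y x = f y - f x + dotv (x - y) (a x).
    by rewrite /bregman -[y - x]opprB dotvNl opprK.
  rewrite /bregman !dotvE.
  rewrite [RHS](eq_bigr (fun i => (x - y) 0 i * a x 0 i - (x - y) 0 i * a y 0 i)).
    by rewrite sumrB; ring.
  by move=> i _; rewrite !mxE; ring.
move=> bb b0; apply: (@le_trans _ _ (\sum_i (x 0 i - y 0 i) * (a x 0 i - a y 0 i))).
  by lra.
rewrite mulr_sumr; apply: ler_sum => i _; rewrite !mxE.
have := sqr_ge0 (x 0 i - y 0 i - (a x 0 i - a y 0 i)); rewrite !expr2; lra.
Qed.

(* Cells in the variable x + a x: by monotonicity of a the Bregman divergence of
   two points of the same cell is quadratic in the mesh size, with no smoothness. *)
Lemma uniform_net : exists2 C : R, 0 < C & forall m, (0 < m)%N ->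
  exists y0 s, [/\ (size s < m)%N, forall y, y \in y0 :: s -> O y &
    forall x, O x -> exists2 y, y \in y0 :: s & bregman x y <= C * m%:R `^ (- (2 / n%:R))].
Proof.
have [B hB] := h2; have B0 : 0 <= B by apply: le_trans (hB _ x0A).
pose B' := `|c| + L + B + 1.
have B'0 : 0 < B' by rewrite /B' ltr_wpDl// addr_ge0// addr_ge0// ltW.
pose c' : 'rV[R]_n := const_mx (- B'); pose L' := 2 * B'.
have L'0 : 0 < L' by rewrite mulr_gt0.
have zc x : O x -> cube c' L' (x + a x).
  move=> Ox i; rewrite !mxE.
  have /andP[c1 c2] := AL (interior_subset Ox) i.
  have := le_trans (ler_coord (a x) i) (hB _ Ox); rewrite ler_norml => /andP[a1 a2].
  have := ler_coord c i; rewrite ler_norml => /andP[d1 d2].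
  by rewrite /L' /B'; apply/andP; split; lra.
exists (n%:R * L' ^+ 2) => [|m m0]; first by rewrite mulr_gt0 ?ltr0n ?exprn_gt0.
have [k [k0 km mk]] := nat_root n0 m0.
(* A cell that contains no [x + a x] gets the default [x0], so that the net has exactly [k ^ n]
   entries. *)
have Q (z : 'rV['I_k]_n) : exists t, O t /\
    ((exists x, O x /\ gcell c' L' z (x + a x)) -> gcell c' L' z (t + a t)).
  have [[x [Ox zx]]|nx] := pselect (exists x, O x /\ gcell c' L' z (x + a x)).
    by exists x.
  by exists x0.
have [t ht] := choice Q.
have sz : size [seq t z | z <- enum 'rV['I_k]_n] = (k ^ n)%N.
  by rewrite size_map -cardE card_mx card_ord mul1n.
have sO y : y \in [seq t z | z <- enum 'rV['I_k]_n] -> O y.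
  by move=> /mapP[z _ ->]; exact: (ht z).1.
have sN x : O x -> exists2 y, y \in [seq t z | z <- enum 'rV['I_k]_n] &
    bregman x y <= n%:R * L' ^+ 2 * m%:R `^ (- (2 / n%:R)).
  move=> Ox; have [z zx] := gcell_cover L'0 k0 (zc x Ox).
  exists (t z); first by apply/mapP; exists z => //; rewrite mem_enum.
  have zt : gcell c' L' z (t z + a (t z)) by apply: (ht z).2; exists x.
  have d := gcell_dist L'0 k0 zt zx.
  have k0' : 0 < k%:R :> R by rewrite ltr0n.
  apply: (le_trans (bregman_le Ox (ht z).1)).
  apply: (@le_trans _ _ (4^-1 * (n%:R * (L' / k%:R) ^+ 2))).
    have -> : n%:R * (L' / k%:R) ^+ 2 = \sum_(i < n) (L' / k%:R) ^+ 2.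
      by rewrite sumr_const card_ord mulr_natl.
    rewrite ler_pM2l ?invr_gt0//.
    apply: ler_sum => i _; rewrite -real_normK ?num_real//.
    rewrite ler_sqr ?nnegrE ?divr_ge0 ?(ltW L'0)//.
    have := le_trans (ler_coord _ i) (ltW d); rewrite !mxE; apply.
  rewrite -[leRHS]mulrA mulrCA ler_pM2l ?ltr0n// expr_div_n mulrCA ler_pM2l ?exprn_gt0//.
  rewrite powRN -invfM lef_pV2 ?posrE ?mulr_gt0 ?exprn_gt0 ?powR_gt0 ?ltr0n//.
  (* The factor 4 from [bregman_le] pays for [m < (k + 1) ^ n <= (2 * k) ^ n]. *)
  have -> : 4 * k%:R ^+ 2 = ((2 * k%:R) ^+ n) `^ (2 / n%:R) :> R.
    rewrite -[(2 * k%:R) ^+ n]powR_mulrn ?mulr_ge0// -powRrM.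
    have -> : n%:R * (2 / n%:R) = 2%:R :> R by field; rewrite pnatr_eq0 -lt0n.
    by rewrite powR_mulrn ?mulr_ge0//; ring.
  apply: ge0_ler_powR; rewrite ?nnegrE ?ler0n ?divr_ge0 ?exprn_ge0 ?mulr_ge0//.
  apply: (@le_trans _ _ (k.+1 ^ n)%:R); first by rewrite ler_nat ltnW.
  rewrite natrX ler_pXn2r ?nnegrE ?mulr_ge0// -natr1.
  have : 1 <= k%:R :> R by rewrite ler1n.
  lra.
case sE : [seq t z | z <- enum 'rV['I_k]_n] => [|y0 s].
  by have := sz; rewrite sE => /esym/eqP; rewrite expn_eq0 -[k == 0%N]negbK -lt0n k0.
rewrite sE in sz sO sN; exists y0, s; split => //.
by rewrite -[X in (X <= _)%N]/(size (y0 :: s)) sz.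
Qed.

Lemma lipschitz_interior : exists2 K : R, 0 < K &
  forall x y, O x -> O y -> `|f x - f y| <= K * `|x - y|.
Proof.
have [B hB] := h2; have B0 : 0 <= B by apply: le_trans (hB _ x0A).
exists (n%:R * B + 1) => [|x y Ox Oy]; first by rewrite ltr_wpDl// mulr_ge0.
have h x' y' : O x' -> O y' -> f y' - f x' <= n%:R * B * `|x' - y'|.
  move=> Ox' Oy'; have := h1 (interior_subset Ox') Oy'.
  have := dotv_le (- (x' - y')) (a y'); rewrite normrN dotvNl.
  have : n%:R * (`|x' - y'| * `|a y'|) <= n%:R * B * `|x' - y'|.
    by rewrite -mulrA ler_wpM2l// mulrC ler_wpM2r// hB.
  lra.
have := h _ _ Ox Oy; have := h _ _ Oy Ox; rewrite distrC => h3 h4.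
have := normr_ge0 (x - y); rewrite ler_norml => d0; apply/andP; split; lra.
Qed.

Lemma continuous_interior (x : 'rV[R]_n) : O x -> {for x, continuous f}.
Proof.
move=> Ox; have [K K0 hK] := lipschitz_interior.
apply/(@cvgrPdist_lt _ _ _ (nbhs x) _ f (f x)) => e e0.
have [r r0 rA] : exists2 r : R, 0 < r & forall y, `|y - x| < r -> O y.
  by apply/interiorP; exact: nbhs_interior.
apply/nbhs_ballP; exists (Num.min r (e / K)).
  by rewrite /= lt_min r0 divr_gt0.
move=> y; rewrite -ball_normE /ball_/= lt_min => /andP[yr ye].
apply: (le_lt_trans (hK _ _ Ox _)); first by apply: rA; rewrite distrC.
by rewrite mulrC -ltr_pdivlMr.
Qed.

Lemma affine_continuous (ab : 'rV[R]_n * R) : continuous (fun x => aff ab x).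
Proof.
have cs : continuous (fun y : 'rV[R]_n => \sum_i y 0 i * ab.1 0 i).
  apply: continuous_bigsum => i v.
  exact: (cvgM (@coord_continuous R 1 n 0 i v) (cvg_cst (ab.1 0 i))).
have -> : (fun x => aff ab x) = (fun y : 'rV[R]_n => \sum_i y 0 i * ab.1 0 i + ab.2).
  by apply/funext => y; rewrite /affine_fun -/(dotv _ _) dotvE.
by move=> x; exact: (cvgD (cs x) (cvg_cst ab.2)).
Qed.

Lemma ccube_convex c' l (x y : 'rV[R]_n) (t : R) : 0 <= t <= 1 ->
  ccube c' l x -> ccube c' l y -> ccube c' l ((1 - t) *: x + t *: y).
Proof.
move=> /andP[t0 t1] cx cy i; rewrite !mxE.
have /andP[x1 x2] := cx i; have /andP[y1 y2] := cy i.
have s0 : 0 <= 1 - t by lra.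
have e1 := ler_wpM2l s0 x1; have e2 := ler_wpM2l s0 x2.
have e3 := ler_wpM2l t0 y1; have e4 := ler_wpM2l t0 y2.
by apply/andP; split; lra.
Qed.

(** Take the lower bounds for the divergences of [x] and of [y] from their convex combination [z].
    The gradient terms at [z] cancel on averaging, and [(1 - t) * t ^ 2 + t * (1 - t) ^ 2 = t * (1 -
    t)]. *)
Lemma strong_convexity eta c' l (ab : 'rV[R]_n * R) x y w (t : R) :
  good_cube eta c' l -> 0 <= t <= 1 -> ccube c' l x -> ccube c' l y -> ccube c' l w ->
  (f ((1 - t) *: x + t *: y) - aff ab ((1 - t) *: x + t *: y)) +
     (1 - eta) / 2 * (t * (1 - t)) * qf (H w) (y - x) <=
  (1 - t) * (f x - aff ab x) + t * (f y - aff ab y).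
Proof.
move=> [gO gD] t01 cx cy cw; have /andP[t0 t1] := t01.
set z := (1 - t) *: x + t *: y; have cz : ccube c' l z by exact: ccube_convex.
have /andP[b1 _] := gD _ _ _ cx cz cw; have /andP[b2 _] := gD _ _ _ cy cz cw.
have e1 : x - z = (- t) *: (y - x) by apply/rowP => i; rewrite !mxE; ring.
have e2 : y - z = (1 - t) *: (y - x) by apply/rowP => i; rewrite !mxE; ring.
rewrite e1 qfZ /bregman e1 dotvZl in b1; rewrite e2 qfZ /bregman e2 dotvZl in b2.
have s0 : 0 <= 1 - t by lra.
have {}b1 := ler_wpM2l s0 b1; have {}b2 := ler_wpM2l t0 b2.
rewrite /affine_fun -!/(dotv _ _) /z dotvDl !dotvZl -/z.
move: b1 b2; set q := qf _ _; set d := dotv (y - x) _; rewrite !expr2.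
lra.
Qed.

(** The witness minimises the gap between [u] and the piece over the cube. Comparing it with a point
    a fraction [t] of the way to [x], for small [t], gives the bound; no derivative of the gap is
    used, so the minimiser may lie on the boundary of the cube. *)
Lemma affine_argmin eta c' l (ab : 'rV[R]_n * R) : 0 < eta < 1 -> 0 <= l ->
  good_cube eta c' l -> (forall w, psd (H w) \/ ~ O w) ->
  (forall x, A x -> aff ab x <= f x) ->
  exists2 y, ccube c' l y & forall x w, ccube c' l x -> ccube c' l w ->
    (1 - eta) / 2 * qf (H w) (x - y) <= f x - aff ab x.
Proof.
move=> /andP[eta0 eta1] l0 gc pH abf.
have [K K0 hK] := lipschitz_interior.
have cC : compact (ccube c' l).
  rewrite (_ : ccube c' l = [set v | forall i, `[c' 0 i, c' 0 i + l]%classic (v ord0 i)]).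
    apply: (@rV_compact _ n (fun i => `[c' 0 i, c' 0 i + l]%classic)) => i.
    exact: segment_compact.
  by apply/seteqP; split => x h i; have := h i; rewrite /= in_itv.
have nC : ccube c' l !=set0.
  by exists c' => i; rewrite lexx lerDl.
have cg : {within ccube c' l, continuous (fun x => f x - aff ab x)}.
  apply: continuous_in_subspaceT => x /set_mem /gc.1 Ox.
  exact: (cvgB (continuous_interior Ox) (@affine_continuous ab x)).
have [y /set_mem cy ymin] := EVT_min_rV nC cC cg.
exists y => // x w cx cw.
have q0 : 0 <= qf (H w) (x - y) by case: (pH w) => // /(_ (gc.1 _ cw)).
set Q := (1 - eta) / 2 * _; set G := f x - _.
have G0 : 0 <= G by rewrite subr_ge0 abf//; exact: interior_subset (gc.1 _ cx).
have step t : 0 < t < 1 -> (1 - t) * Q <= G.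
  move=> /andP[t0 t1]; have t01 : 0 <= t <= 1 by rewrite !ltW.
  have := strong_convexity ab gc t01 cy cx cw.
  have /ymin : (1 - t) *: y + t *: x \in ccube c' l by apply/mem_set; exact: ccube_convex.
  set gz := f (_ + _) - _; set gy := f y - _ => h hs.
  have gy0 : 0 <= gy by rewrite subr_ge0 abf//; exact: interior_subset (gc.1 _ cy).
  rewrite -(ler_pM2l t0).
  have : 0 <= t * gy by rewrite mulr_ge0// ltW.
  move: hs; rewrite -/G /Q; lra.
rewrite leNgt; apply/negP => GQ.
have Q0 : 0 < Q by exact: le_lt_trans GQ.
(* A single [t] replaces the limit: for this value [(1 - t) * Q] is the mean of [Q] and [G], which
   exceeds [G]. *)
have tt : 0 < (Q - G) / (2 * Q) < 1.
  apply/andP; split; first by apply: divr_gt0; lra.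
  by rewrite ltr_pdivrMr; lra.
have := step _ tt.
have -> : (1 - (Q - G) / (2 * Q)) * Q = (Q + G) / 2 by field; rewrite gt_eqF.
lra.
Qed.

(** Suppose the gap is below the threshold at [y] and [y']. By convexity it is so at the point [w1]
    of the segment at distance [d] from [y]. Strong convexity then lowers the gap at the midpoint of
    [y] and [w1] by [(1 - eta) / 2 * (1 / 4) * qf (H w) (w1 - y)], hence below zero; this is the
    origin of the constant [(1 - eta) / 8]. *)
Lemma affine_separation eta c' l (d lam : R) (ab : 'rV[R]_n * R) y y' w :
  0 < eta < 1 -> 0 < d -> 0 < lam -> good_cube eta c' l ->
  (forall v, lam * `|v| ^+ 2 <= qf (H w) v) -> ccube c' l w ->
  (forall v, `|v - y| <= d -> ccube c' l v) -> O y' -> d <= `|y' - y| ->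
  (forall x, A x -> aff ab x <= f x) ->
  f y - aff ab y < (1 - eta) / 8 * (lam * d ^+ 2) ->
  f y' - aff ab y' < (1 - eta) / 8 * (lam * d ^+ 2) -> False.
Proof.
move=> /andP[eta0 eta1] d0 lam0 gc hlam cw cyd Oy' dy abf gy gy'.
have dd : 0 < `|y' - y| by exact: lt_le_trans dy.
pose t := d / `|y' - y|.
have t0 : 0 < t by rewrite divr_gt0.
have t1 : t <= 1 by rewrite ler_pdivrMr// mul1r.
pose w1 := (1 - t) *: y + t *: y'.
have w1E : w1 - y = t *: (y' - y) by apply/rowP => i; rewrite !mxE; ring.
have nw1 : `|w1 - y| = d.
  by rewrite w1E normrZ ger0_norm ?(ltW t0)// divfK ?gt_eqF.
have cy : ccube c' l y by apply: cyd; rewrite subrr normr0 ltW.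
have cw1 : ccube c' l w1 by apply: cyd; rewrite nw1.
have Ow1 := gc.1 _ cw1; have Oy := gc.1 _ cy.
set gam := (1 - eta) / 8 * _ in gy gy'.
have gw1 : f w1 - aff ab w1 < gam.
  have b1 := h1 (interior_subset Oy) Ow1; have b2 := h1 (interior_subset Oy') Ow1.
  have e1 : y - w1 = (- t) *: (y' - y) by apply/rowP => i; rewrite !mxE; ring.
  have e2 : y' - w1 = (1 - t) *: (y' - y) by apply/rowP => i; rewrite !mxE; ring.
  rewrite e1 dotvZl in b1; rewrite e2 dotvZl in b2.
  have s0 : 0 <= 1 - t by lra.
  have {}b1 := ler_wpM2l s0 b1; have {}b2 := ler_wpM2l (ltW t0) b2.
  have g1 := ler_wpM2l s0 (ltW gy); have g2 : t * (f y' - aff ab y') < t * gam by rewrite ltr_pM2l.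
  have dw : dotv w1 ab.1 = (1 - t) * dotv y ab.1 + t * dotv y' ab.1.
    by rewrite /w1 dotvDl !dotvZl.
  move: b1 b2 g1 g2; rewrite /affine_fun -!/(dotv _ _) dw.
  set D := dotv (y' - y) _; lra.
have half : 0 <= (2^-1 : R) <= 1 by apply/andP; split; lra.
have := strong_convexity ab gc half cy cw1 cw.
set z := (1 - 2^-1) *: y + 2^-1 *: w1 => sc.
have cz : ccube c' l z by exact: ccube_convex.
have := abf z (interior_subset (gc.1 _ cz)).
have := hlam (w1 - y); rewrite nw1.
move: sc gy gw1; rewrite /gam; set X := lam * _; set q := qf _ _ => sc g1 g2 hX hz.
have : (1 - eta) * X <= (1 - eta) * q by rewrite ler_wpM2l//; lra.
lra.
Qed.

End Bregman.

(** * Max-affine minorants as lists of pieces *)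

Section Pieces.
Variables (R : realType) (n : nat) (u : 'rV[R]_n -> \bar R).
Local Notation aff ab x := (affine_fun ab.1 ab.2 x).

Definition minorant (ab : 'rV[R]_n * R) := forall x, edom u x -> aff ab x <= fine (u x).

Lemma Pc_elim m l : (forall x, u x != -oo%E) -> Pc u m l ->
  exists t : seq ('rV[R]_n * R), [/\ (size t <= m)%N, forall ab, ab \in t -> minorant ab,
    forall x, exists2 ab, ab \in t & l x = aff ab x &
    forall x, edom u x -> l x <= fine (u x)].
Proof.
move=> uN [k [a [b [km [lE lu]]]]].
have lf x : edom u x -> l x <= fine (u x).
  move=> ux; rewrite -lee_fin fineK; first exact: lu.
  by rewrite fin_numE uN lt_eqF.
exists [seq (a j, b j) | j <- enum 'I_k.+1]; split => //.
- by rewrite size_map size_enum_ord.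
- move=> _ /mapP[j _ ->] x ux; apply: le_trans (lf x ux).
  by rewrite lE; exact: le_bigmax.
- move=> x; rewrite lE; elim/big_ind : _ => [|v w [ab1 t1 ->] [ab2 t2 ->]|j _].
  + by exists (a ord0, b ord0) => //; apply/mapP; exists ord0; rewrite ?mem_enum.
  + by rewrite maxElt; case: ifP => _; [exists ab2|exists ab1].
  + by exists (a j, b j) => //; apply/mapP; exists j; rewrite ?mem_enum.
Qed.

Lemma Pc_intro m (t : seq ('rV[R]_n * R)) : (forall x, u x != -oo%E) ->
  (0 < size t <= m)%N -> (forall ab, ab \in t -> minorant ab) ->
  exists l, [/\ Pc u m l, forall x ab, ab \in t -> aff ab x <= l x &
    forall x, edom u x -> l x <= fine (u x)].
Proof.
case: t => // ab0 t uN /andP[_ tm] tA.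
pose a (j : 'I_(size t).+1) := (nth ab0 (ab0 :: t) j).1.
pose b (j : 'I_(size t).+1) := (nth ab0 (ab0 :: t) j).2.
pose l x := \big[Num.max/affine_fun (a ord0) (b ord0) x]_(j < (size t).+1)
  affine_fun (a j) (b j) x.
have lf x : edom u x -> l x <= fine (u x).
  move=> ux; have h j : affine_fun (a j) (b j) x <= fine (u x).
    by apply: (tA (nth ab0 (ab0 :: t) j)) => //; rewrite mem_nth.
  by apply/bigmax_leP; split.
exists l; split => //.
  exists (size t), a, b; split => //; split => // x ux.
  have ufin : u x \is a fin_num by rewrite fin_numE uN lt_eqF.
  by rewrite -(fineK ufin) lee_fin lf.
move=> x ab abt; pose j : 'I_(size t).+1 := Ordinal (etrans (index_mem ab (ab0 :: t)) abt).
have -> : ab = (a j, b j) by rewrite /a /b nth_index//; case: (ab).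
by rewrite /l; exact: (le_bigmax _ (fun j => affine_fun (a j) (b j) x)).
Qed.

Lemma finite_lower_bound (I : finType) (P : pred I) (g : I -> R -> Prop) :
  (forall i e e', g i e -> 0 < e' <= e -> g i e') ->
  (forall i, P i -> exists2 e, 0 < e & g i e) ->
  exists2 e, 0 < e & forall i, P i -> g i e.
Proof.
move=> gm hg; suff : forall r : seq I, exists2 e, 0 < e & forall i, i \in r -> P i -> g i e.
  by move=> /(_ (enum I))[e e0 he]; exists e => // i; apply: he; rewrite mem_enum.
elim=> [|i r [e e0 he]]; first by exists 1.
have [Pi|nPi] := boolP (P i); last first.
  exists e => // j; rewrite inE => /predU1P[->|/he//]; by rewrite (negbTE nPi).
have [e' e'0 ge'] := hg i Pi; exists (Num.min e e'); first by rewrite lt_min e0.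
move=> j; rewrite inE => /predU1P[-> _|jr Pj].
  by apply: gm ge' _; rewrite lt_min e0 e'0 ge_min lexx orbT.
by apply: gm (he j jr Pj) _; rewrite lt_min e0 e'0 ge_min lexx.
Qed.

End Pieces.

(** * Lower bound *)

Section LowerBound.
Variables (R : realType) (n : nat) (p : R) (u : 'rV[R]_n -> \bar R).
Variables (a : 'rV[R]_n -> 'rV[R]_n) (H : 'rV[R]_n -> 'M[R]_n).
Variables (c : 'rV[R]_n) (L : R) (x0 : 'rV[R]_n).
Local Notation J := (@integral_Rn R _).
Local Notation A := (edom u).
Local Notation f x := (fine (u x)).
Local Notation O := (interiorV (edom u)).
Local Notation aff ab x := (affine_fun ab.1 ab.2 x).
Local Notation al := (2 * p / n%:R).
Hypothesis n0 : (0 < n)%N.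
Hypothesis p0 : 0 < p.
Hypothesis uN : forall x, u x != -oo%E.
Hypothesis L0 : 0 < L.
Hypothesis AL : A `<=` cube c L.
Hypothesis x0A : O x0.
Hypothesis h1 : forall x y, A x -> O y -> f y + dotv (x - y) (a y) <= f x.
Hypothesis h2 : exists B, forall y, O y -> `|a y| <= B.
Hypothesis hH : forall w, O w -> exists2 lam : R, 0 < lam &
  forall v, lam * `|v| ^+ 2 <= qf (H w) v.

Lemma psdH w : O w -> psd (H w).
Proof.
move=> /hH[lam lam0 hl] v; apply: le_trans (hl v).
by rewrite mulr_ge0 ?exprn_ge0// ltW.
Qed.

Definition corner k (z : 'rV['I_(2 ^ k)]_n) : 'rV[R]_n :=
  \row_i (c 0 i + L / (2 ^ k)%:R * (z 0 i)%:R).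

Variables (eta tau : R) (k : nat) (P : pred 'rV['I_(2 ^ k)]_n).
Hypothesis eta01 : 0 < eta < 1.
Hypothesis tau01 : 0 < tau < 1.
Let h := L / (2 ^ k)%:R.
Hypothesis goodP : forall z, P z -> good_cube u a H eta (corner z) h.
Let h0 : 0 < h.
Proof. by rewrite divr_gt0// ltr0n expn_gt0. Qed.
Let corner_in (z : 'rV['I_(2 ^ k)]_n) : ccube (corner z) h (corner z).
Proof. by move=> i; rewrite lexx lerDl ltW. Qed.
(** Each cell is replaced by the concentric cube of side [l']. The margin [d] on every side keeps a
    ball of radius [d] around each point of this cube inside the cell, as [affine_separation]
    requires. *)
Let l' := (1 - tau) * h.
Let c' (z : 'rV['I_(2 ^ k)]_n) : 'rV[R]_n := \row_i (corner z 0 i + tau * h / 2).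
Let l'0 : 0 < l'. Proof. by rewrite mulr_gt0//; case/andP: tau01; lra. Qed.
Let d := tau * h / 2.
Let d0 : 0 < d. Proof. by rewrite divr_gt0// mulr_gt0//; case/andP: tau01. Qed.

Let shrunk z y v : ccube (c' z) l' y -> `|v - y| <= d -> ccube (corner z) h v.
Proof.
move=> cy vy i; have /andP[y1 y2] := cy i; have := le_trans (ler_coord _ i) vy.
rewrite /l' /d !mxE ler_norml in y1 y2 * => /andP[v1 v2].
by apply/andP; split; lra.
Qed.

Let shrunk_strict z y v : ccube (c' z) l' y -> `|v - y| < d -> gcell c L z v.
Proof.
move=> cy vy i; have /andP[y1 y2] := cy i; have := le_lt_trans (ler_coord _ i) vy.
rewrite /l' /d !mxE ltr_norml -/h in y1 y2 * => /andP[v1 v2].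
by apply/andP; split; lra.
Qed.

Let shrunk_sub z y : ccube (c' z) l' y -> ccube (corner z) h y.
Proof. by move=> cy; apply: (shrunk cy); rewrite subrr normr0 ltW. Qed.

(** Two points closer than [d] lie in one cell; for all others [affine_separation] applies. The
    coercivity constant can be shared because the cells are finite in number. *)
Lemma relevance_threshold : exists2 gam : R, 0 < gam &
  forall z z' y y' ab, P z -> P z' -> minorant u ab ->
    ccube (c' z) l' y -> ccube (c' z') l' y' ->
    f y - aff ab y < gam -> f y' - aff ab y' < gam -> z = z'.
Proof.
have /andP[eta0 eta1] := eta01.
have [lam lam0 hlam] : exists2 lam : R, 0 < lam & forall z, P z ->
    forall v, lam * `|v| ^+ 2 <= qf (H (corner z)) v.
  apply: (@finite_lower_bound R _ P
    (fun z lam => forall v, lam * `|v| ^+ 2 <= qf (H (corner z)) v)).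
    move=> z e e' he /andP[e'0 e'e] v; apply: le_trans (he v).
    by rewrite ler_wpM2r// exprn_ge0.
  by move=> z Pz; apply: hH; exact: (goodP Pz).1.
exists ((1 - eta) / 8 * (lam * d ^+ 2)).
  by apply: mulr_gt0; [lra|exact: mulr_gt0 (exprn_gt0 _ d0)].
move=> z z' y y' ab Pz Pz' mab cy cy' gy gy'.
have [dy|dy] := leP d `|y' - y|; last first.
  apply: (@gcell_uniq _ _ c L _ z z' y' L0); first exact: shrunk_strict dy.
  by apply: (shrunk_strict cy'); rewrite subrr normr0.
exfalso; apply: (affine_separation h1 eta01 d0 lam0 (goodP Pz) (hlam z Pz) (corner_in z) _ _ dy mab gy gy').
  by move=> v; exact: shrunk.
by apply: (goodP Pz').1; exact: shrunk_sub.
Qed.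

(** In each cell the pieces relevant to it are joined by a fixed net of [M] tangents. The gap of the
    net stays below [gam], whereas an irrelevant piece has gap at least [gam], so such pieces can be
    ignored. As a piece is relevant to at most one cell, there are at most [m + K * M] centres in
    all, and the overhead [N = K * M] does not depend on [m]. *)
Lemma lower_bound_cells : exists N : nat, forall m l, (0 < m)%N -> Pc u m l ->
  ((((1 - eta) / 2) `^ p * (l' ^+ n * l' `^ (2 * p)) *
     (\sum_(z | P z) zador (H (corner z)) p `^ (1 + al)^-1) `^ (1 + al) *
     (m + N)%:R `^ (- al))%:E <=
   integral_on A (fun x => ((f x - l x) `^ p)%:E))%E.
Proof.
have /andP[eta0 eta1] := eta01.
have al0 : 0 < al by rewrite divr_gt0 ?mulr_gt0 ?ltr0n.
have [gam gam0 hgam] := relevance_threshold.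
have [C C0 hC] := uniform_net n0 L0 AL x0A h1 h2.
have [M M0 hM] : exists2 M, (0 < M)%N & C * M%:R `^ (- (2 / n%:R)) < gam.
  pose q := (C / gam) `^ (n%:R / 2); exists (Num.truncn q).+1 => //.
  have /andP[_ qM] := truncn_itv (powR_ge0 (C / gam) (n%:R / 2)).
  rewrite powRN ltr_pdivrMr ?powR_gt0// mulrC -ltr_pdivrMr//.
  have n2 : 0 < 2 / n%:R :> R by rewrite divr_gt0 ?ltr0n.
  have -> : C / gam = q `^ (2 / n%:R).
    rewrite /q -powRrM (_ : n%:R / 2 * (2 / n%:R) = 1) ?powRr1//.
      by rewrite divr_ge0 ?(ltW C0) ?(ltW gam0).
    by field; rewrite pnatr_eq0 -lt0n.
  by apply: gt0_ltr_powR; rewrite ?nnegrE ?powR_ge0.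
have [y0 [sN [szN sNO hN]]] := hC M M0.
pose T := [seq tangent u a y | y <- y0 :: sN].
have Tm ab : ab \in T -> minorant u ab.
  move=> /mapP[y ys ->] x Ax; rewrite -subr_ge0 tangentE.
  exact: (bregman_ge0 h1) (sNO _ ys).
pose K := #|{: 'rV['I_(2 ^ k)]_n}|.
exists (K * M)%N => m l m0 /(Pc_elim uN)[t [tm tmin tl lf]].
pose rel z ab := `[< exists y, ccube (c' z) l' y /\ f y - aff ab y < gam >].
have Q (zab : 'rV['I_(2 ^ k)]_n * ('rV[R]_n * R)) : exists y, P zab.1 -> minorant u zab.2 ->
    ccube (c' zab.1) l' y /\ forall x, ccube (c' zab.1) l' x ->
      (1 - eta) / 2 * qf (H (corner zab.1)) (x - y) <= f x - aff zab.2 x.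
  have [Pz|nP] := boolP (P zab.1); last by exists 0.
  have [mab|nm] := pselect (minorant u zab.2); last by exists 0.
  (* The form is frozen at the corner, since [zador_lb] works with one form on the whole cell. *)
  have gH' : good_cube u a (fun=> H (corner zab.1)) eta (c' zab.1) l'.
    have [gO gD] := goodP Pz; split => [y /shrunk_sub/gO//|y y' w cy cy' _].
    by apply: gD; [exact: shrunk_sub|exact: shrunk_sub|exact: corner_in].
  have [y cy hy] := affine_argmin x0A h1 h2 eta01 (ltW l'0) gH'
    (fun _ => or_introl (psdH ((goodP Pz).1 _ (corner_in _)))) mab.
  by exists y => _ _; split => // x cx; exact: (hy x x).
have [Y hY] := choice Q.
pose hd z := Y (z, tangent u a y0).
pose tt z := [seq Y (z, ab) | ab <- [seq tangent u a y | y <- sN] ++ [seq ab <- t | rel z ab]].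
have hdE z : hd z :: tt z = [seq Y (z, ab) | ab <- T ++ [seq ab <- t | rel z ab]] by [].
have YP z y : P z -> y \in hd z :: tt z -> exists2 ab, minorant u ab & y = Y (z, ab).
  move=> Pz; rewrite hdE => /mapP[ab]; rewrite mem_cat mem_filter => /orP[/Tm|/andP[_ /tmin]] mab ->;
  by exists ab.
pose wz (z : 'rV['I_(2 ^ k)]_n) := H (corner z).
have pw z : P z -> psd (wz z) by move=> Pz; apply: psdH; apply: (goodP Pz).1; exact: corner_in.
have key z x : P z -> cube (c' z) l' x ->
    (1 - eta) / 2 * minq (wz z) (hd z) (tt z) x <= f x - l x.
  move=> Pz cx; have ccx : ccube (c' z) l' x.
    by move=> i; have /andP[-> /ltW->] := cx i.
  have Ox : O x by apply: (goodP Pz).1; exact: shrunk_sub.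
  have use ab : ab \in T ++ [seq ab <- t | rel z ab] ->
      (1 - eta) / 2 * minq (wz z) (hd z) (tt z) x <= f x - aff ab x.
    move=> abT; have mab : minorant u ab.
      by move: abT; rewrite mem_cat mem_filter => /orP[/Tm//|/andP[_ /tmin]].
    have [_ hq] := hY (z, ab) Pz mab; apply: le_trans (hq x ccx).
    rewrite ler_pM2l; last by rewrite divr_gt0//; lra.
    by apply: minq_le; rewrite hdE; apply/mapP; exists ab.
  have [ab abt lx] := tl x; rewrite lx.
  have [rz|nrz] := boolP (rel z ab); first by apply: use; rewrite mem_cat mem_filter rz abt orbT.
  have gx : gam <= f x - aff ab x.
    by rewrite leNgt; apply: contra nrz => gx; apply/asboolP; exists x.
  have [y ys byx] := hN x Ox; apply: le_trans gx; apply: le_trans (ltW hM).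
  apply: le_trans byx; rewrite -tangentE; apply: use.
  by rewrite mem_cat; apply/orP; left; apply/mapP; exists y.
have cub z x : cube (c' z) l' x -> gcell c L z x.
  move=> cx; apply: (@shrunk_strict z x x); last by rewrite subrr normr0.
  by move=> i; have /andP[-> /ltW->] := cx i.
pose B := ((1 - eta) / 2) `^ p; have B0 : 0 <= B by exact: powR_ge0.
pose mu z := (size [seq ab <- t | rel z ab] + M)%N.
have mu0 z : 0 < (mu z)%:R :> R by rewrite ltr0n addn_gt0 M0 orbT.
pose g z x := ((B%:E * (\1_(cube (c' z) l') x * minq (wz z) (hd z) (tt z) x `^ p)%:E))%E.
have g0 z x : (0 <= g z x)%E by rewrite /g -EFinM lee_fin !mulr_ge0// powR_ge0.
have ng z : P z -> nice (g z).
  move=> Pz; apply: niceZ => //; first by move=> x; rewrite lee_fin mulr_ge0// powR_ge0.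
  by apply: nice_quant => //; exact: pw.
have [_ JS] := @nice_sum _ n _ (index_enum _) P g (fun z x _ => g0 z x) ng.
have le1 : (J (fun x => \sum_(z | P z) g z x)%E <=
    integral_on A (fun x => ((f x - l x) `^ p)%:E))%E.
  apply: le_integral_Rn => x; first by apply: sume_ge0.
  have [[z [Pz cx]]|no] := pselect (exists z, P z /\ cube (c' z) l' x); last first.
    rewrite big1; first by case: ifP => // _; rewrite lee_fin powR_ge0.
    move=> z Pz; rewrite /g indicE memNset ?mul0r ?mule0// => cx.
    by apply: no; exists z.
  rewrite (bigD1 z)//= big1 ?adde0; last first.
    move=> z' /andP[Pz' z'z]; rewrite /g indicE memNset ?mul0r ?mule0// => cx'.
    by rewrite (gcell_uniq L0 (cub _ _ cx') (cub _ _ cx)) eqxx in z'z.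
  have ccx : ccube (c' z) l' x by move=> i; have /andP[-> /ltW->] := cx i.
  have Ax : A x by apply: interior_subset; apply: (goodP Pz).1; exact: shrunk_sub.
  rewrite asboolT// /g indicE mem_set// mul1r -EFinM lee_fin -powRM ?minq_ge0//; last 2 first.
  - by rewrite divr_ge0//; lra.
  - exact: pw.
  have q0 : 0 <= (1 - eta) / 2 * minq (wz z) (hd z) (tt z) x.
    by rewrite mulr_ge0 ?divr_ge0 ?minq_ge0//; [lra|exact: pw].
  by apply: ge0_ler_powR; rewrite ?nnegrE ?(ltW p0)// ?(le_trans q0) ?key.
apply: le_trans le1; rewrite JS.
apply: (@le_trans _ _ (\sum_(z | P z) (B * (l' ^+ n * l' `^ (2 * p) *
    (zador (wz z) p * (mu z)%:R `^ (- al))))%:E)%E); last first.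
  apply: lee_sum => z Pz; rewrite /g integral_RnZl//; last first.
    by move=> x; rewrite lee_fin mulr_ge0// powR_ge0.
  rewrite EFinM lee_wpmul2l ?lee_fin//; apply: zador_lb => //; first exact: pw.
    by move=> y /(YP z y Pz)[ab mab ->]; exact: (hY (z, ab) Pz mab).1.
  by rewrite size_map size_cat size_map addnC ltn_add2l.
rewrite sumEFin lee_fin -!mulr_sumr -/B -[leLHS]mulrA -[leLHS]mulrA ler_wpM2l//.
rewrite ler_wpM2l ?mulr_ge0 ?exprn_ge0 ?powR_ge0 ?(ltW l'0)//.
have z0 z : P z -> 0 <= zador (wz z) p by move=> Pz; apply: zador_ge0; exact: pw.
apply: le_trans (holder_allocation al0 z0 (fun z _ => mu0 z)).
set S := \sum_(z | P z) _.
have S0 : 0 <= S by apply: sumr_ge0 => z _; exact: powR_ge0.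
(* When [S] is nonzero some cell is in [P], so the number of centres is positive and the negative
   powers can be compared. *)
have [SE|Sn] := eqVneq S 0.
  by rewrite SE powR0 ?mul0r// gt_eqF//; lra.
have [z1 Pz1] : exists z, P z.
  apply: contrapT => no; move: Sn; rewrite /S big1 ?eqxx// => z Pz.
  by exfalso; apply: no; exists z.
rewrite ler_wpM2l ?powR_ge0// !powRN lef_pV2 ?posrE ?powR_gt0 ?ltr0n ?addn_gt0 ?m0//; last first.
  rewrite (bigD1 z1)//= ltr_wpDr//; apply: sumr_ge0 => z _; exact: ler0n.
apply: ge0_ler_powR; rewrite ?nnegrE ?(ltW al0) ?ler0n//.
  by apply: sumr_ge0 => z _; exact: ler0n.
rewrite -natr_sum ler_nat big_split/= leq_add//; last first.
  by rewrite sum_nat_const leq_mul2r max_card orbT.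
(* Double counting of the pairs of a cell and a piece relevant to it; [hgam] leaves at most one cell
   for each piece. *)
apply: leq_trans tm; rewrite (eq_bigr (fun z => \sum_(ab <- t) (rel z ab : nat))); last first.
  by move=> z _; rewrite size_filter -sum1_count big_mkcond/=; apply: eq_bigr => ab _; case: (rel z ab).
rewrite exchange_big/= -sum1_size big_seq [X in (_ <= X)%N]big_seq.
apply: leq_sum => ab abt.
have [[z [Pz rz]]|no] := pselect (exists z, P z /\ rel z ab); last first.
  rewrite big1// => z Pz; case: (boolP (rel z ab)) => // rz.
  by exfalso; apply: no; exists z.
rewrite (bigD1 z)//= rz big1// => z' /andP[Pz' z'z].
case: (boolP (rel z' ab)) => // /asboolP[y' [cy' gy']].
have /asboolP[y [cy gy]] := rz.
by rewrite (hgam _ _ _ _ _ Pz' Pz (tmin _ abt) cy' cy gy' gy) eqxx in z'z.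
Qed.

End LowerBound.

(** * Upper bound *)

Section UpperBound.
Variables (R : realType) (n : nat) (p : R) (u : 'rV[R]_n -> \bar R).
Variables (a : 'rV[R]_n -> 'rV[R]_n) (H : 'rV[R]_n -> 'M[R]_n).
Variables (c : 'rV[R]_n) (L : R) (x0 : 'rV[R]_n).
Local Notation J := (@integral_Rn R _).
Local Notation A := (edom u).
Local Notation f x := (fine (u x)).
Local Notation O := (interiorV (edom u)).
Local Notation aff ab x := (affine_fun ab.1 ab.2 x).
Local Notation al := (2 * p / n%:R).
Local Notation corner := (corner c L).
Hypothesis n0 : (0 < n)%N.
Hypothesis p0 : 0 < p.
Hypothesis uN : forall x, u x != -oo%E.
Hypothesis convA : forall x y (t : R), A x -> A y -> 0 <= t <= 1 ->
  A ((1 - t) *: x + t *: y).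
Hypothesis L0 : 0 < L.
Hypothesis AL : A `<=` cube c L.
Hypothesis x0A : O x0.
Hypothesis h1 : forall x y, A x -> O y -> f y + dotv (x - y) (a y) <= f x.
Hypothesis hH : forall w, O w -> exists2 lam : R, 0 < lam &
  forall v, lam * `|v| ^+ 2 <= qf (H w) v.

(** [eps] is the slack of the quantizers. A share [del] of the pieces is reserved for the net, and a
    further share [del] covers the rounding of the allocations. *)
Variables (eta eps del C : R) (k : nat) (P : pred 'rV['I_(2 ^ k)]_n).
Hypothesis eta01 : 0 < eta < 1.
Hypothesis eps0 : 0 < eps.
Hypothesis del0 : 0 < del.
Hypothesis del1 : 2 * del < 1.
Hypothesis C0 : 0 < C.
Hypothesis hC : forall m, (0 < m)%N ->
  exists y0 s, [/\ (size s < m)%N, forall y, y \in y0 :: s -> O y &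
    forall x, O x -> exists2 y, y \in y0 :: s & bregman u a x y <= C * m%:R `^ (- (2 / n%:R))].
Let h := L / (2 ^ k)%:R.
Hypothesis goodP : forall z, P z -> good_cube u a H eta (corner z) h.
Let h0 : 0 < h.
Proof. by rewrite divr_gt0// ltr0n expn_gt0. Qed.
Let corner_in (z : 'rV['I_(2 ^ k)]_n) : ccube (corner z) h (corner z).
Proof. by move=> i; rewrite lexx lerDl ltW. Qed.

(** Cell [z] receives the share [be z = s z / S] of the pieces, the case of equality in
    [holder_allocation]. Outside the cells of [P] only the net controls the error, uniformly, and
    the volume of those cells enters as the second term. *)
Lemma upper_bound_cells : exists m1, forall m, (m1 <= m)%N -> exists2 l, Pc u m l &
  (integral_on A (fun x => ((f x - l x) `^ p)%:E) <=
   (m%:R `^ (- al) * (((1 + eta) / 2) `^ p * (1 - 2 * del) `^ (- al) *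
     (h ^+ n * h `^ (2 * p)) *
     (\sum_(z | P z) (zador (H (corner z)) p + eps) `^ (1 + al)^-1) `^ (1 + al) +
     C `^ p * (del / 2) `^ (- al) *
       \sum_(z : 'rV['I_(2 ^ k)]_n | cell_meets A c L z && ~~ P z) h ^+ n))%:E)%E.
Proof.
have /andP[eta0 eta1] := eta01.
move: (eps0) (del0) (del1) => eps_gt0 del_gt0 del_lt1.
have al0 : 0 < al by rewrite divr_gt0 ?mulr_gt0 ?ltr0n.
have al1 : 0 < 1 + al by lra.
pose wz (z : 'rV['I_(2 ^ k)]_n) := H (corner z).
have Oz z : P z -> O (corner z) by move=> Pz; apply: (goodP Pz).1; exact: corner_in.
have pw z : P z -> psd (wz z) by move=> Pz; apply: (psdH hH); exact: Oz.
pose s z := (zador (wz z) p + eps) `^ (1 + al)^-1.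
have ze z : P z -> 0 < zador (wz z) p + eps.
  by move=> Pz; have := zador_ge0 p (pw z Pz); lra.
have s0 z : P z -> 0 < s z by move=> Pz; rewrite powR_gt0 ?ze.
pose S := \sum_(z | P z) s z.
have S0 : 0 <= S by apply: sumr_ge0 => z Pz; exact/ltW/s0.
have Sz z : P z -> 0 < S.
  by move=> Pz; rewrite /S (bigD1 z)//= ltr_wpDr ?s0//; apply: sumr_ge0 => i /andP[Pi _]; exact/ltW/s0.
pose be z := s z / S.
have be0 z : P z -> 0 < be z by move=> Pz; rewrite divr_gt0 ?s0 ?(Sz z).
have Q z : exists m0, P z -> forall m c l, (m0 <= m)%N -> 0 < l -> exists y0 s,
    [/\ forall y, y \in y0 :: s -> ccube c l y, (size s < m)%N &
    (quant (wz z) p y0 s c l <= (l ^+ n * l `^ (2 * p) *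
      ((zador (wz z) p + eps) * m%:R `^ (- al)))%:E)%E].
  have [Pz|nP] := boolP (P z); last by exists 0%N.
  by have [m0 _ hm0] := zador_ub n0 (pw z Pz) p0 eps0; exists m0.
have [m0 hm0] := choice Q.
(* Once [e * m >= 1], the first condition bounds the rounding loss by [del * be z * m], and the
   second lets the allocation reach the size [m0 z] from which the quantizers exist. *)
have [e e0 he] : exists2 e, 0 < e & forall z, P z ->
    e <= del * be z /\ e * (m0 z)%:R <= (1 - 2 * del) * be z.
  apply: (@finite_lower_bound R _ P (fun z e => e <= del * be z /\
    e * (m0 z)%:R <= (1 - 2 * del) * be z)).
    move=> z e e' [he1 he2] /andP[e'0 e'e]; split; first exact: le_trans e'e he1.
    by apply: le_trans he2; rewrite ler_wpM2r.
  move=> z Pz; exists (Num.min (del * be z) ((1 - 2 * del) * be z / (m0 z).+1%:R)).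
    have d2 : 0 < 1 - 2 * del by rewrite subr_gt0.
    rewrite lt_min; apply/andP; split; first exact: mulr_gt0 (be0 z Pz).
    by apply: divr_gt0; [exact: mulr_gt0 d2 (be0 z Pz)|rewrite ltr0n].
  split; first by rewrite ge_min lexx.
  have b1 : 0 <= (1 - 2 * del) * be z by rewrite mulr_ge0 ?(ltW (be0 z Pz))//; lra.
  apply: (@le_trans _ _ ((1 - 2 * del) * be z / (m0 z).+1%:R * (m0 z)%:R)).
    by rewrite ler_wpM2r// ge_min lexx orbT.
  by rewrite -mulrA ler_piMr// mulrC ler_pdivrMr ?ltr0n// mul1r ler_nat.
pose e' := Num.min e (del / 2).
have e'0 : 0 < e' by rewrite lt_min e0 divr_gt0.
exists (Num.truncn e'^-1).+1 => m mm.
have em : 1 <= e' * m%:R.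
  rewrite -ler_pdivrMl// mulr1; have /andP[_ h'] := truncn_itv (ltW (etrans (invr_gt0 e') e'0)).
  by rewrite (le_trans (ltW h'))// ler_nat.
have m_ge0 : 0 <= m%:R :> R by [].
have m_gt0 : (0 < m)%N by exact: leq_trans mm.
have m_gt0' : 0 < m%:R :> R by rewrite ltr0n.
have em1 : 1 <= e * m%:R.
  by apply: (le_trans em); rewrite ler_wpM2r// ge_min lexx.
have em2 : 1 <= del / 2 * m%:R.
  by apply: (le_trans em); rewrite ler_wpM2r// ge_min lexx orbT.
pose mz z := Num.truncn ((1 - del) * be z * m%:R).
pose mN := Num.truncn (del * m%:R).
have tr (x : R) : 0 <= x -> x - 1 < (Num.truncn x)%:R /\ (Num.truncn x)%:R <= x.
  by move=> x_ge0; have /andP[t1 t2] := truncn_itv x_ge0; rewrite -natr1 in t2; split => //; lra.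
have [mN1 mN2] : del / 2 * m%:R <= mN%:R /\ mN%:R <= del * m%:R.
  have [t1 t2] := tr (del * m%:R) (mulr_ge0 (ltW del0) m_ge0); split => //.
  by rewrite -/mN in t1; lra.
have mN0 : (0 < mN)%N by rewrite -(ltr_nat R); lra.
have hz z : P z -> [/\ (1 - 2 * del) * be z * m%:R <= (mz z)%:R,
    (mz z)%:R <= (1 - del) * be z * m%:R & (m0 z <= mz z)%N].
  move=> Pz; have b0 := be0 z Pz.
  have [t1 t2] : (1 - del) * be z * m%:R - 1 < (mz z)%:R /\ (mz z)%:R <= (1 - del) * be z * m%:R.
    by apply: tr; apply: mulr_ge0 => //; apply: mulr_ge0; [lra|exact: ltW].
  have [he1 he2] := he z Pz.
  have g1 : 1 <= del * be z * m%:R by apply: (le_trans em1); rewrite ler_wpM2r.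
  have g2 : (m0 z)%:R <= (1 - 2 * del) * be z * m%:R.
    apply: (@le_trans _ _ ((e * m%:R) * (m0 z)%:R)); first by rewrite ler_peMl.
    by rewrite mulrAC ler_wpM2r.
  by split => //; [lra|rewrite -(ler_nat R); lra].
have QY z : exists ys : 'rV[R]_n * seq 'rV[R]_n, P z ->
    [/\ forall y, y \in ys.1 :: ys.2 -> ccube (corner z) h y, (size ys.2 < mz z)%N &
    (quant (wz z) p ys.1 ys.2 (corner z) h <= (h ^+ n * h `^ (2 * p) *
      ((zador (wz z) p + eps) * (mz z)%:R `^ (- al)))%:E)%E].
  have [Pz|nP] := boolP (P z); last by exists (0, [::]).
  have [_ _ mm0] := hz z Pz.
  by have [y0 [ys hys]] := hm0 z Pz (mz z) (corner z) h mm0 h0; exists (y0, ys).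
have [Y hY] := choice QY.
have [y0 [sN [szN sNO hN]]] := hC mN0.
pose t := [seq tangent u a y | y <- y0 :: sN] ++
  flatten [seq [seq tangent u a y | y <- (Y z).1 :: (Y z).2] | z <- enum P].
have tmin ab : ab \in t -> minorant u ab.
  have tan y : O y -> minorant u (tangent u a y).
    by move=> Oy x Ax; rewrite -subr_ge0 tangentE; exact: (bregman_ge0 h1).
  rewrite mem_cat => /orP[/mapP[y ys ->]|]; first by apply: tan; exact: sNO.
  move=> /flatten_mapP[z]; rewrite mem_enum => Pz /mapP[y ys ->].
  by apply: tan; apply: (goodP Pz).1; have [cY _ _] := hY z Pz; exact: cY.
have tsz : (0 < size t <= m)%N.
  apply/andP; split; first by [].
  rewrite size_cat size_map size_flatten /shape -map_comp sumnE big_map big_enum /=.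
  rewrite -(ler_nat R) natrD natr_sum.
  have st1 : (size sN).+1%:R <= del * m%:R :> R.
    by apply: le_trans mN2; rewrite ler_nat.
  have st2 : \sum_(z in P) (size [seq tangent u a y | y <- (Y z).1 :: (Y z).2])%:R <= (1 - del) * m%:R :> R.
    apply: (@le_trans _ _ (\sum_(z | P z) (1 - del) * be z * m%:R)).
      apply: ler_sum => z Pz; have [_ t2 _] := hz z Pz; apply: le_trans t2.
      by rewrite size_map ler_nat; have [_ + _] := hY z Pz.
    rewrite -mulr_suml -mulr_sumr ler_wpM2r// ler_piMr//; first by lra.
    rewrite -mulr_suml -/S; have [->|Sn] := eqVneq S 0; first by rewrite mul0r.
    by rewrite mulfV.
  by move: st1 st2; rewrite /=; lra.
have [l [lP tl lf]] := Pc_intro uN tsz tmin; exists l => //.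
have fl x y : A x -> tangent u a y \in t -> f x - l x <= bregman u a x y.
  by move=> Ax yt; rewrite -tangentE; have := tl x _ yt; lra.
pose B := ((1 + eta) / 2) `^ p; have B0 : 0 <= B by exact: powR_ge0.
pose D := (C * mN%:R `^ (- (2 / n%:R))) `^ p; have D0 : 0 <= D by exact: powR_ge0.
pose g z x := (B%:E * (\1_(cube (corner z) h) x * minq (wz z) (Y z).1 (Y z).2 x `^ p)%:E)%E.
have g0 z x : (0 <= g z x)%E by rewrite /g -EFinM lee_fin !mulr_ge0// powR_ge0.
have ng z : P z -> nice (g z).
  move=> Pz; apply: niceZ => //; first by move=> x; rewrite lee_fin mulr_ge0// powR_ge0.
  by apply: nice_quant => //; exact: pw.
have [nS JS] := @nice_sum _ n _ (index_enum _) P g (fun z x _ => g0 z x) ng.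
pose bad (z : 'rV['I_(2 ^ k)]_n) := cell_meets A c L z && ~~ P z.
have [nB JB] := @nice_gcells _ n c L _ bad (fun=> D) L0 (fun=> D0).
have sg0 x : (0 <= \sum_(z | P z) g z x)%E by apply: sume_ge0.
have sb0 x : (0 <= (\sum_(z | bad z) D * \1_(gcell c L z) x)%:E)%E.
  by rewrite lee_fin; apply: sumr_ge0 => z _; rewrite mulr_ge0.
have [nphi Jphi] := niceD sg0 sb0 nS nB.
apply: (@le_trans _ _ (\sum_(z | P z) J (g z) + (\sum_(z | bad z) D * h ^+ n)%:E)%E).
  rewrite -JS -JB -Jphi.
  (* The gap is not known to be [nice] and its boundary values are free, but the majorant is a
     finite sum of nice functions. *)
  apply: (integral_on_interior convA x0A L0 AL) => //.
  - by move=> x; rewrite lee_fin powR_ge0.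
  - by move=> x; rewrite adde_ge0.
  move=> x Ox; have Ax := interior_subset Ox.
  have fl0 : 0 <= f x - l x by rewrite subr_ge0 lf.
  have [z zx] := @gcell_cover _ _ c L (2 ^ k) x L0 (expn_gt0 2 k) (AL Ax).
  have [Pz|nPz] := boolP (P z).
    apply: (@le_trans _ _ (g z x)); last first.
      by rewrite (bigD1 z)//= -addeA leeDl// adde_ge0// sume_ge0.
    rewrite /g indicE mem_set// mul1r -EFinM lee_fin -powRM ?minq_ge0//; last 2 first.
    - by rewrite divr_ge0//; lra.
    - exact: pw.
    have q0 : 0 <= (1 + eta) / 2 * minq (wz z) (Y z).1 (Y z).2 x.
      by rewrite mulr_ge0 ?divr_ge0 ?minq_ge0//; [lra|exact: pw].
    apply: ge0_ler_powR; rewrite ?nnegrE ?(ltW p0)//.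
    have [y ys ->] := minq_mem (wz z) (Y z).1 (Y z).2 x.
    apply: (@le_trans _ _ (bregman u a x y)).
      apply: fl => //; rewrite mem_cat; apply/orP; right; apply/flatten_mapP.
      by exists z; rewrite ?mem_enum//; apply/mapP; exists y.
    have cx : ccube (corner z) h x by move=> i; have /andP[-> /ltW->] := zx i.
    have [cY _ _] := hY z Pz.
    by have /andP[_] := (goodP Pz).2 x y (corner z) cx (cY y ys) (corner_in z).
  apply: (@le_trans _ _ (\sum_(z | bad z) D * \1_(gcell c L z) x)%:E); last by rewrite leeDr.
  rewrite (sum_gcell _ _ L0 zx).
  have -> : bad z by rewrite /bad nPz andbT; apply/asboolP; exists x.
  rewrite lee_fin; have [y ys bxy] := hN x Ox.
  apply: ge0_ler_powR; rewrite ?nnegrE ?(ltW p0)//.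
    by rewrite mulr_ge0 ?powR_ge0 ?(ltW C0).
  apply: le_trans bxy; apply: fl => //; rewrite mem_cat; apply/orP; left.
  by apply/mapP; exists y.
apply: (@le_trans _ _ ((\sum_(z | P z) B * (h ^+ n * h `^ (2 * p) *
    ((zador (wz z) p + eps) * (mz z)%:R `^ (- al))))%:E + (\sum_(z | bad z) D * h ^+ n)%:E)%E).
  rewrite leeD2r// -sumEFin; apply: lee_sum => z Pz; rewrite /g integral_RnZl//; last first.
    by move=> x; rewrite lee_fin mulr_ge0// powR_ge0.
  rewrite EFinM lee_wpmul2l ?lee_fin//.
  by have [_ _] := hY z Pz.
rewrite -EFinD lee_fin mulrDr; apply: lerD; last first.
  rewrite -!mulr_sumr mulrA; rewrite ler_wpM2r//.
    by apply: sumr_ge0 => z _; rewrite exprn_ge0// ltW.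
  rewrite /D powRM ?powR_ge0 ?(ltW C0)// mulrCA ler_wpM2l ?powR_ge0//.
  rewrite -powRrM mulNr -powRM ?divr_ge0 ?(ltW del0)// (_ : 2 / n%:R * p = al); last by ring.
  rewrite !powRN lef_pV2 ?posrE ?powR_gt0 ?mulr_gt0 ?divr_gt0 ?ltr0n//.
  apply: ge0_ler_powR; rewrite ?nnegrE ?(ltW al0) ?mulr_ge0 ?divr_ge0 ?(ltW del0)//.
  by rewrite mulrC.
rewrite -!mulr_sumr -/B.
rewrite (_ : m%:R `^ (- al) * _ = B * ((h ^+ n * h `^ (2 * p)) *
   (m%:R `^ (- al) * (1 - 2 * del) `^ (- al) * S `^ (1 + al)))); last by rewrite -/S; ring.
rewrite ler_wpM2l// ler_wpM2l ?mulr_ge0 ?exprn_ge0 ?powR_ge0 ?(ltW h0)//.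
(* Since the quantizer constant of [z] is [s z ^ (1 + al)] and its share is [s z / S], the cell
   contributes [s z * S ^ al], and the cells together [S ^ (1 + al)]. *)
apply: (@le_trans _ _ (\sum_(z | P z) m%:R `^ (- al) * (1 - 2 * del) `^ (- al) * (s z * S `^ al))).
  apply: ler_sum => z Pz; have [t1 _ _] := hz z Pz.
  have d2 : 0 < 1 - 2 * del by rewrite subr_gt0.
  have b0 := be0 z Pz.
  have sE : zador (wz z) p + eps = s z * s z `^ al.
    rewrite -{1}[s z]powRr1 ?(ltW (s0 z Pz))// -powRD; last by rewrite gt_eqF.
    by rewrite -powRrM mulVf ?gt_eqF// powRr1// ltW// ze.
  apply: (@le_trans _ _ ((zador (wz z) p + eps) * ((1 - 2 * del) * be z * m%:R) `^ (- al))).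
    have bm0 : 0 < (1 - 2 * del) * be z * m%:R by exact: mulr_gt0 (mulr_gt0 d2 b0) m_gt0'.
    have mz0 : 0 < (mz z)%:R :> R by exact: lt_le_trans bm0 t1.
    rewrite ler_wpM2l ?(ltW (ze z Pz))// !powRN lef_pV2 ?posrE; last 2 first.
    - exact: powR_gt0.
    - exact: powR_gt0.
    by apply: ge0_ler_powR => //; rewrite ?nnegrE ?(ltW al0) ?(ltW bm0).
  rewrite (powRM _ (ltW (mulr_gt0 d2 b0)) m_ge0) (powRM _ (ltW d2) (ltW b0)) sE.
  have -> : be z `^ (- al) = S `^ al / s z `^ al.
    rewrite /be powRM ?invr_ge0 ?(ltW (s0 z Pz)) ?(ltW (Sz z Pz))// powRN mulrC; congr (_ * _).
    by rewrite -[S^-1]powR_inv1// -powRrM mulN1r opprK.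
  rewrite le_eqVlt; apply/orP; left; apply/eqP.
  by field; rewrite gt_eqF// powR_gt0// s0.
rewrite -mulr_sumr -mulr_suml -/S le_eqVlt; apply/orP; left; apply/eqP; congr (_ * _).
have [->|Sn] := eqVneq S 0; first by rewrite mul0r powR0// gt_eqF.
by rewrite powRD ?powRr1// gt_eqF.
Qed.

End UpperBound.

(** * Inequalities for powers, and limits in the extended reals *)

Section PowerLemmas.
Variable R : realType.

Lemma powR_subadditive (x y s : R) : 0 <= x -> 0 <= y -> 0 < s <= 1 ->
  (x + y) `^ s <= x `^ s + y `^ s.
Proof.
move=> x0 y0 /andP[s0 s1].
have [xy|xy] := eqVneq (x + y) 0.
  by rewrite xy powR0 ?gt_eqF// addr_ge0 ?powR_ge0.
have xy0 : 0 < x + y by rewrite lt_def xy addr_ge0.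
have h t : 0 <= t -> t <= x + y -> t / (x + y) * (x + y) `^ s <= t `^ s.
  move=> t0 txy; have -> : t `^ s = (t / (x + y)) `^ s * (x + y) `^ s.
    by rewrite -powRM ?divr_ge0 ?(ltW xy0)// divfK.
  rewrite ler_wpM2r ?powR_ge0//; have [->|tn] := eqVneq t 0.
    by rewrite mul0r powR0 ?gt_eqF.
  apply: ger1_powR => //; rewrite divr_gt0 ?lt_def ?tn//=; last by rewrite -lt_def.
  by rewrite ler_pdivrMr// mul1r.
have := lerD (h x x0 _) (h y y0 _); rewrite lerDl lerDr y0 x0 => /(_ isT isT).
by rewrite -mulrDl -mulrDl mulfV// mul1r.
Qed.

(** Turns the bound for cells of side [h] into a power of the Riemann sum [h ^ n * S]. *)
Lemma powR_scale_sum (n : nat) (p h S : R) : (0 < n)%N -> 0 < h -> 0 <= S ->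
  h ^+ n * h `^ (2 * p) * S `^ (1 + 2 * p / n%:R) = (h ^+ n * S) `^ (1 + 2 * p / n%:R).
Proof.
move=> n0 h0 S0; rewrite powRM ?exprn_ge0 ?(ltW h0)//; congr (_ * _).
rewrite -powR_mulrn ?(ltW h0)// -powRrM -powRD; last by rewrite (gt_eqF h0) implybT.
by congr (_ `^ _); field; rewrite pnatr_eq0 -lt0n.
Qed.

Lemma powR_gap (r E : R) : 0 <= r < 1 -> 0 < E -> exists2 q, 0 < q < 1 & r < q `^ E.
Proof.
move=> /andP[r0 r1] E0; have h0 : 0 < (1 + r) / 2 by lra.
have iE : 0 < E^-1 by rewrite invr_gt0.
exists (((1 + r) / 2) `^ E^-1); last first.
  by rewrite -powRrM mulVf ?gt_eqF// powRr1 ?(ltW h0)//; lra.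
rewrite powR_gt0//=; have := gt0_ltr_powR iE; move/(_ ((1 + r) / 2) 1).
by rewrite !nnegrE ler01 (ltW h0) powR1; apply => //; lra.
Qed.

Lemma powR_gap_above (B E : R) : 1 < B -> 0 < E -> exists2 q, 1 < q &
  forall q', 1 <= q' <= q -> q' `^ E <= B.
Proof.
move=> B1 E0; have iE : 0 < E^-1 by rewrite invr_gt0.
exists (B `^ E^-1).
  have := gt0_ltr_powR iE; move/(_ 1 B).
  by rewrite !nnegrE ler01 (ltW (lt_trans ltr01 B1)) powR1; exact.
move=> q' /andP[q1 q2]; have -> : B = (B `^ E^-1) `^ E.
  by rewrite -powRrM mulVf ?gt_eqF// powRr1// ltW// (lt_trans ltr01).
by apply: ge0_ler_powR; rewrite ?nnegrE ?powR_ge0 ?(ltW E0)//; lra.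
Qed.

(** Half of the gap between [i] and [w] absorbs the factor [q]; the other half is kept for a further
    error term. *)
Lemma gap_interpolate (w i q : R) : 0 <= i -> i < w ->
  q <= 1 + (w - i) / (2 * (i + 1)) -> q * i <= i + (w - i) / 2.
Proof.
move=> i0 iw q1; apply: (le_trans (ler_wpM2r i0 q1)); rewrite mulrDl mul1r lerD2l.
have i1 : 0 < i + 1 by lra.
have -> : (w - i) / (2 * (i + 1)) * i = (w - i) / 2 * (i / (i + 1)).
  by field; rewrite gt_eqF.
by apply: ler_piMr; [lra|rewrite ler_pdivrMr//; lra].
Qed.

Lemma gap_collect (X Y Z c w i : R) : X <= Y + Z -> Y <= c -> c <= i + (w - i) / 2 ->
  Z <= (w - i) / 2 -> X <= w.
Proof. by lra. Qed.

Lemma midpoint_collect (X Y q b b' : R) : 0 < b' -> q <= (b + b') / (2 * b') ->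
  X <= q * b' -> Y <= (b - b') / 2 -> X + Y <= b.
Proof.
move=> b0 /(ler_wpM2r (ltW b0)) qb Xq Yb.
have : (b + b') / (2 * b') * b' = (b + b') / 2 by field; rewrite gt_eqF.
lra.
Qed.

(** Real bounds on either side treat a finite and an infinite limit alike, and allow the first terms
    to be infinite. *)
Lemma ereal_cvg_sandwich (x : nat -> \bar R) (l : \bar R) : (0 <= l)%E ->
  (forall b : R, (b%:E < l)%E -> exists M, forall m, (M <= m)%N -> (b%:E <= x m)%E) ->
  (forall b : R, (l < b%:E)%E -> exists M, forall m, (M <= m)%N -> (x m <= b%:E)%E) ->
  x m @[m --> \oo] --> l.
Proof.
case: l => [l| |] // l0 lo hi; last first.
  apply/cvgeyPge => b; have [M hM] := lo b (ltry b).
  by exists M => // m /= Mm; exact: hM.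
have hx e : 0 < e -> exists M, forall m, (M <= m)%N ->
    [/\ x m \is a fin_num & `|l - fine (x m)| <= e].
  move=> e0; have [|M1 hM1] := lo (l - e); first by rewrite lte_fin; lra.
  have [|M2 hM2] := hi (l + e); first by rewrite lte_fin; lra.
  exists (maxn M1 M2) => m; rewrite geq_max => /andP[/hM1 h1 /hM2 h2].
  have fx : x m \is a fin_num.
    rewrite fin_numElt (lt_le_trans _ h1) ?ltNyr//=.
    by rewrite (le_lt_trans h2) ?ltry.
  split => //; move: h1 h2; rewrite -(fineK fx) !lee_fin => h1 h2 /=.
  by rewrite ler_norml; apply/andP; split; lra.
apply/fine_cvgP; split.
  by have [M hM] := hx 1 ltr01; exists M => // m /= /hM[].
apply/cvgrPdist_le => e e0; have [M hM] := hx e e0.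
by exists M => // m /= /hM[].
Qed.

End PowerLemmas.

(** * The limit *)

Section Core.
Variables (R : realType) (n : nat) (p : R) (u : 'rV[R]_n -> \bar R).
Variables (a : 'rV[R]_n -> 'rV[R]_n) (H : 'rV[R]_n -> 'M[R]_n).
Variables (c : 'rV[R]_n) (L : R) (x0 : 'rV[R]_n).
Local Notation J := (@integral_Rn R _).
Local Notation A := (edom u).
Local Notation f x := (fine (u x)).
Local Notation O := (interiorV (edom u)).
Local Notation al := (2 * p / n%:R).
Local Notation corner := (corner c L).
Hypothesis n0 : (0 < n)%N.
Hypothesis p0 : 0 < p.
Hypothesis uN : forall x, u x != -oo%E.
Hypothesis convA : forall x y (t : R), A x -> A y -> 0 <= t <= 1 ->
  A ((1 - t) *: x + t *: y).
Hypothesis L0 : 0 < L.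
Hypothesis AL : A `<=` cube c L.
Hypothesis x0A : O x0.
Hypothesis h1 : forall x y, A x -> O y -> f y + dotv (x - y) (a y) <= f x.
Hypothesis h2 : exists B, forall y, O y -> `|a y| <= B.
Hypothesis hH : forall w, O w -> exists2 lam : R, 0 < lam &
  forall v, lam * `|v| ^+ 2 <= qf (H w) v.
Hypothesis h3 : forall x (eta : R), O x -> 0 < eta < 1 -> exists2 r, 0 < r &
  forall y y' w, `|y - x| < r -> `|y' - x| < r -> `|w - x| < r ->
    (1 - eta) / 2 * qf (H w) (y - y') <= bregman u a y y' <= (1 + eta) / 2 * qf (H w) (y - y').

Let al0 : 0 < al. Proof. by rewrite divr_gt0 ?mulr_gt0 ?ltr0n. Qed.

(** The witness is a ball rather than the cell, so that subcells inherit it. The two bounds by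
    [r / 2] put the closed cell into the ball on which the divergence is controlled. *)
Definition good_cell (eta : R) k (z : 'rV['I_(2 ^ k)]_n) := `[< exists x r,
  [/\ 0 < r, forall y, `|y - x| < r -> O y,
   forall y y' w, `|y - x| < r -> `|y' - x| < r -> `|w - x| < r ->
    (1 - eta) / 2 * qf (H w) (y - y') <= bregman u a y y' <= (1 + eta) / 2 * qf (H w) (y - y'),
   forall y, gcell c L z y -> `|y - x| < r / 2 & L / (2 ^ k)%:R < r / 2] >].

Let e20 k : (0 < 2 ^ k)%N. Proof. by rewrite expn_gt0. Qed.
Let h0 k : 0 < L / (2 ^ k)%:R. Proof. by rewrite divr_gt0// ltr0n. Qed.

Lemma good_cell_cube eta k (z : 'rV['I_(2 ^ k)]_n) : good_cell eta z ->
  good_cube u a H eta (corner z) (L / (2 ^ k)%:R).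
Proof.
move=> /asboolP[x [r [r0 rO rD zr hr]]].
have near y : ccube (corner z) (L / (2 ^ k)%:R) y -> `|y - x| < r.
  move=> cy; have := zr _ (gcell_corner c z L0); rewrite -/(corner z) => cx.
  have -> : y - x = (y - corner z) + (corner z - x) by rewrite addrA subrK.
  apply: (le_lt_trans (ler_normD _ _)).
  have : `|y - corner z| <= L / (2 ^ k)%:R.
    apply: normv_le; first exact: ltW.
    move=> i; have /andP[y1 y2] := cy i; have -> : (y - corner z) 0 i = y 0 i - corner z 0 i by rewrite mxE [X in _ + X]mxE.
    by rewrite ger0_norm ?subr_ge0// lerBlDl.
  lra.
split => [y /near/rO//|y y' w /near ? /near ? /near ?]; exact: rD.
Qed.

Lemma good_cell_hereditary eta k (z : 'rV['I_(2 ^ k)]_n) (z' : 'rV['I_(2 ^ k.+1)]_n) :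
  good_cell eta z -> gcell c L z' `<=` gcell c L z -> good_cell eta z'.
Proof.
move=> /asboolP[x [r [r0 rO rD zr hr]]] zz'; apply/asboolP; exists x, r; split => //.
  by move=> y /zz'; exact: zr.
apply: lt_trans hr; rewrite ltr_pM2l// ltf_pV2 ?posrE ?ltr0n//.
by rewrite ltr_nat ltn_exp2l.
Qed.

Lemma good_cell_sub eta k (z : 'rV['I_(2 ^ k)]_n) : good_cell eta z -> gcell c L z `<=` O.
Proof.
move=> /asboolP[x [r [r0 rO _ zr _]]] y /zr yr; apply: rO; apply: lt_trans yr _.
by rewrite ltr_pdivrMr// ltr_pMr// ltr1n.
Qed.

Lemma good_cell_exists eta eta' x : 0 < eta < 1 -> 0 < eta' < 1 -> O x ->
  exists k (z : 'rV['I_(2 ^ k)]_n), [/\ good_cell eta z, good_cell eta' z & gcell c L z x].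
Proof.
move=> e01 e01' Ox; have [r r0 rD] := h3 Ox e01; have [r' r'0 rD'] := h3 Ox e01'.
have [s s0 sO] : exists2 s : R, 0 < s & forall y, `|y - x| < s -> O y.
  by apply/interiorP; exact: nbhs_interior.
pose t := Num.min s (Num.min r r').
have t0 : 0 < t by rewrite !lt_min s0 r0.
have [k kt] := dyadic_small L0 (divr_gt0 t0 (ltr0n R 2)).
have [z zx] := @gcell_cover _ _ c L (2 ^ k) x L0 (e20 k) (AL (interior_subset Ox)).
have tb (y : 'rV[R]_n) : `|y - x| < t -> [/\ `|y - x| < s, `|y - x| < r & `|y - x| < r'].
  by rewrite !lt_min => /andP[? /andP[? ?]].
exists k, z; split => //; apply/asboolP; exists x, t; split => //.
- by move=> y /tb[/sO].
- by move=> y y' w /tb[_ ? _] /tb[_ ? _] /tb[_ ? _]; exact: rD.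
- by move=> y zy; apply: lt_trans kt; exact: gcell_dist zx zy.
- by move=> y /tb[/sO].
- by move=> y y' w /tb[_ _ ?] /tb[_ _ ?] /tb[_ _ ?]; exact: rD'.
- by move=> y zy; apply: lt_trans kt; exact: gcell_dist zx zy.
Qed.

(** The forms at [w] and [w'] describe the same divergences, one from below and one from above, so
    they are comparable. This takes the place of continuity of [H]. *)
Lemma good_cube_compare eta c' l w w' : 0 < eta < 1 -> 0 < l ->
  good_cube u a H eta c' l -> ccube c' l w -> ccube c' l w' ->
  ((1 - eta) / (1 + eta)) `^ p * zador (H w) p <= zador (H w') p.
Proof.
move=> /andP[e0 e1] l0 [gO gD] cw cw'.
have ee : 0 < (1 - eta) / (1 + eta) by rewrite divr_gt0//; lra.
apply: zador_mono => //; first by apply: (psdH hH); exact: gO.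
(* The factor [t] makes [v] fit into half the cube; both forms are homogeneous of degree 2, so it
   cancels. *)
move=> v; pose t := l / (2 * (`|v| + 1)).
have v1 : 0 < `|v| + 1 by rewrite ltr_wpDl.
have t0 : 0 < t by rewrite divr_gt0// mulr_gt0.
pose y' : 'rV[R]_n := \row_i (c' 0 i + l / 2); pose y := y' + t *: v.
have tv i : `|t * v 0 i| <= l / 2.
  rewrite normrM ger0_norm ?(ltW t0)// /t -mulrA ler_pM2l// invfM -mulrA ler_piMr ?invr_ge0//.
  by rewrite mulrC ler_pdivrMr// mul1r (le_trans (ler_coord v i))// lerDl.
have cy' : ccube c' l y' by move=> i; rewrite mxE; apply/andP; split; lra.
have cy : ccube c' l y.
  move=> i; rewrite !mxE; have := tv i; rewrite ler_norml => /andP[t1 t2].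
  by apply/andP; split; lra.
have /andP[b1 _] := gD y y' w cy cy' cw; have /andP[_ b2] := gD y y' w' cy cy' cw'.
have := le_trans b1 b2; have -> : y - y' = t *: v by rewrite /y addrC addKr.
rewrite !qfZ mulrCA [leRHS]mulrCA ler_pM2l ?exprn_gt0//.
rewrite -[X in X / 2]mul1r => q12.
rewrite -mulrA mulrCA ler_pdivrMl; last by lra.
by lra.
Qed.

(** The exponent equals [n / (n + 2 * p)]; up to normalisation this is the optimal density of the
    pieces. *)
Definition sigma x := zador (H x) p `^ (1 + al)^-1.
Let F x := \1_O x * sigma x.
Let F0 x : 0 <= F x. Proof. by rewrite mulr_ge0// powR_ge0. Qed.
Let al1 : 0 < (1 + al)^-1. Proof. by rewrite invr_gt0 addr_gt0. Qed.

Lemma sigma_exhaustion eta : 0 < eta < 1 -> nice (fun x => (\1_O x * sigma x)%:E) /\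
  J (fun x => (\1_O x * sigma x)%:E) = ereal_sup (range (fun k =>
    (\sum_(z : 'rV['I_(2 ^ k)]_n | good_cell eta z)
       inf (F @` gcell c L z) * (L / (2 ^ k)%:R) ^+ n)%:E)).
Proof.
move=> e01; have [|x e Fx0 e0|nF JF] := @dyadic_exhaustion _ n c L F (good_cell eta) L0 F0.
- by move=> k z z'; exact: good_cell_hereditary.
- have Ox : O x.
    apply: contrapT => nOx; move: Fx0; rewrite /F indicE memNset//.
    by rewrite mul0r ltxx.
  have FE y : O y -> F y = sigma y by move=> Oy; rewrite /F indicE mem_set// mul1r.
  have z0 : 0 < zador (H x) p.
    by apply: (gt0_powR al1); [exact/zador_ge0/(psdH hH)|rewrite -/(sigma x) -FE].
  have [th /andP[th0 th1] thP] := powR_lsc z0 e0 al1.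
  have th01 : 0 <= th < 1 by rewrite ltW.
  have [q /andP[q0 q1] qth] := powR_gap th01 p0.
  have q1' : 0 < 1 + q by lra.
  (* For this second tolerance the ratio in [good_cube_compare] is [q], and [th < q ^ p], so on the
     cell the constant drops at most by the factor [th]. This gives the semicontinuity of
     [sigma]. *)
  have e01' : 0 < (1 - q) / (1 + q) < 1.
    by apply/andP; split; [apply: divr_gt0; lra|rewrite ltr_pdivrMr//; lra].
  have [k [z [Gz Gz' zx]]] := good_cell_exists e01 e01' Ox.
  exists k, z; split; [exact: Gz|exact: zx|move=> y zy].
  have Oy : O y := good_cell_sub Gz zy.
  rewrite (FE _ Ox) (FE _ Oy); apply: thP; have cc w : gcell c L z w -> ccube (corner z) (L / (2 ^ k)%:R) w.
    by move=> zw i; have /andP[-> /ltW->] := zw i.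
  apply: le_trans (good_cube_compare e01' (h0 k) (good_cell_cube Gz') (cc _ zx) (cc _ zy)).
  rewrite ler_wpM2r; [by []|exact/zador_ge0/(psdH hH)|].
  have -> : (1 - (1 - q) / (1 + q)) / (1 + (1 - q) / (1 + q)) = q.
    by field; rewrite !gt_eqF//; lra.
  exact: ltW.
by split.
Qed.

Lemma integral_sigma eta : 0 < eta < 1 ->
  integral_on A (fun x => (sigma x)%:E) = ereal_sup (range (fun k =>
    (\sum_(z : 'rV['I_(2 ^ k)]_n | good_cell eta z)
       inf (F @` gcell c L z) * (L / (2 ^ k)%:R) ^+ n)%:E)).
Proof.
move=> /sigma_exhaustion[nF <-].
apply/eqP; rewrite eq_le; apply/andP; split.
  apply: (integral_on_interior convA x0A L0 AL) => //.
  - by move=> x; rewrite lee_fin powR_ge0.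
  - by move=> x Ox; rewrite lee_fin /F indicE mem_set// mul1r.
apply: le_integral_Rn => x; first by rewrite lee_fin F0.
rewrite /F indicE; have [/set_mem Ox|nOx] := boolP (x \in O).
  by rewrite mul1r asboolT//; exact: interior_subset.
by rewrite mul0r; case: ifP => // _; rewrite lee_fin powR_ge0.
Qed.

Let V k eta := \sum_(z : 'rV['I_(2 ^ k)]_n | good_cell eta z) sigma (corner z).

Lemma inf_le_corner eta k : \sum_(z : 'rV['I_(2 ^ k)]_n | good_cell eta z)
    inf (F @` gcell c L z) * (L / (2 ^ k)%:R) ^+ n <= (L / (2 ^ k)%:R) ^+ n * V k eta.
Proof.
rewrite /V mulr_sumr; apply: ler_sum => z Gz; rewrite [leRHS]mulrC.
rewrite ler_wpM2r ?exprn_ge0 ?(ltW (h0 k))//.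
have zc := gcell_corner c z L0.
apply: (@le_trans _ _ (F (corner z))).
  by apply: ge_inf; [exists 0 => _ [x _ <-]|exists (corner z)].
by rewrite /F indicE mem_set ?mul1r//; exact: (good_cell_sub Gz).
Qed.

Lemma triangle_ge0 m : (0 <= triangle_p p u m)%E.
Proof.
apply: le_ereal_inf_tmp => _ [l _ <-]; apply: integral_Rn_ge0 => x.
by case: ifP => // _; rewrite lee_fin powR_ge0.
Qed.

(* Values on the boundary are irrelevant; this is where the nice function sigma
   controls an integrand g that is only known on the interior. *)
Lemma integral_sigma_scale (k : R) (g : 'rV[R]_n -> R) : 0 <= k -> (forall x, 0 <= g x) ->
  (forall x, O x -> sigma x = k * g x) ->
  integral_on A (fun x => (sigma x)%:E) = (k%:E * integral_on A (fun x => (g x)%:E))%E.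
Proof.
move=> k0 g0 sE; have h12 : 0 < (2^-1 : R) < 1 by rewrite invr_gt0 ltr0n invf_lt1 ?ltr1n.
have [nF _] := sigma_exhaustion h12.
have SF : integral_on A (fun x => (sigma x)%:E) = J (fun x => (F x)%:E).
  by rewrite (integral_sigma h12); have [_ ->] := sigma_exhaustion h12.
have FE x : O x -> F x = k * g x by move=> Ox; rewrite /F indicE mem_set// mul1r sE.
have F0' x : ~ O x -> F x = 0 by move=> Ox; rewrite /F indicE memNset// mul0r.
move: k0; rewrite le_eqVlt => /predU1P[kE|k0].
  rewrite SF -kE mul0e (_ : (fun x => (F x)%:E) = (fun x => 0%:E * 0)%E).
    by rewrite integral_RnZl// mul0e.
  apply/funext => x; rewrite mul0e; have [Ox|/F0' ->//] := pselect (O x).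
  by rewrite FE// -kE mul0r.
have gF : integral_on A (fun x => (g x)%:E) = (k^-1%:E * J (fun x => (F x)%:E))%E.
  have ki : 0 <= k^-1 by rewrite invr_ge0 ltW.
  rewrite -integral_RnZl//.
  have gk x : O x -> g x = k^-1 * F x by move=> Ox; rewrite FE// mulKf ?gt_eqF.
  apply/eqP; rewrite eq_le; apply/andP; split.
    apply: (integral_on_interior convA x0A L0 AL).
    - by move=> x; rewrite lee_fin.
    - by move=> x; rewrite -EFinM lee_fin mulr_ge0.
    - by apply: niceZ.
    - by move=> x Ox; rewrite -EFinM lee_fin gk.
  apply: le_integral_Rn => x; first by rewrite -EFinM lee_fin mulr_ge0.
  rewrite -EFinM; have [Ox|/F0' ->] := pselect (O x).
    by rewrite asboolT ?gk//; exact: interior_subset.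
  by rewrite mulr0; case: ifP => // _; rewrite lee_fin.
by rewrite gF muleA -EFinM mulfV ?gt_eqF// mul1e.
Qed.

Lemma lower_limit (b : R) :
  (b%:E < ((2^-1 : R) `^ p)%:E *
     integral_on A (fun x => (sigma x)%:E) `^ (1 + al))%E ->
  exists M, forall m, (M <= m)%N -> (b%:E <= (m%:R `^ al)%:E * triangle_p p u m)%E.
Proof.
set I := integral_on _ _ => bI.
have I0 : (0 <= I)%E.
  by apply: integral_Rn_ge0 => x; case: ifP => // _; rewrite lee_fin powR_ge0.
have al1' : 0 < 1 + al by rewrite addr_gt0.
have [b0|b0] := ltP b 0.
  exists 0%N => m _; apply: (@le_trans _ _ 0%E); first by rewrite lee_fin ltW.
  by rewrite mule_ge0 ?lee_fin ?powR_ge0 ?triangle_ge0.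
set D := (2^-1 : R) `^ p in bI; have D0 : 0 < D by rewrite powR_gt0.
(* A finite [v] replaces the integral, which may be infinite, and still beats [b]. *)
have [v v0 [vI bv]] : exists2 v : R, 0 < v & (v%:E < I)%E /\ b < D * v `^ (1 + al).
  move: bI I0; case: I => [i| |] // bI I0; last first.
    exists (((b + 1) / D) `^ (1 + al)^-1); first by rewrite powR_gt0// divr_gt0//; lra.
    rewrite ltry; split => //; rewrite -powRrM mulVf ?gt_eqF// powRr1; last by rewrite divr_ge0 ?(ltW D0)//; lra.
    by rewrite mulrC divfK ?gt_eqF//; lra.
  rewrite lee_fin in I0; rewrite poweR_EFin -EFinM lte_fin in bI.
  have i0 : 0 < i.
    rewrite lt_def I0 andbT; apply/negP => /eqP iE; move: bI.
    by rewrite iE powR0 ?mulr0 ?gt_eqF// ltNge b0.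
  have g0 : 0 < (i `^ (1 + al) - b / D) / 2.
    by rewrite divr_gt0// subr_gt0 ltr_pdivrMr// mulrC.
  have [th /andP[th0 th1] thP] := powR_lsc i0 g0 al1'.
  exists (th * i); first by rewrite mulr_gt0.
  split; first by rewrite lte_fin gtr_pMl.
  have := thP (th * i) (lexx _); rewrite -(ler_pM2l D0); apply: lt_le_trans.
  have : D * (b / D) = b by rewrite mulrC divfK ?gt_eqF.
  by move: bI; lra.
have dv0 : 0 < D * v `^ (1 + al) by rewrite mulr_gt0 ?powR_gt0.
have r01 : 0 <= b / (D * v `^ (1 + al)) < 1.
  by rewrite divr_ge0 ?(ltW dv0)//= ltr_pdivrMr// mul1r.
(* With [eta = tau = 1 - q], the bound on the cells loses [q ^ p] in the divergence and
   [q ^ (n + 2 * p)] by shrinking the cells. *)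
have E0 : 0 < p + n%:R + 2 * p by rewrite !addr_gt0 ?mulr_gt0 ?ltr0n.
have [q /andP[q0 q1] qr] := powR_gap r01 E0.
have e01 : 0 < 1 - q < 1 by apply/andP; split; lra.
move: vI; rewrite /I (integral_sigma e01) => /ereal_sup_gt[_ [k _ <-]]; rewrite lte_fin => vk.
have {}vk := lt_le_trans vk (inf_le_corner (1 - q) k).
have gd (z : 'rV['I_(2 ^ k)]_n) : good_cell (1 - q) z -> good_cube u a H (1 - q) (corner z) (L / (2 ^ k)%:R).
  exact: good_cell_cube.
have [N hN] := lower_bound_cells n0 p0 uN L0 AL x0A h1 h2 hH e01 e01 gd.
rewrite -[\sum_(z | _) _]/(V k (1 - q)) in hN.
set K0 := ((1 - (1 - q)) / 2) `^ p * _ * _ in hN.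
have bK : b < K0.
  have -> : K0 = D * (q `^ (p + n%:R + 2 * p) * ((L / (2 ^ k)%:R) ^+ n * V k (1 - q)) `^ (1 + al)).
    have V0 : 0 <= V k (1 - q) by apply: sumr_ge0 => z _; exact: powR_ge0.
    rewrite -powR_scale_sum// /K0; have := h0 k; set h := L / _ => hh0.
    rewrite opprB addrC subrK exprMn [(q * h) `^ _]powRM ?(ltW q0) ?(ltW hh0)//.
    have -> : q `^ (p + n%:R + 2 * p) = q `^ p * q ^+ n * q `^ (2 * p).
      rewrite -(powR_mulrn n (ltW q0)) powRD; last by rewrite (gt_eqF q0) implybT.
      by rewrite powRD // (gt_eqF q0) implybT.
    have -> : (q / 2) `^ p = q `^ p * D by rewrite powRM ?(ltW q0).
    ring.
  apply: (@lt_le_trans _ _ (D * (q `^ (p + n%:R + 2 * p) * v `^ (1 + al)))).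
    by move: qr; rewrite ltr_pdivrMr//; lra.
  rewrite ler_pM2l// ler_wpM2l ?powR_ge0//; apply: ge0_ler_powR; rewrite ?nnegrE ?(ltW v0) ?(ltW al1')//.
    by rewrite (le_trans (ltW v0)) ?ltW.
  exact: ltW.
have K00 : 0 < K0 by exact: le_lt_trans b0 bK.
have r01' : 0 <= b / K0 < 1 by rewrite divr_ge0 ?(ltW K00)//= ltr_pdivrMr// mul1r.
have [t /andP[t0 t1] tr] := powR_gap r01' al0.
(* From this size on [m / (m + N) >= t], so the extra [N] centres cost at most the factor
   [t ^ al]. *)
exists (Num.truncn (t * N%:R / (1 - t))).+1 => m Mm.
have t1' : 0 < 1 - t by lra.
have m0 : (0 < m)%N by exact: leq_trans Mm.
have tm : t * (m + N)%:R <= m%:R.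
  have : t * N%:R / (1 - t) < m%:R.
    have /andP[_ hh] := truncn_itv (divr_ge0 (mulr_ge0 (ltW t0) (ler0n R N)) (ltW t1')).
    by rewrite (lt_le_trans hh)// ler_nat.
  by rewrite ltr_pdivrMr// natrD; lra.
apply: (@le_trans _ _ ((m%:R `^ al)%:E * (K0 * (m + N)%:R `^ (- al))%:E)%E); last first.
  rewrite lee_wpmul2l ?lee_fin ?powR_ge0//; apply: le_ereal_inf_tmp => _ [l lP <-].
  exact: hN.
rewrite -EFinM lee_fin.
have mN0 : 0 < (m + N)%:R :> R by rewrite ltr0n addn_gt0 m0.
have : t `^ al <= m%:R `^ al * (m + N)%:R `^ (- al).
  rewrite powRN ler_pdivlMr ?powR_gt0// -powRM ?(ltW t0)//.
  apply: ge0_ler_powR; [exact: (ltW al0)| | |exact: tm]; rewrite nnegrE.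
    by apply: mulr_ge0; apply: ltW.
  exact: ler0n.
move=> hh; move: tr; rewrite ltr_pdivrMr// mulrC => /ltW btK; apply: (le_trans btK).
by rewrite mulrCA ler_pM2l.
Qed.

Lemma upper_limit (b : R) :
  (((2^-1 : R) `^ p)%:E * integral_on A (fun x => (sigma x)%:E) `^ (1 + al) < b%:E)%E ->
  exists M, forall m, (M <= m)%N -> ((m%:R `^ al)%:E * triangle_p p u m <= b%:E)%E.
Proof.
set I := integral_on _ _ => Ib.
have I0 : (0 <= I)%E.
  by apply: integral_Rn_ge0 => x; case: ifP => // _; rewrite lee_fin powR_ge0.
have al1' : 0 < 1 + al by rewrite addr_gt0.
set D := (2^-1 : R) `^ p in Ib; have D0 : 0 < D by rewrite powR_gt0.
have [i IE] : exists i, I = i%:E.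
  move: Ib I0; case: I => [i| |] // + _; first by exists i.
  by rewrite poweRyr ?gt_eqF// gt0_muley ?lte_fin.
rewrite IE lee_fin in I0; rewrite IE poweR_EFin -EFinM lte_fin in Ib.
(* [b'] is halfway between the limit and [b], and [w] is the value of the integral that would yield
   [b']. The gap from [i] to [w] pays for [eps] and the oscillation of [sigma] in a cell; the gap
   from [b'] to [b] pays for [eta], [del] and the bad cells. *)
pose b' := (D * i `^ (1 + al) + b) / 2.
have dp0 : 0 <= D * i `^ (1 + al) by rewrite mulr_ge0 ?powR_ge0 ?(ltW D0).
have b'0 : 0 < b' by rewrite /b'; lra.
have b'b : b' < b by rewrite /b'; lra.
pose w := (b' / D) `^ (1 + al)^-1.
have wE : D * w `^ (1 + al) = b'.
  rewrite /w -powRrM mulVf ?gt_eqF// powRr1; last exact: (ltW (divr_gt0 b'0 D0)).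
  by rewrite mulrC divfK ?gt_eqF.
have w0 : 0 <= w by exact: powR_ge0.
have iw : i < w.
  rewrite ltNge; apply/negP => wi.
  have : w `^ (1 + al) <= i `^ (1 + al).
    by apply: ge0_ler_powR; rewrite ?nnegrE ?(ltW al1').
  by rewrite -(ler_pM2l D0) wE /b'; lra.
have [q1 q11 hq1] : exists2 q, 1 < q & forall q', 1 <= q' <= q ->
    q' `^ (p * (1 + al)^-1) <= 1 + (w - i) / (2 * (i + 1)).
  apply: powR_gap_above; last by rewrite mulr_gt0.
  by rewrite ltrDl divr_gt0//; lra.
have [q2 q21 hq2] : exists2 q, 1 < q & forall q', 1 <= q' <= q ->
    q' `^ (p + al) <= (b + b') / (2 * b').
  apply: powR_gap_above; last by rewrite addr_gt0.
  by rewrite ltr_pdivlMr; lra.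
pose q := Num.min q1 q2.
have q_gt1 : 1 < q by rewrite lt_min q11.
have qq1 : q `^ (p * (1 + al)^-1) <= 1 + (w - i) / (2 * (i + 1)).
  by apply: hq1; rewrite (ltW q_gt1) ge_min lexx.
have qq2 : q `^ (p + al) <= (b + b') / (2 * b').
  by apply: hq2; rewrite (ltW q_gt1) ge_min lexx orbT.
have q0 : 0 < q by lra.
(* This choice gives [(1 - eta) / (1 + eta) = 1 / q] and [1 + eta <= q], and [del] below satisfies
   [1 - 2 * del = 1 / q], so that all these losses become powers of [q]. *)
pose eta := (q - 1) / (q + 1).
have e01 : 0 < eta < 1.
  by rewrite /eta; apply/andP; split; [apply: divr_gt0; lra|rewrite ltr_pdivrMr; lra].
have etaq : (1 - eta) / (1 + eta) = q^-1.
  by rewrite /eta; field; rewrite !gt_eqF//; lra.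
have eta_le : 1 + eta <= q.
  have : eta <= q - 1 by rewrite /eta ler_pdivrMr; [rewrite ler_peMr; lra|lra].
  lra.
have eta_half : ((0 <= (1 + eta) / 2) * (0 <= q / 2) * ((1 + eta) / 2 <= q / 2)).
  by have /andP[eta0 _] := e01; split; [split|]; lra.
pose del := (1 - q^-1) / 2.
have qi : 0 < q^-1 < 1 by rewrite invr_gt0 q0 invf_lt1.
have /andP[qi0 qi1] := qi.
have del0 : 0 < del by rewrite /del; lra.
have del1 : 2 * del < 1 by rewrite /del; lra.
have delE : 1 - 2 * del = q^-1 by rewrite /del; lra.
pose s := (1 + al)^-1.
have s0 : 0 < s by exact: al1.
have s1 : s <= 1 by rewrite invf_le1// lerDl ltW.
have Ln0 : 0 < L ^+ n by rewrite exprn_gt0.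
pose eps := ((w - i) / 2 / L ^+ n) `^ s^-1.
have wi0 : 0 < (w - i) / 2 / L ^+ n by rewrite divr_gt0//; lra.
have eps0 : 0 < eps by rewrite powR_gt0.
have epsE : eps `^ s * L ^+ n = (w - i) / 2.
  rewrite /eps -powRrM mulVf ?gt_eqF// powRr1 ?(ltW wi0)//.
  by rewrite divfK// gt_eqF.
have [C C0 hC] := uniform_net n0 L0 AL x0A h1 h2.
pose e2 := (b - b') / 2 / (C `^ p * (del / 2) `^ (- al)).
have cd0 : 0 < C `^ p * (del / 2) `^ (- al).
  by rewrite mulr_gt0 ?powR_gt0// divr_gt0.
have e20' : 0 < e2 by apply: divr_gt0 cd0; rewrite divr_gt0 ?subr_gt0.
have [k hk] : exists k, \sum_(z : 'rV['I_(2 ^ k)]_n | cell_meets A c L z && ~~ good_cell eta z)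
    (L / (2 ^ k)%:R) ^+ n <= e2.
  apply: (bad_cells_small convA x0A L0 AL) => //.
  - by move=> k z z'; exact: good_cell_hereditary.
  - by move=> k z; exact: good_cell_sub.
  - by move=> x Ox; have [k [z [Gz _ zx]]] := good_cell_exists e01 e01 Ox; exists k, z.
have gd (z : 'rV['I_(2 ^ k)]_n) : good_cell eta z -> good_cube u a H eta (corner z) (L / (2 ^ k)%:R).
  exact: good_cell_cube.
have [m1 hm1] := upper_bound_cells n0 p0 uN convA L0 AL x0A h1 hH e01 eps0 del0 del1 C0 hC gd.
exists m1.+1 => m mm; have m0 : 0 < m%:R :> R by rewrite ltr0n (leq_trans _ mm).
have [l lP hl] := hm1 m (ltnW mm).
apply: (@le_trans _ _ ((m%:R `^ al)%:E * integral_on A (fun x => ((f x - l x) `^ p)%:E))%E).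
  by rewrite lee_wpmul2l ?lee_fin ?powR_ge0//; apply: ereal_inf_lbound; exists l.
apply: le_trans (lee_wpmul2l _ hl) _; first by rewrite lee_fin powR_ge0.
have mE : m%:R `^ al * m%:R `^ (- al) = 1 :> R.
  by rewrite powRN mulfV// gt_eqF// powR_gt0.
rewrite -EFinM lee_fin [leLHS]mulrA mE mul1r.
set h := L / (2 ^ k)%:R.
set S' := \sum_(z | _) _.
have S'0 : 0 <= S' by apply: sumr_ge0 => z _; exact: powR_ge0.
rewrite -[_ * (h ^+ n * _) * _]mulrA powR_scale_sum//; last exact: h0.
have hn0 : 0 < h ^+ n by rewrite exprn_gt0// h0.
have main : h ^+ n * S' <= w.
  have st1 : h ^+ n * S' <= h ^+ n * V k eta +
      eps `^ s * \sum_(z : 'rV['I_(2 ^ k)]_n | good_cell eta z) h ^+ n.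
    rewrite /V !mulr_sumr -big_split/=; apply: ler_sum => z Gz.
    rewrite [eps `^ s * _]mulrC -mulrDr ler_pM2l//; apply: powR_subadditive.
    - by apply: zador_ge0; apply: (psdH hH); apply: (good_cell_sub Gz); exact: gcell_corner.
    - exact: ltW.
    - by rewrite s0.
  have st2 : \sum_(z : 'rV['I_(2 ^ k)]_n | good_cell eta z) h ^+ n <= L ^+ n.
    have h2n : 0 <= L ^+ n by rewrite ltW.
    apply: (@le_trans _ _ (\sum_(z : 'rV['I_(2 ^ k)]_n) h ^+ n)).
      by rewrite [leRHS](bigID (good_cell eta (k:=k)))/= lerDl; apply: sumr_ge0 => z _; exact: ltW.
    rewrite sumr_const card_mx card_ord mul1n -mulr_natl natrX -exprMn /h.
    by rewrite mulrC divfK// gt_eqF// ltr0n.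
  (* On a good cell the value of [sigma] at the corner is at most [q ^ (p * s)] times its infimum,
     and the infima form a lower sum of the integral. *)
  have st3 : h ^+ n * V k eta <= q `^ (p * s) * i.
    have := integral_sigma e01; rewrite -/I IE => IE'.
    have : \sum_(z : 'rV['I_(2 ^ k)]_n | good_cell eta z) inf (F @` gcell c L z) * h ^+ n <= i.
      by rewrite -lee_fin IE'; apply: ereal_sup_ubound; exists k.
    rewrite -(ler_pM2l (powR_gt0 (p * s) q0)); apply: le_trans.
    rewrite /V !mulr_sumr; apply: ler_sum => z Gz; rewrite mulrA mulrC ler_pM2r//.
    have zc := gcell_corner c z L0.
    rewrite mulrC -ler_pdivrMr ?powR_gt0//; apply: lb_le_inf.
      by exists (F (corner z)), (corner z).
    move=> _ [y zy <-]; rewrite /F indicE mem_set ?mul1r; last exact: (good_cell_sub Gz).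
    rewrite ler_pdivrMr ?powR_gt0//.
    have cy : ccube (corner z) h y by move=> j; have /andP[-> /ltW->] := zy j.
    have cc : ccube (corner z) h (corner z) by move=> j; rewrite lexx lerDl ltW// h0.
    have := good_cube_compare e01 (h0 k) (gd z Gz) cc cy; rewrite etaq.
    have zn w' : O w' -> 0 <= zador (H w') p by move=> Ow; apply: zador_ge0; exact: (psdH hH).
    have Oc : O (corner z) by exact: (good_cell_sub Gz).
    have Oy : O y by exact: (good_cell_sub Gz).
    have -> : q^-1 `^ p = (q `^ p)^-1 by rewrite -[q^-1]powR_inv1 ?(ltW q0)// -powRrM mulN1r powRN.
    rewrite ler_pdivrMl ?powR_gt0// => cmp.
    rewrite /sigma powRrM -powRM ?powR_ge0 ?zn//.
    apply: ge0_ler_powR; rewrite ?nnegrE ?(ltW s0) ?zn ?mulr_ge0 ?powR_ge0 ?zn//.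
    by rewrite mulrC.
  have : eps `^ s * \sum_(z : 'rV['I_(2 ^ k)]_n | good_cell eta z) h ^+ n <= (w - i) / 2.
    by rewrite -epsE ler_wpM2l ?powR_ge0.
  move=> Zw; exact: (gap_collect st1 st3 (gap_interpolate I0 iw qq1) Zw).
have sm : C `^ p * (del / 2) `^ (- al) * \sum_(z : 'rV['I_(2 ^ k)]_n |
    cell_meets A c L z && ~~ good_cell eta z) h ^+ n <= (b - b') / 2.
  apply: (@le_trans _ _ (C `^ p * (del / 2) `^ (- al) * e2)); first by rewrite ler_pM2l.
  by rewrite /e2 mulrC divfK// gt_eqF.
have mn : ((1 + eta) / 2) `^ p * (1 - 2 * del) `^ (- al) * (h ^+ n * S') `^ (1 + al) <= q `^ (p + al) * b'.
  rewrite -wE; have -> : q `^ (p + al) * (D * w `^ (1 + al)) =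
      (q `^ p * D) * q `^ al * w `^ (1 + al).
    by rewrite powRD ?(gt_eqF q0) ?implybT//; ring.
  rewrite delE; have -> : q^-1 `^ (- al) = q `^ al.
    by rewrite -[q^-1]powR_inv1 ?(ltW q0)// -powRrM mulN1r opprK.
  apply: ler_pM; rewrite ?mulr_ge0 ?powR_ge0//.
    rewrite ler_wpM2r ?powR_ge0// /D -powRM ?(ltW q0)//.
    by apply: (ge0_ler_powR (ltW p0)); rewrite ?nnegrE ?eta_half.
  by apply: ge0_ler_powR; rewrite ?nnegrE ?(ltW al1') ?mulr_ge0 ?(ltW hn0).
exact: (midpoint_collect b'0 qq2 mn sm).
Qed.

Theorem core_limit : (fun m : nat => ((m%:R `^ al)%:E * triangle_p p u m)%E) @ \oo -->
  (((2^-1 : R) `^ p)%:E * integral_on A (fun x => (sigma x)%:E) `^ (1 + al))%E.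
Proof.
apply: ereal_cvg_sandwich.
- by rewrite mule_ge0 ?lee_fin ?powR_ge0 ?poweR_ge0.
- exact: lower_limit.
- exact: upper_limit.
Qed.

End Core.

(** * Dependence of the constant on the quadratic form *)

Section Cholesky.
Variable R : realType.
Local Notation J := (@integral_Rn R _).

Lemma mulmx_bound n k (M : 'M[R]_(n, k)) : exists2 K : R, 0 < K &
  forall v : 'rV[R]_n, `|v *m M| <= K * `|v|.
Proof.
pose K := \sum_i \sum_j `|M i j| + 1.
have K0 : 0 < K by rewrite ltr_wpDl//; apply: sumr_ge0 => i _; exact: sumr_ge0.
exists K => // v; apply: normv_le; first by rewrite mulr_ge0 ?(ltW K0).
move=> j; rewrite mxE (le_trans (ler_norm_sum _ _ _))//.
apply: (@le_trans _ _ (\sum_i (\sum_k `|M i k|) * `|v|)); last first.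
  by rewrite -mulr_suml ler_wpM2r// lerDl.
apply: ler_sum => i _; rewrite normrM mulrC ler_pM//; last exact: ler_coord.
by rewrite (bigD1 j)//= lerDl; exact: sumr_ge0.
Qed.

(** The factor is built in upper triangular blocks because each such step is a substitution covered
    by [integral_Rn_triangular]; this is why the substitution formula is carried through the
    induction. *)
Lemma cholesky n (H : 'M[R]_n) : H^T = H -> posdef H ->
  exists (S : 'M[R]_n) (d : R),
    [/\ 0 < d, S \in unitmx, H = S *m S^T, d ^+ 2 = \det H &
     forall g : 'rV[R]_n -> \bar R, (forall x, 0 <= g x)%E ->
       J g = (d%:E * J (fun x => g (x *m S)))%E].
Proof.
elim: n H => [|n IH] H HT Hpos.
  exists 1%:M, 1; split => //; first exact: unitmx1.
  - by apply/matrixP => -[].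
  - by rewrite det_mx00 expr1n.
  - by move=> g _ /=; rewrite mul1e mulmx1.
rewrite -[n.+1]/(1 + n)%N in H HT Hpos *.
pose b := ursubmx H; pose D := drsubmx H; pose al := ulsubmx H 0 0.
have bT : dlsubmx H = b^T by rewrite /b -{1}HT trmx_ursub.
have DT : D^T = D by rewrite /D trmx_drsub HT.
have HE : H = block_mx al%:M b b^T D.
  rewrite -[LHS]submxK bT; congr (block_mx _ _ _ _).
  by apply/matrixP => i j; rewrite !ord1 [RHS]mxE mulr1n.
have Dpos : posdef D.
  move=> v v0; have := Hpos (row_mx 0 v); rewrite HE mul_row_block !mul0mx !add0r.
  rewrite tr_row_mx mul_row_col trmx0 mulmx0 add0r; apply.
  by apply: contra_neq v0 => /(congr1 rsubmx); rewrite row_mxKr linear0.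
have [S [d [d0 SU DE dD JS]]] := IH D DT Dpos.
have STU : S^T \in unitmx by rewrite unitmx_tr.
pose r := b *m invmx S^T.
have rb : r *m S^T = b by rewrite /r mulmxKV.
have rb' : S *m r^T = b^T by rewrite -rb [RHS]trmx_mul trmxK.
pose q := al - (r *m r^T) 0 0.
have subE (M N : 'M[R]_1) : (M - N) 0 0 = M 0 0 - N 0 0 by rewrite mxE [(- N) _ _]mxE.
have q0 : 0 < q.
  (* [q] is the Schur complement of [D]: the vector [(1, - w)] minimises the form among the vectors
     with first entry 1, and its value is [q]. *)
  pose w := r *m invmx S; have wS : w *m S = r by rewrite /w mulmxKV.
  have := Hpos (row_mx 1%:M (- w)); rewrite HE mul_row_block.
  rewrite !mul1mx !mulNmx DE mulmxA wS rb subrr tr_row_mx mul_row_col mul0mx addr0.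
  have -> : w *m b^T = r *m r^T by rewrite -rb' mulmxA wS.
  rewrite trmx1 mulmx1 subE [al%:M 0 0]mxE mulr1n; apply.
  apply/negP => /eqP /(congr1 lsubmx); rewrite row_mxKl linear0 => /matrixP/(_ 0 0).
  by rewrite !mxE => /eqP; rewrite oner_eq0.
pose s := Num.sqrt q; have s0 : 0 < s by rewrite sqrtr_gt0.
have sq : s ^+ 2 = q by rewrite sqr_sqrtr// ltW.
pose T := block_mx (s%:M : 'M[R]_1) r 0 S.
have TE : H = T *m T^T.
  rewrite HE /T tr_block_mx mulmx_block !trmx0 !mulmx0 !mul0mx !add0r rb rb' -DE tr_scalar_mx.
  congr (block_mx _ _ _ _); apply/matrixP => i j; rewrite !ord1 mxE mulr1n mxE.
  by rewrite -scalar_mxM mxE mulr1n -expr2 sq /q subrK.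
have dT : \det T = s * \det S by rewrite det_ublock det_scalar1.
exists T, (s * d); split.
- by rewrite mulr_gt0.
- by rewrite unitmxE dT unitrM unitfE (gt_eqF s0) -unitmxE SU.
- exact: TE.
- rewrite TE det_mulmx det_tr dT exprMn dD DE det_mulmx det_tr; ring.
- by move=> g g0; exact: integral_Rn_triangular.
Qed.

Lemma dotv_mulmx n (H : 'M[R]_n) v w : H^T = H -> dotv v (w *m H) = (v *m H *m w^T) 0 0.
Proof. by move=> HT; rewrite /dotv trmx_mul HT mulmxA. Qed.

Lemma qfD n (H : 'M[R]_n) v w : H^T = H ->
  qf H (v + w) = qf H v + 2 * dotv v (w *m H) + qf H w.
Proof.
have addE (M N : 'M[R]_1) : (M + N) 0 0 = M 0 0 + N 0 0 by rewrite mxE.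
move=> HT; rewrite dotv_mulmx// /qf linearD /= !mulmxDl.
have sym : (w *m H *m v^T) 0 0 = (v *m H *m w^T) 0 0.
  transitivity ((w *m H *m v^T)^T 0 0); first by rewrite [RHS]mxE.
  by rewrite !trmx_mul trmxK HT mulmxA.
by rewrite !mulmxDr !addE sym; ring.
Qed.

Lemma qf1 n (v : 'rV[R]_n) : qf 1%:M v = \sum_i v 0 i ^+ 2.
Proof.
by rewrite /qf mulmx1 mxE; apply: eq_bigr => i _; rewrite mxE expr2.
Qed.

Lemma qf_gram n (S : 'M[R]_n) v : qf (S *m S^T) v = qf 1%:M (v *m S).
Proof. by rewrite /qf mulmx1 trmx_mul !mulmxA. Qed.

Lemma qf1_ge n (v : 'rV[R]_n) : `|v| ^+ 2 <= qf 1%:M v.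
Proof.
have s0 : 0 <= qf 1%:M v by rewrite qf1; apply: sumr_ge0 => i _; exact: sqr_ge0.
rewrite -[leRHS]sqr_sqrtr// ler_sqr ?nnegrE ?sqrtr_ge0//.
apply: normv_le => [|i]; first exact: sqrtr_ge0.
rewrite -ler_sqr ?nnegrE ?sqrtr_ge0// sqr_sqrtr// real_normK ?num_real//.
by rewrite qf1 (bigD1 i)//= lerDl; apply: sumr_ge0 => j _; exact: sqr_ge0.
Qed.

(** The factor [S] turns the form into a sum of squares, and the bound on its inverse gives an
    explicit constant. *)
Lemma posdef_coercive n (H : 'M[R]_n) : H^T = H -> posdef H ->
  exists2 lam : R, 0 < lam & forall v, lam * `|v| ^+ 2 <= qf H v.
Proof.
move=> HT Hpos; have [S [d [_ SU -> _ _]]] := cholesky HT Hpos.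
have [K K0 hK] := mulmx_bound (invmx S).
exists (K ^+ 2)^-1 => [|v]; first by rewrite invr_gt0 exprn_gt0.
rewrite qf_gram; apply: le_trans (qf1_ge _).
rewrite ler_pdivrMl ?exprn_gt0// -exprMn ler_sqr ?nnegrE ?mulr_ge0 ?(ltW K0)//.
by rewrite -{1}[v](mulmxK SU).
Qed.

End Cholesky.

Section Quadratic.
Variables (R : realType) (n : nat) (p : R).
Local Notation J := (@integral_Rn R _).
Local Notation al := (2 * p / n%:R).
Hypothesis n0 : (0 < n)%N.
Hypothesis p0 : 0 < p.

Definition quad (A : set 'rV[R]_n) (H : 'M[R]_n) x : \bar R :=
  if `[< A x >] then (2^-1 * qf H x)%:E else +oo%E.

Lemma edom_quad A H : edom (quad A H) = A.
Proof.
apply/seteqP; split => x; rewrite /edom /quad /=; last by move=> Ax; rewrite asboolT// ltry.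
by case: asboolP.
Qed.

Lemma quadE A H x : A x -> fine (quad A H x) = 2^-1 * qf H x.
Proof. by move=> Ax; rewrite /quad asboolT. Qed.

(** With the gradient field [y *m H] the divergence is exactly half the form, so [core_limit]
    applies with any tolerance; [sigma] is constant and leaves the volume of [A]. *)
Lemma quadratic_limit (A : set 'rV[R]_n) (H : 'M[R]_n) c L x0 : H^T = H ->
  (exists2 lam : R, 0 < lam & forall v, lam * `|v| ^+ 2 <= qf H v) ->
  (forall x y (t : R), A x -> A y -> 0 <= t <= 1 -> A ((1 - t) *: x + t *: y)) ->
  0 < L -> A `<=` cube c L -> interiorV A x0 ->
  (fun m : nat => ((m%:R `^ al)%:E * triangle_p p (quad A H) m)%E) @ \oo -->
  (((2^-1 : R) `^ p * zador H p)%:E * J (fun x => (\1_A x)%:E) `^ (1 + al))%E.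
Proof.
move=> HT Hco convA L0 AL x0A.
have Hpsd : psd H.
  have [lam lam0 hl] := Hco; move=> v; apply: le_trans (hl v).
  by rewrite mulr_ge0 ?exprn_ge0// ltW.
have OA x : interiorV A x -> A x by exact: interior_subset.
have br y y' : A y -> A y' -> bregman (quad A H) (fun y => y *m H) y y' = 2^-1 * qf H (y - y').
  move=> Ay Ay'; rewrite /bregman !quadE//=.
  have := @qfD _ _ H (y - y') y' HT; rewrite subrK; lra.
have al0 : 0 < al by rewrite divr_gt0 ?mulr_gt0 ?ltr0n.
have := @core_limit R n p (quad A H) (fun y => y *m H) (fun=> H) c L x0 n0 p0.
rewrite edom_quad => core.
set l1 := (X in _ --> X) in core *; set l2 := (X in _ --> X).
suff <- : l1 = l2.
  apply: core => //.
  - by move=> x; rewrite /quad; case: ifP.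
  - move=> x y Ax /OA Ay; have := br _ _ Ax Ay; rewrite /bregman.
    have := Hpsd (x - y); lra.
  - have [K K0 hK] := mulmx_bound H; exists (K * (`|c| + L)) => y /OA/AL yc.
    apply: (le_trans (hK y)); rewrite ler_pM2l//; apply: normv_le => [|i].
      by rewrite addr_ge0 ?(ltW L0).
    have := ler_coord c i; have /andP[y1 y2] := yc i; rewrite !ler_norml => /andP[c1 c2].
    by apply/andP; split; lra.
  - move=> x eta /interiorP[r r0 rA] /andP[e0 e1]; exists r => // y y' w /rA Ay /rA Ay' _.
    rewrite br//; have := Hpsd (y - y') => q0.
    by apply/andP; split; rewrite ler_wpM2r//; lra.
have z0 := zador_ge0 p Hpsd.
rewrite /l1 /l2 /integral_on.
have -> : J (fun x => if `[< A x >] then (sigma p (fun=> H) x)%:E else 0%E) =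
    ((zador H p `^ (1 + al)^-1)%:E * J (fun x => (\1_A x)%:E))%E.
  rewrite -integral_RnZl ?powR_ge0//.
  congr (J _); apply/funext => x; rewrite indicE; case: asboolP => Ax.
    by rewrite mem_set// mule1.
  by rewrite memNset// mule0.
rewrite poweRM ?lee_fin ?powR_ge0//; last by apply: integral_Rn_ge0 => x; rewrite lee_fin.
rewrite muleA poweR_EFin -powRrM mulVf; last by rewrite gt_eqF// addr_gt0.
by rewrite powRr1// EFinM.
Qed.

Lemma Pc_quad_mulmx (A A' : set 'rV[R]_n) (H H' S : 'M[R]_n) m l :
  (forall x, A x -> A' (x *m S)) -> (forall x, qf H' (x *m S) = qf H x) ->
  Pc (quad A' H') m l -> Pc (quad A H) m (fun x => l (x *m S)).
Proof.
move=> AA' HH' [k [a [b [km [lE lu]]]]]; exists k, (fun j => a j *m S^T), b; split => //.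
have aE j x : affine_fun (a j) (b j) (x *m S) = affine_fun (a j *m S^T) (b j) x.
  by rewrite /affine_fun trmx_mul trmxK mulmxA.
split => [x|x]; first by rewrite lE aE; apply: eq_bigr => j _; rewrite aE.
rewrite edom_quad => Ax; have := lu (x *m S); rewrite edom_quad => /(_ (AA' _ Ax)).
by rewrite /quad !asboolT ?HH'//; exact: AA'.
Qed.

(* Both quadratic problems have the same approximation error up to the Jacobian,
   so the two instances of the limit theorem determine the ratio of the constants. *)
Lemma zador_det (H : 'M[R]_n) : H^T = H -> posdef H ->
  zador H p = zador (1%:M : 'M[R]_n) p * \det H `^ (p / n%:R).
Proof.
move=> HT Hpos; have [S [d [d0 SU HE dD JS]]] := cholesky HT Hpos.
have al0 : 0 < al by rewrite divr_gt0 ?mulr_gt0 ?ltr0n.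
pose A := @cube R n 0 1; pose A' : set 'rV[R]_n := [set y | A (y *m invmx S)].
have AS x : A' (x *m S) = A x by rewrite /A' /= mulmxK.
have qS x : qf 1%:M (x *m S) = qf H x by rewrite HE qf_gram.
have convA x y (t : R) : A x -> A y -> 0 <= t <= 1 -> A ((1 - t) *: x + t *: y).
  move=> Ax Ay /andP[t0 t1] i; have /andP[x0 x1] := Ax i; have /andP[y0 y1] := Ay i.
  move: x0 x1 y0 y1; rewrite !mxE !add0r => x0 x1 y0 y1; apply/andP; split.
    by rewrite addr_ge0 ?mulr_ge0// subr_ge0.
  have : (1 - t) * x 0 i <= (1 - t) * 1 by rewrite ler_wpM2l ?subr_ge0// ltW.
  have [->|tn] := eqVneq t 0; first by lra.
  have : t * y 0 i < t * 1 by rewrite ltr_pM2l// lt_def tn.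
  lra.
have [K K0 hK] := mulmx_bound (invmx S); have [K' K'0 hK'] := mulmx_bound S.
pose e : 'rV[R]_n := const_mx 2^-1.
have eA y : `|y - e| < 2^-1 -> A y.
  move=> ye i; have := le_lt_trans (ler_coord (y - e) i) ye; rewrite !mxE ltr_norml => /andP[h1 h2].
  by apply/andP; split; lra.
have eO : interiorV A e by apply/interiorP; exists 2^-1; [rewrite invr_gt0|exact: eA].
have lim1 := @quadratic_limit A H 0 1 e HT (posdef_coercive HT Hpos) convA ltr01 (fun _ h => h) eO.
have J1 : J (fun x => (\1_A x)%:E) = 1%E.
  by have [_ ->] := @nice_cube R n 0 1 ler01; rewrite expr1n.
have lim2 : (fun m : nat => ((m%:R `^ al)%:E * triangle_p p (quad A' 1%:M) m)%E) @ \oo -->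
    (((2^-1 : R) `^ p * zador (1%:M : 'M[R]_n) p)%:E * J (fun x => (\1_A' x)%:E) `^ (1 + al))%E.
  apply: (@quadratic_limit A' 1%:M (const_mx (- K')) (2 * K' + 1) (e *m S)).
  - exact: trmx1.
  - by exists 1 => // v; rewrite mul1r qf1_ge.
  - by move=> x y t Ax Ay t01; rewrite /A' /= mulmxDl -!scalemxAl; exact: convA.
  - by lra.
  - move=> y Ay i; rewrite !mxE.
    have : `|y| <= K'.
      rewrite -[y](mulmxKV SU); apply: (le_trans (hK' _)); rewrite ler_piMr ?(ltW K'0)//.
      apply: normv_le => // j; have /andP[y1 y2] := Ay j; move: y1 y2; rewrite !mxE add0r => y1 y2.
      by rewrite ger0_norm// ltW.
    move=> /(le_trans (ler_coord y i)); rewrite ler_norml => /andP[y1 y2].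
    by apply/andP; split; lra.
  - apply/interiorP; exists (2^-1 / K) => [|y ye]; first by rewrite divr_gt0 ?invr_gt0.
    apply: eA; rewrite -{1}[e](mulmxK SU) -mulmxBl; apply: le_lt_trans (hK _) _.
    by rewrite mulrC -ltr_pdivlMr.
have JA' : J (fun x => (\1_A' x)%:E) = d%:E.
  rewrite JS; last by move=> x; rewrite lee_fin.
  rewrite -[RHS]mule1 -J1; congr (_ * J _)%E; apply/funext => x.
  by rewrite !indicE; congr ((nat_of_bool _)%:R%:E); apply/idP/idP => /set_mem h; apply/mem_set; move: h; rewrite AS.
have intE l : integral_on A' (fun x => ((fine (quad A' 1%:M x) - l x) `^ p)%:E) =
    (d%:E * integral_on A (fun x => ((fine (quad A H x) - l (x *m S)) `^ p)%:E))%E.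
  rewrite /integral_on JS; last by move=> x; case: ifP => // _; rewrite lee_fin powR_ge0.
  congr (_ * J _)%E; apply/funext => x; rewrite AS; case: asboolP => [Ax|//].
  by rewrite !quadE ?AS// qS.
have triE m : triangle_p p (quad A' 1%:M) m = (d%:E * triangle_p p (quad A H) m)%E.
  apply/eqP; rewrite eq_le; apply/andP; split.
    rewrite -lee_pdivrMl//; apply: le_ereal_inf_tmp => _ [l lP <-].
    rewrite lee_pdivrMl//.
    have -> : l = (fun x => l (x *m S *m invmx S)) by apply/funext => x; rewrite mulmxK.
    rewrite edom_quad -[leRHS](intE (fun x => l (x *m invmx S))); apply: ereal_inf_lbound.
    exists (fun x => l (x *m invmx S)); last by rewrite edom_quad.
    apply: (Pc_quad_mulmx _ _ lP) => // x.
    by rewrite -qS mulmxKV.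
  apply: le_ereal_inf_tmp => _ [l lP <-]; rewrite edom_quad intE lee_pmul2l ?lte_fin//.
  apply: ereal_inf_lbound; exists (fun x => l (x *m S)); last by rewrite edom_quad.
  by apply: (Pc_quad_mulmx _ _ lP) => // x; rewrite AS.
have J1p : (J (fun x => (\1_A x)%:E) `^ (1 + al) = 1)%E by rewrite J1 poweR_EFin powR1.
rewrite JA' in lim2; rewrite J1p mule1 in lim1.
have lim3 : (fun m : nat => ((m%:R `^ al)%:E * triangle_p p (quad A' 1%:M) m)%E) @ \oo -->
    (d%:E * ((2^-1 : R) `^ p * zador H p)%:E)%E.
  rewrite (_ : (fun m => _) = (fun m : nat => d%:E * ((m%:R `^ al)%:E * triangle_p p (quad A H) m))%E).
    by apply: cvgeZl.
  by apply/funext => m; rewrite triE muleCA.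
(* After cancelling [d] and the power of 2 this reads [zador 1 * d ^ al = zador H], and
   [d ^ 2 = det H]. *)
have E : (2^-1 : R) `^ p * zador (1%:M : 'M[R]_n) p * d `^ (1 + al) = d * ((2^-1 : R) `^ p * zador H p).
  by apply: EFin_inj; exact: (cvg_unique (@ereal_hausdorff R) lim2 lim3).
have D0 : 0 < (2^-1 : R) `^ p by rewrite powR_gt0// invr_gt0.
have -> : \det H `^ (p / n%:R) = d `^ al.
  by rewrite -dD -powR_mulrn ?(ltW d0)// -powRrM mulrA.
move: E; rewrite powRD ?(gt_eqF d0) ?implybT// powRr1 ?(ltW d0)// => E.
apply: (mulfI (lt0r_neq0 D0)); apply: (mulfI (lt0r_neq0 d0)).
by rewrite -E; ring.
Qed.

End Quadratic.

(** * Functions of class C2 *)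

Section Calculus.
Variable R : realType.

Lemma mvt_from0 (F dF : R -> R) (c : R) :
  (forall t : R, `|t| <= `|c| -> is_derive t 1 F (dF t)) ->
  exists2 t : R, `|t| <= `|c| & F c - F 0 = dF t * c.
Proof.
move=> dFP.
have cont a b : (forall t, a <= t <= b -> `|t| <= `|c|) -> {within `[a, b], continuous F}.
  by move=> h; apply: derivable_within_continuous => t; rewrite in_itv/= => /h/dFP[].
have [c0|c0|c0] := ltgtP c 0.
- have bd t : c <= t <= 0 -> `|t| <= `|c|.
    by move=> /andP[h1 h2]; rewrite !ler0_norm// ?(ltW c0)// lerN2.
  have [t|t ht E] := @MVT_segment R F dF c 0 (ltW c0) _ (cont c 0 bd).
    by rewrite in_itv/= => /andP[/ltW h1 /ltW h2]; apply: dFP; apply: bd; rewrite h1.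
  exists t; first by apply: bd; move: ht; rewrite in_itv.
  by rewrite -opprB E sub0r mulrN opprK.
- have bd t : 0 <= t <= c -> `|t| <= `|c|.
    by move=> /andP[h1 h2]; rewrite !ger0_norm// ltW.
  have [t|t ht E] := @MVT_segment R F dF 0 c (ltW c0) _ (cont 0 c bd).
    by rewrite in_itv/= => /andP[/ltW h1 /ltW h2]; apply: dFP; apply: bd; rewrite h1.
  exists t; first by apply: bd; move: ht; rewrite in_itv.
  by rewrite E subr0.
- by exists 0; rewrite ?normr0// c0 subrr mulr0.
Qed.

(** Compare [F] with the parabola of second derivative [k] by the mean value theorem, once for [dF]
    and once for the difference. The sign [e], equal to 1 or -1, treats the two bounds alike. *)
Lemma taylor2_bounds (F dF d2F : R -> R) (m M : R) :
  (forall t : R, `|t| <= 1 -> is_derive t 1 F (dF t)) ->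
  (forall t : R, 0 <= t <= 1 -> forall s : R, `|s| <= `|t| -> is_derive s 1 dF (d2F s)) ->
  (forall t : R, `|t| <= 1 -> m <= d2F t <= M) ->
  m / 2 <= F 1 - F 0 - dF 0 <= M / 2.
Proof.
move=> dFP d2FP mM.
have key k (e : R) : (forall t, 0 <= t <= 1 -> e * (k * t) <= e * (dF t - dF 0)) ->
    e * (k / 2) <= e * (F 1 - F 0 - dF 0).
  move=> hk; pose G t := e * (F t - dF 0 * t - k / 2 * t ^+ 2).
  pose dG t := e * (dF t - dF 0 - k * t).
  have dGP (t : R) : 0 <= t <= 1 -> is_derive t 1 G (dG t).
    move=> /andP[t0 t1]; have d1 : is_derive t 1 F (dF t) by apply: dFP; rewrite ger0_norm.
    have D := is_deriveZ e (is_deriveB (is_deriveB d1 (is_deriveZ (dF 0) (is_derive_id t 1)))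
      (is_deriveZ (k / 2) (is_deriveX 2 (is_derive_id t 1)))).
    by apply: (@is_derive_eq _ _ _ G t 1 _ _ D); rewrite /dG /GRing.scale /=; field.
  have [//|t||t tI E] := @MVT_segment R G dG 0 1.
  - by rewrite in_itv/= => /andP[/ltW h1 /ltW h2]; apply: dGP; rewrite h1.
  - by apply: derivable_within_continuous => t; rewrite in_itv/= => /dGP[].
  - move: tI E; rewrite in_itv/= => t01; have := hk t t01; rewrite /G /dG.
    rewrite expr1n expr0n /= !mulr0 !subr0 !mulr1 => h1 h2.
    have : 0 <= e * (dF t - dF 0 - k * t) by rewrite mulrBr subr_ge0.
    rewrite -h2; lra.
have hd (t : R) : 0 <= t <= 1 -> m * t <= dF t - dF 0 <= M * t.
  move=> /andP[t0 t1].
  have [|s st ->] := @mvt_from0 dF d2F t.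
    by move=> s; apply: d2FP; rewrite t0.
  have /andP[h1 h2] : m <= d2F s <= M by apply: mM; rewrite (le_trans st)// ger0_norm.
  by rewrite !ler_wpM2r.
apply/andP; split.
  rewrite -[leLHS]mul1r -[leRHS]mul1r; apply: key => t /hd/andP[h1 _]; rewrite !mul1r; exact: h1.
rewrite -lerN2 -[leLHS]mulN1r -[leRHS]mulN1r; apply: key => t /hd/andP[_ h2].
by rewrite !mulN1r lerN2.
Qed.

Lemma dist_halves (A B C e : R) : `|A - C| < e / 2 -> `|A - B| < e / 2 -> `|B - C| <= e.
Proof.
rewrite !ltr_norml ler_norml => /andP[a1 a2] /andP[b1 b2].
by apply/andP; split; lra.
Qed.

Lemma ratio_bounds (q qt qw eta : R) : 0 < eta < 1 -> 0 <= q ->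
  `|qt - q| <= eta / 4 * q -> `|qw - q| <= eta / 4 * q ->
  (1 - eta) * qw <= qt <= (1 + eta) * qw.
Proof.
move=> /andP[e0 e1] q0; rewrite !ler_norml => /andP[a1 a2] /andP[b1 b2].
by apply/andP; split; nra.
Qed.

Lemma qf_dist_le n (M N : 'M[R]_n) v (e : R) : (forall i j, `|M i j - N i j| <= e) ->
  `|qf M v - qf N v| <= (n * n)%:R * (e * `|v| ^+ 2).
Proof.
move=> MN; rewrite !qfE -sumrB.
apply: (@le_trans _ _ (\sum_(i < n) \sum_(j < n) `|v| * e * `|v|)).
  rewrite (le_trans (ler_norm_sum _ _ _))//; apply: ler_sum => i _.
  rewrite -sumrB (le_trans (ler_norm_sum _ _ _))//; apply: ler_sum => j _.
  rewrite -mulrBl -mulrBr !normrM; apply: ler_pM; [by rewrite mulr_ge0|by []| |exact: ler_coord].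
  by apply: ler_pM; [by []|by []|exact: ler_coord|exact: MN].
rewrite !sumr_const !card_ord -mulrnA -mulr_natl le_eqVlt; apply/orP; left; apply/eqP.
by rewrite expr2; ring.
Qed.

Lemma line_derive n (g : 'rV[R]_n -> R) (x v : 'rV[R]_n) (t : R) :
  derivable g (x + t *: v) v ->
  is_derive t 1 (fun s => g (x + s *: v)) ('D_v g (x + t *: v)).
Proof.
move=> dg.
have E : (fun h : R => h^-1 *: (((fun s => g (x + s *: v)) \o shift t) (h *: 1) - g (x + t *: v))) =
    (fun h : R => h^-1 *: ((g \o shift (x + t *: v)) (h *: v) - g (x + t *: v))).
  apply/funext => h /=; congr (_ *: (g _ - _)).
  by rewrite [h *: 1]mulr1 scalerDl addrCA.
by constructor; [rewrite /derivable E|rewrite /derive E].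
Qed.

Lemma sum_unitv n (w : 'rV[R]_n) : \sum_i w 0 i *: unitv R i = w.
Proof. by rewrite [RHS]row_sum_delta. Qed.

Lemma norm_unitv n (i : 'I_n) : `|unitv R i| <= 1.
Proof.
apply: normv_le => // j; rewrite mxE; case: (_ && _); by rewrite ?normr1 ?normr0.
Qed.

Lemma derive_bound_cvg (F : R -> R) (t l : R) :
  (forall e : R, 0 < e -> exists2 r : R, 0 < r &
    forall h, `|h| < r -> `|F (t + h) - F t - h * l| <= e * `|h|) ->
  is_derive t 1 F l.
Proof.
move=> H.
have cv : (fun h : R => h^-1 *: ((F \o shift t) (h *: 1) - F t)) @ 0^' --> l.
  apply/cvgrPdist_le => e e0; have [r r0 hr] := H e e0.
  near=> h; have h0 : h != 0 by near: h; exact: nbhs_dnbhs_neq.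
  have hlt : `|h| < r.
    near: h; apply: dnbhs0_lt; exact: r0.
  rewrite /= [h *: 1]mulr1 [h + t]addrC /GRing.scale /=.
  have := hr h hlt.
  have -> : l - h^-1 * (F (t + h) - F t) = - (h^-1 * (F (t + h) - F t - h * l)).
    by field.
  by rewrite normrN normrM normfV ler_pdivrMl ?normr_gt0// [`|h| * e]mulrC.
by constructor; [apply/cvg_ex; exists l|exact: cvg_lim].
Unshelve. all: by end_near. Qed.

End Calculus.

Section C2.
Variables (R : realType) (n : nat) (O : set 'rV[R]_n).
Hypothesis hO : forall x, O x -> exists2 r : R, 0 < r & forall y, `|y - x| < r -> O y.

Lemma within_continuous_eps (g : 'rV[R]_n -> R) x e : {within O, continuous g} -> O x ->
  0 < e -> exists2 r : R, 0 < r & forall y, `|y - x| < r -> `|g y - g x| < e.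
Proof.
move=> cg Ox e0; have [r r0 rO] := hO Ox.
have := cg x => /cvgrPdist_lt /(_ e e0).
move=> hn; have : within O (nbhs x) (fun t => `|g x - g t| < e).
  by rewrite nbhs_subspace_in//; exact: hn.
move=> /nbhs_ballP[s /= s0 hs].
exists (Num.min r s) => [|y]; first by rewrite lt_min r0.
rewrite lt_min => /andP[/rO Oy ys]; rewrite distrC.
by apply: (hs y) => //; rewrite -ball_normE /ball_/= distrC.
Qed.

Section C1.
Variable g : 'rV[R]_n -> R.
Hypothesis dg : forall i x, O x -> derivable g x (unitv R i).
Hypothesis cg : forall i, {within O, continuous (partial i g)}.

(** [C2_on] speaks only of derivatives along the axes, so differentiability has to be derived:
    follow the path that changes one coordinate at a time and apply the mean value theorem on each
    leg. *)
Lemma first_order z e : O z -> 0 < e -> exists2 r : R, 0 < r &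
  forall w, `|w| < r -> `|g (z + w) - g z - \sum_i w 0 i * partial i g z| <= e * `|w|.
Proof.
(* [n + 1] in place of [n] keeps the divisor positive in every dimension. *)
move=> Oz e0; pose N : R := n.+1%:R; have N0 : 0 < N by rewrite ltr0n.
have eN0 : 0 < e / N by rewrite divr_gt0.
have [r r0 hr] : exists2 r : R, 0 < r & forall i : 'I_n, true ->
    forall y, `|y - z| < r -> O y /\ `|partial i g y - partial i g z| < e / N.
  apply: (@finite_lower_bound R _ xpredT (fun i r => forall y, `|y - z| < r ->
    O y /\ `|partial i g y - partial i g z| < e / N)).
    by move=> i d d' hd /andP[_ dd] y yd; apply: hd; exact: lt_le_trans dd.
  move=> i _; have [r1 r10 h1] := hO Oz.
  have [r2 r20 h2] := within_continuous_eps (@cg i) Oz eN0.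
  exists (Num.min r1 r2); first by rewrite lt_min r10.
  by move=> y; rewrite lt_min => /andP[/h1 ? /h2].
exists (r / N) => [|w wr]; first by rewrite divr_gt0.
have wb (s : seq 'I_n) : `|\sum_(i <- s) w 0 i *: unitv R i| <= (size s)%:R * `|w|.
  elim: s => [|i s IH]; first by rewrite big_nil normr0 mul0r.
  rewrite big_cons /= -natr1 mulrDl mul1r addrC (le_trans (ler_normD _ _))// lerD//.
  rewrite normrZ -[leRHS]mulr1 ler_pM//; [exact: ler_coord|exact: norm_unitv].
have key (s : seq 'I_n) : (size s <= n)%N ->
    `|g (z + \sum_(i <- s) w 0 i *: unitv R i) - g z - \sum_(i <- s) w 0 i * partial i g z| <=
    (size s)%:R * (e / N * `|w|).
  elim: s => [|i s IH] sn; first by rewrite !big_nil addr0 !subrr normr0 mul0r.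
  rewrite !big_cons [size _]/=; pose y := z + \sum_(j <- s) w 0 j *: unitv R j.
  rewrite -/y in IH.
  have yz (t : R) : `|t| <= `|w 0 i| -> `|y + t *: unitv R i - z| < r.
    move=> tw; have -> : y + t *: unitv R i - z = \sum_(j <- s) w 0 j *: unitv R j + t *: unitv R i.
      by rewrite /y -addrA addrC addrA subrK addrC.
    apply: (@le_lt_trans _ _ (n%:R * `|w|)).
      rewrite (le_trans (ler_normD _ _))//; apply: (@le_trans _ _ ((size s)%:R * `|w| + `|w|)).
        rewrite lerD// normrZ -[leRHS]mulr1 ler_pM//; last exact: norm_unitv.
        by rewrite (le_trans tw)// ler_coord.
      by rewrite -{2}[`|w|]mul1r -mulrDl ler_wpM2r// natr1 ler_nat.
    apply: (@le_lt_trans _ _ (N * `|w|)); first by rewrite ler_wpM2r// ler_nat.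
    by rewrite mulrC -ltr_pdivlMr.
  have [t ht E] := @mvt_from0 R (fun t => g (y + t *: unitv R i))
    (fun t => partial i g (y + t *: unitv R i)) (w 0 i)
    (fun t ht => line_derive (@dg i _ (proj1 (hr i isT _ (yz t ht))))).
  move: E; rewrite /= scale0r addr0 => E.
  have -> : z + (w 0 i *: unitv R i + \sum_(j <- s) w 0 j *: unitv R j) = y + w 0 i *: unitv R i.
    by rewrite /y addrCA addrC.
  set S := \sum_(j <- s) w 0 j * partial j g z in IH *.
  have -> : g (y + w 0 i *: unitv R i) - g z - (w 0 i * partial i g z + S) =
      (partial i g (y + t *: unitv R i) - partial i g z) * w 0 i + (g y - g z - S).
    by rewrite mulrBl -E; ring.
  rewrite mulr_natl mulrS -mulr_natl (le_trans (ler_normD _ _))// lerD//; last by apply: IH; exact: ltnW.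
  rewrite normrM ler_pM//; last exact: ler_coord.
  by apply/ltW; apply: (proj2 (hr i isT _ (yz t ht))).
have := key (index_enum 'I_n).
have sz : size (index_enum 'I_n) = n by rewrite -[RHS]card_ord cardT enumT.
rewrite sum_unitv sz => /(_ (leqnn n))/le_trans; apply.
rewrite mulrA ler_wpM2r// mulrCA ler_piMr ?(ltW e0)// ler_pdivrMr// mul1r ler_nat//.
Qed.

Lemma C1_line_derive z v (t : R) : O (z + t *: v) ->
  is_derive t 1 (fun s => g (z + s *: v)) (\sum_i v 0 i * partial i g (z + t *: v)).
Proof.
move=> Oz; apply: derive_bound_cvg => e e0.
have v1 : 0 < `|v| + 1 by rewrite ltr_wpDl.
have [r r0 hr] := first_order Oz (divr_gt0 e0 v1).
exists (r / (`|v| + 1)) => [|h hh]; first by rewrite divr_gt0.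
have hv : `|h *: v| <= (`|v| + 1) * `|h| by rewrite normrZ mulrC ler_wpM2r// lerDl.
have /hr : `|h *: v| < r by apply: (le_lt_trans hv); rewrite mulrC -ltr_pdivlMr.
have -> : z + t *: v + h *: v = z + (t + h) *: v by rewrite scalerDl addrA.
have -> : \sum_i (h *: v) 0 i * partial i g (z + t *: v) = h * \sum_i v 0 i * partial i g (z + t *: v).
  by rewrite mulr_sumr; apply: eq_bigr => i _; rewrite mxE mulrA.
move=> /le_trans; apply; rewrite -mulrA ler_pM2l// mulrC ler_pdivrMr// mulrC; exact: hv.
Qed.

End C1.

Variable f : 'rV[R]_n -> R.
Hypothesis f2 : C2_on O f.

Let df i x : O x -> derivable f x (unitv R i).
Proof. by have [_ [/(_ i)[h _] _]] := f2; exact: h. Qed.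
Let cdf i : {within O, continuous (partial i f)}.
Proof. by have [_ [/(_ i)[_ h] _]] := f2. Qed.
Let ddf i j x : O x -> derivable (partial i f) x (unitv R j).
Proof. by have [_ [_ /(_ i j)[h _]]] := f2; exact: h. Qed.
Let cddf i j : {within O, continuous (partial j (partial i f))}.
Proof. by have [_ [_ /(_ i j)[_ h]]] := f2. Qed.

Lemma mixed_difference i j x (h : R) :
  (forall s t : R, `|s| <= `|h| -> `|t| <= `|h| -> O (x + t *: unitv R j + s *: unitv R i)) ->
  exists s t : R, [/\ `|s| <= `|h|, `|t| <= `|h| &
   f (x + h *: unitv R j + h *: unitv R i) - f (x + h *: unitv R i) - f (x + h *: unitv R j) + f x =
   partial j (partial i f) (x + t *: unitv R j + s *: unitv R i) * h * h].
Proof.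
move=> hx; set ei := unitv R i in hx *; set ej := unitv R j in hx *.
have [|s sh E] := @mvt_from0 R (fun s => f (x + h *: ej + s *: ei) - f (x + s *: ei))
    (fun s => partial i f (x + h *: ej + s *: ei) - partial i f (x + s *: ei)) h.
  move=> s sh; apply: is_deriveB; apply: line_derive; apply: df; first by apply: hx.
  by have := hx s 0 sh; rewrite scale0r addr0 normr0; apply.
have [|t th E'] := @mvt_from0 R (fun t => partial i f ((x + s *: ei) + t *: ej))
    (fun t => partial j (partial i f) ((x + s *: ei) + t *: ej)) h.
  by move=> t th; apply: line_derive; apply: ddf; rewrite addrAC; apply: hx.
exists s, t; split => //; move: E E'; rewrite !scale0r !addr0 => E E'.
rewrite [x + t *: ej + _]addrAC -E' [x + s *: ei + _]addrAC -E; ring.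
Qed.

(** Schwarz's theorem. The second difference in [mixed_difference] is symmetric in [i] and [j], so
    the two mixed derivatives agree at a pair of points near [x]; continuity carries both values to
    [x]. *)
Lemma hessian_sym x : O x -> (hessian f x)^T = hessian f x.
Proof.
move=> Ox; apply/matrixP => j i; rewrite !mxE; apply/eqP; rewrite -subr_eq0 -normr_le0.
apply/ler_addgt0Pl => e e0; rewrite addr0.
have e20 : 0 < e / 2 by rewrite divr_gt0.
have [r r0 rO] := hO Ox.
have [r1 r10 h1] := within_continuous_eps (@cddf i j) Ox e20.
have [r2 r20 h2] := within_continuous_eps (@cddf j i) Ox e20.
pose q := Num.min r (Num.min r1 r2); have q0 : 0 < q by rewrite !lt_min r0 r10.
pose h := q / 4; have h0 : 0 < h by rewrite divr_gt0.
have near (k l : 'I_n) (s t : R) : `|s| <= `|h| -> `|t| <= `|h| ->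
    `|x + t *: unitv R k + s *: unitv R l - x| < q.
  move=> sh th; have -> : x + t *: unitv R k + s *: unitv R l - x = t *: unitv R k + s *: unitv R l.
    by rewrite addrAC [x + t *: _ - x]addrAC subrr add0r.
  have b (m : 'I_n) (c : R) : `|c| <= `|h| -> `|c *: unitv R m| <= h.
    move=> ch; rewrite normrZ -[leRHS]mulr1 ler_pM//; last exact: norm_unitv.
    by rewrite (le_trans ch)// ger0_norm// ltW.
  apply: (le_lt_trans (ler_normD _ _)); apply: (le_lt_trans (lerD (b k _ th) (b l _ sh))).
  by rewrite /h; lra.
have hn : h != 0 := lt0r_neq0 h0.
clearbody h.
have nO y : `|y - x| < q -> O y by rewrite lt_min => /andP[/rO].
have n1 y : `|y - x| < q -> `|partial j (partial i f) y - partial j (partial i f) x| < e / 2.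
  by rewrite !lt_min => /andP[_ /andP[/h1]].
have n2 y : `|y - x| < q -> `|partial i (partial j f) y - partial i (partial j f) x| < e / 2.
  by rewrite !lt_min => /andP[_ /andP[_ /h2]].
have [s [t [sh th E]]] := @mixed_difference i j x h (fun s t sh th => nO _ (near j i s t sh th)).
have [s' [t' [sh' th' E']]] := @mixed_difference j i x h (fun s t sh th => nO _ (near i j s t sh th)).
have EE : partial j (partial i f) (x + t *: unitv R j + s *: unitv R i) =
    partial i (partial j f) (x + t' *: unitv R i + s' *: unitv R j).
  apply: (mulIf hn (mulIf hn _)); apply: (etrans (esym E)); apply: etrans E'.
  by rewrite [x + h *: unitv R j + _]addrAC; ring.
have := n1 _ (near j i s t sh th); have := n2 _ (near i j s' t' sh' th'); rewrite EE.
exact: dist_halves.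
Qed.

Lemma bregman_taylor (m M : R) y y' :
  (forall t : R, `|t| <= 1 -> O (y' + t *: (y - y')) /\
     m <= qf (hessian f (y' + t *: (y - y'))) (y - y') <= M) ->
  m / 2 <= f y - f y' - dotv (y - y') (\row_i partial i f y') <= M / 2.
Proof.
move=> hyp; set v := y - y' in hyp *.
pose F t := f (y' + t *: v).
pose dF t := \sum_i v 0 i * partial i f (y' + t *: v).
pose d2F t := qf (hessian f (y' + t *: v)) v.
have := @taylor2_bounds R F dF d2F m M; rewrite /F scale1r scale0r addr0 [y' + v]addrC subrK.
have -> : dF 0 = dotv v (\row_i partial i f y').
  by rewrite dotvE /dF; apply: eq_bigr => i _; rewrite mxE scale0r addr0.
apply.
- by move=> t /hyp[Ot _]; exact: (C1_line_derive df cdf).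
- move=> t /andP[t0 t1] s st; have s1 : `|s| <= 1 by rewrite (le_trans st)// ger0_norm.
  have [Os _] := hyp s s1.
  have -> : d2F s = \sum_i v 0 i * \sum_j v 0 j * partial j (partial i f) (y' + s *: v).
    rewrite /d2F qfE; apply: eq_bigr => i _; rewrite mulr_sumr; apply: eq_bigr => j _.
    by rewrite [hessian _ _ i j]mxE; ring.
  have -> : dF = \sum_i (fun s => v 0 i * partial i f (y' + s *: v)).
    by apply/funext => s'; rewrite fct_sumE.
  apply: is_derive_sum => i; apply: is_deriveZ.
  by apply: (@C1_line_derive (partial i f) (@ddf i) (@cddf i)).
- by move=> t /hyp[].
Qed.

Hypothesis hpos : forall x, O x -> posdef (hessian f x).

Lemma hessian_coercive w : O w -> exists2 lam : R, 0 < lam &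
  forall v, lam * `|v| ^+ 2 <= qf (hessian f w) v.
Proof. by move=> Ow; apply: posdef_coercive; [exact: hessian_sym|exact: hpos]. Qed.

(** Coercivity at [x] turns the absolute continuity of the entries into a relative bound between the
    forms, as the factors [1 - eta] and [1 + eta] require. *)
Lemma hessian_near x kap : O x -> 0 < kap -> exists2 r, 0 < r & forall z, `|z - x| < r ->
  O z /\ forall v, `|qf (hessian f z) v - qf (hessian f x) v| <= kap * qf (hessian f x) v.
Proof.
move=> Ox k0; have [lam lam0 hl] := hessian_coercive Ox.
pose N : R := (n * n).+1%:R; have N0 : 0 < N by rewrite ltr0n.
have e0 : 0 < kap * lam / N by rewrite divr_gt0// mulr_gt0.
have [r r0 hr] : exists2 r : R, 0 < r & forall ij : 'I_n * 'I_n, true -> forall y, `|y - x| < r ->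
    `|partial ij.2 (partial ij.1 f) y - partial ij.2 (partial ij.1 f) x| < kap * lam / N.
  apply: (@finite_lower_bound R _ xpredT (fun ij r => forall y, `|y - x| < r ->
    `|partial ij.2 (partial ij.1 f) y - partial ij.2 (partial ij.1 f) x| < kap * lam / N)).
    by move=> i d d' hd /andP[_ dd] y yd; apply: hd; exact: lt_le_trans dd.
  by move=> [i j] _; exact: (within_continuous_eps (@cddf i j) Ox e0).
have [r' r'0 rO] := hO Ox.
exists (Num.min r r') => [|z]; first by rewrite lt_min r0.
rewrite lt_min => /andP[zr /rO Oz]; split => // v.
apply: (@le_trans _ _ (kap * (lam * `|v| ^+ 2))); last by rewrite ler_pM2l.
have MN i j : `|hessian f z i j - hessian f x i j| <= kap * lam / N.
  have E y : hessian f y i j = partial j (partial i f) y by rewrite mxE.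
  have -> : hessian f z i j - hessian f x i j =
      partial j (partial i f) z - partial j (partial i f) x by congr (_ - _); exact: E.
  exact: (ltW (hr (i, j) isT z zr)).
apply: (le_trans (qf_dist_le v MN)).
have -> : (n * n)%:R * (kap * lam / N * `|v| ^+ 2) = (n * n)%:R / N * (kap * (lam * `|v| ^+ 2)).
  by ring.
rewrite ler_piMl ?mulr_ge0 ?exprn_ge0 ?(ltW k0) ?(ltW lam0)//.
by rewrite ler_pdivrMr// mul1r ler_nat.
Qed.

Lemma bregman_hessian x (eta : R) : O x -> 0 < eta < 1 -> exists2 r, 0 < r &
  forall y y' w, `|y - x| < r -> `|y' - x| < r -> `|w - x| < r ->
    (1 - eta) / 2 * qf (hessian f w) (y - y') <=
      f y - f y' - dotv (y - y') (\row_i partial i f y')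
      <= (1 + eta) / 2 * qf (hessian f w) (y - y').
Proof.
move=> Ox /andP[e0 e1]; have k0 : 0 < eta / 4 by rewrite divr_gt0.
have [r r0 hr] := hessian_near Ox k0.
(* [bregman_taylor] asks for all [|t| <= 1], negative values included, and [y' + t *: (y - y')] then
   stays within three times the radius from [x]. *)
exists (r / 3) => [|y y' w yr yr' wr]; first by rewrite divr_gt0.
have wr' : `|w - x| < r by apply: (lt_trans wr); lra.
have := @bregman_taylor ((1 - eta) * qf (hessian f w) (y - y')) ((1 + eta) * qf (hessian f w) (y - y')) y y'.
rewrite -![_ * qf _ _ / 2]mulrAC; apply => t t1.
have tr : `|y' + t *: (y - y') - x| < r.
  have -> : y' + t *: (y - y') - x = (y' - x) + t *: ((y - x) - (y' - x)).
    by rewrite addrAC opprB addrA subrK.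
  apply: (le_lt_trans (ler_normD _ _)); rewrite normrZ.
  have : `|t| * `|y - x - (y' - x)| <= 1 * (`|y - x| + `|y' - x|) by rewrite ler_pM// ler_normB.
  lra.
have [Ot /(_ (y - y')) ht] := hr _ tr; have [Ow /(_ (y - y')) hw] := hr _ wr'.
split => //; move: ht hw.
have : 0 <= qf (hessian f x) (y - y').
  have [lam lam0 hl] := hessian_coercive Ox; apply: le_trans (hl _).
  by rewrite mulr_ge0 ?exprn_ge0// ltW.
by move=> q0 ht hw; apply: ratio_bounds q0 ht hw; rewrite e0.
Qed.

End C2.

(** * Convex domains with empty interior *)

Section FlatHull.
Variables (R : realType) (n : nat).

(** The remaining weight goes to [x0]. One point is split off and the other weights are divided by
    [1 - t i], which is positive because the sum stays strictly below 1. *)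
Lemma star_hull (I : Type) (S : set 'rV[R]_n) (x0 : 'rV[R]_n) (v : I -> 'rV[R]_n) s (t : I -> R) :
  (forall x y (t : R), S x -> S y -> 0 <= t <= 1 -> S ((1 - t) *: x + t *: y)) ->
  S x0 -> (forall i, S (x0 + v i)) -> (forall i, 0 <= t i) ->
  \sum_(i <- s) t i < 1 -> S (x0 + \sum_(i <- s) t i *: v i).
Proof.
move=> Sconv Sx0 Sv; elim: s t => [|i s IH] t t0; first by rewrite !big_nil addr0.
rewrite !big_cons => lt1.
have s0 : 0 <= \sum_(j <- s) t j by apply: sumr_ge0.
have ti1 : t i < 1 by lra.
have d0 : 0 < 1 - t i by lra.
pose t' j := t j / (1 - t i).
have S' : S (x0 + \sum_(j <- s) t' j *: v j).
  apply: IH; first by move=> j; rewrite divr_ge0// ltW.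
  by rewrite -mulr_suml ltr_pdivrMr// mul1r; lra.
have := Sconv _ _ (t i) S' (Sv i); rewrite t0 (ltW ti1) => /(_ isT).
suff -> : (1 - t i) *: (x0 + \sum_(j <- s) t' j *: v j) + t i *: (x0 + v i) =
    x0 + (t i *: v i + \sum_(j <- s) t j *: v j) by [].
have -> : \sum_(j <- s) t j *: v j = (1 - t i) *: \sum_(j <- s) t' j *: v j.
  by rewrite scaler_sumr; apply: eq_bigr => j _; rewrite scalerA /t' mulrC divfK// gt_eqF.
rewrite !scalerDr addrACA -scalerDl subrK scale1r; congr (_ + _); exact: addrC.
Qed.

(** [M] has maximal rank among the matrices whose rows are displacements from [x0] to points of [A];
    appending one more displacement cannot raise the rank. *)
Lemma spanning_rows (A : set 'rV[R]_n) x0 : exists k (M : 'M[R]_(k, n)),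
  (forall i, A (x0 + row i M)) /\ forall x, A x -> (x - x0 <= M)%MS.
Proof.
pose P r := `[< exists k (M : 'M[R]_(k, n)), (forall i, A (x0 + row i M)) /\ \rank M = r >].
have P0 : exists r, P r.
  by exists 0%N; apply/asboolP; exists 0%N, 0; split; [case|rewrite mxrank0].
have Pb r : P r -> (r <= n)%N by move=> /asboolP[k [M [_ <-]]]; exact: rank_leq_col.
have [r /asboolP[k [M [MA Mr]]] rmax] := ex_maxnP P0 Pb.
exists k, M; split => // x Ax.
have : (col_mx M (x - x0) <= col_mx M (x - x0))%MS by exact: submx_refl.
rewrite {1}col_mx_sub => /andP[MM' vM'].
have [le eq] := mxrank_leqif_sup MM'.
apply: submx_trans vM' _; rewrite -eq eqn_leq le Mr; apply: rmax; apply/asboolP.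
exists (k + 1)%N, (col_mx M (x - x0)); split => // i.
have [j ->|j ->] := split_ordP i; first by rewrite rowKu.
by rewrite rowKd row_id addrC subrK.
Qed.

Variable A : set 'rV[R]_n.
Hypothesis convA : forall x y (t : R), A x -> A y -> 0 <= t <= 1 -> A ((1 - t) *: x + t *: y).
Variable x0 : 'rV[R]_n.
Hypothesis Ax0 : A x0.

Lemma interior_or_flat : (exists x, interiorV A x) \/
  exists (w : 'rV[R]_n) (b : R), w != 0 /\ forall x, A x -> (x *m w^T) 0 0 = b.
Proof.
have [k [M [MA Msub]]] := spanning_rows A x0.
have [Mfull|Mnf] := boolP (row_full M).
  (* Near the centre each weight [beta + c i] stays between 0 and [2 * beta], and
     [2 * beta * k < 1]. *)
  left; pose beta : R := (2 * k.+1%:R)^-1.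
  have b0 : 0 < beta by rewrite invr_gt0 mulr_gt0// ltr0n.
  have [K K0 hK] := mulmx_bound (pinvmx M).
  exists (x0 + \sum_i beta *: row i M); apply/interiorP; exists (beta / K) => [|z zb].
    by rewrite divr_gt0.
  set b := x0 + _ in zb; pose c := (z - b) *m pinvmx M.
  have cM : z - b = \sum_i c 0 i *: row i M.
    by rewrite -mulmx_sum_row /c mulmxKpV// submx_full.
  have cb i : `|c 0 i| < beta.
    apply: le_lt_trans (ler_coord c i) _; apply: le_lt_trans (hK _) _.
    by rewrite mulrC -ltr_pdivlMr.
  have -> : z = x0 + \sum_i (beta + c 0 i) *: row i M.
    under eq_bigr do rewrite scalerDl.
    by rewrite big_split /= -cM addrA -/b addrC subrK.
  apply: star_hull => // [i|].
    by have := cb i; rewrite ltr_norml => /andP[h _]; lra.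
  apply: (@le_lt_trans _ _ (\sum_(i < k) 2 * beta)).
    by apply: ler_sum => i _; have := cb i; rewrite ltr_norml => /andP[_ h]; lra.
  rewrite sumr_const card_ord -[_ *+ k]mulr_natl mulrA /beta ltr_pdivrMr ?mulr_gt0 ?ltr0n// mul1r.
  by rewrite mulrC ltr_pM2l// ltr_nat.
right; pose w := nz_row (kermx M^T); exists w, ((x0 *m w^T) 0 0); split.
  rewrite nz_row_eq0 -mxrank_eq0 mxrank_ker mxrank_tr -lt0n subn_gt0.
  by rewrite ltn_neqAle rank_leq_col andbT.
have Mw : M *m w^T = 0.
  apply: trmx_inj; rewrite trmx_mul trmxK trmx0; apply/sub_kermxP; exact: nz_row_sub.
move=> x /Msub /mulmxKpV E; have : (x - x0) *m w^T = 0 by rewrite -E -[_ *m M *m _]mulmxA Mw mulmx0.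
rewrite mulmxBl => /eqP; rewrite subr_eq0 => /eqP; by move=> ->.
Qed.

(* The barycentre b of x0 and the points x0 + row i M is a convex combination of x
   and a point y of the hull of these points, with a weight of x bounded below. *)
Lemma convex_bounded_below (f : 'rV[R]_n -> R) (B : R) : (forall x, A x -> `|x| <= B) ->
  (forall x y (t : R), A x -> A y -> 0 <= t <= 1 ->
     f ((1 - t) *: x + t *: y) <= (1 - t) * f x + t * f y) ->
  exists m : R, forall x, A x -> m <= f x.
Proof.
move=> AB convf; have [k [M [MA Msub]]] := spanning_rows A x0.
have [K K0 hK] := mulmx_bound (pinvmx M).
have B0 : 0 <= B by apply: le_trans (AB _ Ax0).
pose Lam := K * (B + `|x0|) + 1.
have Lam1 : 1 <= Lam by rewrite lerDr mulr_ge0 ?(ltW K0)// addr_ge0.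
have Lam0 : 0 < Lam by lra.
have k10 : 0 < k.+1%:R :> R by rewrite ltr0n.
(* [eps] is chosen to keep [eps * c i] within [beta], so that the weights [t i] of [y] are
   nonnegative; the factor 4 leaves room for the division by [1 - eps] in their sum. *)
pose beta : R := (4 * k.+1%:R)^-1.
have b0 : 0 < beta by rewrite invr_gt0 mulr_gt0.
have kb : 4 * k%:R * beta < 1.
  by rewrite /beta ltr_pdivrMr ?mulr_gt0// mul1r ltr_pM2l// ltr_nat.
have b4 : beta <= 4^-1.
  by rewrite /beta lef_pV2 ?posrE ?mulr_gt0// ler_peMr// ler1n.
pose eps := beta / Lam.
have eps0 : 0 < eps by rewrite divr_gt0.
have epsL : eps * Lam = beta by rewrite divfK// gt_eqF.
have epsb : eps <= beta by rewrite -epsL ler_peMr// ltW.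
clearbody eps beta.
(* Bounds [f] at [x0] and at all points [x0 + row i M], hence on their hull, because the sublevel
   set [S] is convex. *)
pose Mx := \sum_i `|f (x0 + row i M)| + `|f x0|.
have Mx0 : 0 <= Mx by rewrite addr_ge0// sumr_ge0.
pose S : set 'rV[R]_n := [set y | A y /\ f y <= Mx].
have Sconv x y (t : R) : S x -> S y -> 0 <= t <= 1 -> S ((1 - t) *: x + t *: y).
  move=> [Ax fx] [Ay fy] t01; split; first exact: convA.
  apply: (le_trans (convf _ _ _ Ax Ay t01)); move/andP: t01 => [t0 t1].
  have t1' : 0 <= 1 - t by lra.
  have h1 := ler_wpM2l t0 fy; have h2 := ler_wpM2l t1' fx; lra.
have Sx0 : S x0 by split => //; rewrite (le_trans (ler_norm _))// lerDr sumr_ge0.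
have Srow i : S (x0 + row i M).
  split; first exact: MA.
  rewrite (le_trans (ler_norm _))// /Mx (bigD1 i)//= -addrA lerDl addr_ge0// sumr_ge0//.
pose b := x0 + \sum_i beta *: row i M.
exists ((f b - Mx) / eps) => x Ax.
pose c := (x - x0) *m pinvmx M.
have cM : x - x0 = \sum_i c 0 i *: row i M by rewrite -mulmx_sum_row /c mulmxKpV// Msub.
have cb i : `|c 0 i| <= Lam.
  apply: le_trans (ler_coord c i) _; apply: le_trans (hK _) _.
  rewrite /Lam (@le_trans _ _ (K * (B + `|x0|)))// ?lerDl// ler_pM2l//.
  by rewrite (le_trans (ler_normB _ _))// lerD2r AB.
have cb' i : - beta <= eps * c 0 i <= beta.
  have := cb i; rewrite ler_norml => /andP[h1 h2].
  by rewrite -epsL -mulrN !ler_pM2l// h1 h2.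
pose t i := (beta - eps * c 0 i) / (1 - eps).
have e1 : 0 < 1 - eps by lra.
have Sy : S (x0 + \sum_i t i *: row i M).
  apply: star_hull => // [i|].
    by rewrite divr_ge0// ?(ltW e1)// subr_ge0; have /andP[] := cb' i.
  rewrite -mulr_suml ltr_pdivrMr// mul1r.
  apply: (@le_lt_trans _ _ (\sum_(i < k) 2 * beta)).
    by apply: ler_sum => i _; have /andP[h _] := cb' i; lra.
  by rewrite sumr_const card_ord -mulr_natl; lra.
set y := x0 + _ in Sy; have [Ay fy] := Sy.
have bE : (1 - eps) *: y + eps *: x = b.
  have xE : x = x0 + \sum_i c 0 i *: row i M by rewrite -cM addrC subrK.
  rewrite /y /b [X in eps *: X]xE !scalerDr addrACA -[(1 - eps) *: x0 + _]scalerDl subrK scale1r.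
  congr (_ + _); rewrite !scaler_sumr -big_split /=; apply: eq_bigr => i _.
  rewrite !scalerA -scalerDl; congr (_ *: _); rewrite /t; field; by rewrite gt_eqF.
have e01 : 0 <= eps <= 1 by apply/andP; split; lra.
have := convf _ _ _ Ay Ax e01; rewrite bE => fb.
have := ler_wpM2l (ltW e1) fy => fy'.
have : eps * Mx >= 0 by rewrite mulr_ge0// ltW.
rewrite ler_pdivrMr// => h; lra.
Qed.

End FlatHull.

(** * Gradients of a convex function on the interior of its domain *)

Section Convex.
Variables (R : realType) (n : nat) (u : 'rV[R]_n -> \bar R).
Local Notation A := (edom u).
Local Notation f := (fun x => fine (u x)).
Local Notation O := (interiorV (edom u)).
Hypothesis cu : convex_ext u.

Lemma edom_fineK x : A x -> u x = (fine (u x))%:E.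
Proof.
by move=> Ax; rewrite fineK// fin_numElt ltNye; have [-> _] := cu; exact: Ax.
Qed.

Lemma convex_edom_fine x y (t : R) : A x -> A y -> 0 <= t <= 1 ->
  A ((1 - t) *: x + t *: y) /\ fine (u ((1 - t) *: x + t *: y)) <= (1 - t) * fine (u x) + t * fine (u y).
Proof.
move=> Ax Ay /andP[t0 t1].
have [->|tn0] := eqVneq t 0; first by rewrite subr0 !scale1r !scale0r !addr0 mul1r mul0r addr0.
have [->|tn1] := eqVneq t 1; first by rewrite subrr !scale1r !scale0r !add0r mul1r mul0r add0r.
have t01 : 0 < t < 1 by rewrite !lt_def tn0 t0 eq_sym tn1 t1.
have [_ /(_ x y t t01)] := cu; rewrite (edom_fineK Ax) (edom_fineK Ay) -!EFinM -EFinD => h.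
have Az : A ((1 - t) *: x + t *: y) by apply: le_lt_trans h _; exact: ltry.
by split => //; move: h; rewrite {1}(edom_fineK Az) lee_fin.
Qed.

Lemma convex_edom x y (t : R) : A x -> A y -> 0 <= t <= 1 -> A ((1 - t) *: x + t *: y).
Proof. by move=> Ax Ay /(convex_edom_fine Ax Ay)[]. Qed.

Lemma open_interiorV (B : set 'rV[R]_n) x : interiorV B x ->
  exists2 r : R, 0 < r & forall y, `|y - x| < r -> interiorV B y.
Proof. by move=> Bx; apply/interiorP; exact: nbhs_interior. Qed.

Hypothesis f2 : C2_on O f.

Lemma gradient_first_order y (e : R) : O y -> 0 < e -> exists2 r : R, 0 < r &
  forall w, `|w| < r -> `|f (y + w) - f y - dotv w (\row_i partial i f y)| <= e * `|w|.
Proof.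
move=> Oy e0; have [_ [d1 _]] := f2.
have [||r r0 hr] := @first_order _ _ _ (@open_interiorV A) f _ _ y e Oy e0.
- by move=> i; have [h _] := d1 i.
- by move=> i; have [_ h] := d1 i.
exists r => // w wr; have -> : dotv w (\row_i partial i f y) = \sum_i w 0 i * partial i f y.
  by rewrite dotvE; apply: eq_bigr => i _; rewrite mxE.
exact: hr.
Qed.

(** Convexity bounds the difference quotient from [y] towards [x] by [f x - f y], and the
    first-order expansion identifies that quotient with the gradient term up to [e] for small
    [t]. *)
Lemma gradient_subgradient x y : A x -> O y -> f y + dotv (x - y) (\row_i partial i f y) <= f x.
Proof.
move=> Ax Oy; apply/ler_addgt0Pr => e e0.
pose d := `|x - y| + 1; have d0 : 0 < d by rewrite ltr_wpDl.
have [r r0 hr] := gradient_first_order Oy (divr_gt0 e0 d0).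
pose t := Num.min 2^-1 (r / (2 * d)).
have d20 : 0 < 2 * d by rewrite mulr_gt0.
have t0 : 0 < t by rewrite lt_min invr_gt0 ltr0n divr_gt0.
have t2 : t <= 2^-1 by rewrite ge_min lexx.
have td : t * (2 * d) <= r by rewrite -ler_pdivlMr// ge_min lexx orbT.
clearbody t.
have wd : `|t *: (x - y)| <= t * d by rewrite normrZ gtr0_norm// ler_pM2l// lerDl.
have /hr : `|t *: (x - y)| < r by apply: (le_lt_trans wd); have := mulr_gt0 t0 d0; lra.
rewrite dotvZl => /ler_normlP[h _].
have t01 : 0 <= t <= 1 by apply/andP; split; lra.
have [_] := convex_edom_fine (interior_subset Oy) Ax t01.
have -> : (1 - t) *: y + t *: x = y + t *: (x - y).
  by rewrite scalerBl scale1r scalerBr addrAC addrA.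
move=> cv; have : e / d * `|t *: (x - y)| <= t * e.
  apply: (@le_trans _ _ (e / d * (t * d))); first by rewrite ler_pM2l// divr_gt0.
  by rewrite mulrCA divfK// gt_eqF.
move=> ee; rewrite -(ler_pM2l t0) !mulrDr; move: h cv ee; lra.
Qed.

(** A short step along an axis compares the partial derivative with the Lipschitz constant; the
    extra 1 is the error of the first-order expansion. *)
Lemma gradient_bounded : lipschitz_in O f -> exists B, forall y, O y -> `|\row_i partial i f y| <= B.
Proof.
move=> [L lip]; exists (`|L| + 1) => y Oy; apply: normv_le; first by rewrite addr_ge0.
move=> i; have [r r0 hr] := gradient_first_order Oy ltr01.
have [s s0 sO] := open_interiorV Oy.
pose t := Num.min r s / 2.
have m0 : 0 < Num.min r s by rewrite lt_min r0.
have t0 : 0 < t by rewrite divr_gt0.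
have tm : t < Num.min r s by rewrite ltr_pdivrMr// ltr_pMr// ltr1n.
move: tm; rewrite lt_min => /andP[tr ts]; clearbody t.
have wt : `|t *: unitv R i| <= t.
  by rewrite normrZ gtr0_norm// ler_piMr ?(ltW t0)// norm_unitv.
have h1 := hr _ (le_lt_trans wt tr).
have h2 : `|f (y + t *: unitv R i) - f y| <= `|L| * t.
  have Oy' : O (y + t *: unitv R i).
    by apply: sO; rewrite [_ - y]addrC addKr; exact: le_lt_trans ts.
  apply: (le_trans (lip _ _ Oy' Oy)); rewrite [_ - y]addrC addKr.
  by apply: (@le_trans _ _ (`|L| * `|t *: unitv R i|)); rewrite ?ler_wpM2r ?ler_norm// ler_wpM2l.
move: h1; set v := \row_j _; have -> : dotv (t *: unitv R i) v = t * v 0 i.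
  rewrite dotvZl dotvE (bigD1 i)//= big1 ?addr0; last first.
    by move=> j ji; rewrite mxE (negbTE ji) andbF mul0r.
  by rewrite [unitv R i 0 i]mxE !eqxx mul1r.
set D := f (y + _) - f y in h2 *; rewrite mul1r => h1.
rewrite -(ler_pM2l t0) -{1}(gtr0_norm t0) -normrM.
have -> : t * v 0 i = D - (D - t * v 0 i) by rewrite opprB addrC subrK.
rewrite (le_trans (ler_normB _ _))// mulrDr mulr1 [t * `|L|]mulrC lerD//.
exact: le_trans h1 wt.
Qed.

End Convex.

(** * Domains with and without interior, and the theorem *)

Section Final.
Variables (R : realType) (n : nat) (p : R) (u : 'rV[R]_n -> \bar R).
Local Notation A := (edom u).
Local Notation f := (fun x => fine (u x)).
Local Notation O := (interiorV (edom u)).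
Local Notation al := (2 * p / n%:R).
Hypothesis n0 : (0 < n)%N.
Hypothesis p0 : 0 < p.
Hypothesis cu : convex_ext u.
Variable B : R.
Hypothesis AB : forall x, A x -> `|x| <= B.

Lemma integral_on_flat (w : 'rV[R]_n) (b : R) (g : 'rV[R]_n -> \bar R) : w != 0 ->
  (forall x, A x -> (x *m w^T) 0 0 = b) -> (forall x, 0 <= g x)%E -> integral_on A g = 0%E.
Proof.
move=> w0 Aw g0; apply: (integral_Rn_hyperplane (b := b) w0) => x; first by case: ifP.
by case: asboolP => // /Aw ->; rewrite eqxx.
Qed.

(** An empty class would make the infimum [+oo]; a constant below [u] on its domain supplies a
    member. *)
Lemma Pc_neq0 m : (0 < m)%N -> Pc u m !=set0.
Proof.
move=> m0; have [k hk] : exists k : R, forall x, A x -> k <= f x.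
  have [[x0 Ax0]|nA] := pselect (exists x0, A x0).
    apply: (convex_bounded_below (convex_edom cu) Ax0 AB) => x y t Ax Ay t01.
    by have [] := convex_edom_fine cu Ax Ay t01.
  by exists 0 => x Ax; exfalso; apply: nA; exists x.
have [uN _] := cu.
have [||l [lP _ _]] := @Pc_intro _ _ u m [:: (0, k)] uN.
- by [].
- move=> ab; rewrite inE => /eqP -> x Ax /=; rewrite /affine_fun trmx0 mulmx0 mxE add0r.
  exact: hk.
by exists l.
Qed.

Lemma flat_limit (w : 'rV[R]_n) (b : R) : w != 0 ->
  (forall x, A x -> (x *m w^T) 0 0 = b) ->
  (fun m : nat => ((m%:R `^ al)%:E * triangle_p p u m)%E) @ \oo --> 0%E.
Proof.
move=> w0 Aw; have tri0 m : (0 < m)%N -> triangle_p p u m = 0%E.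
  move=> m0; have [l lP] := Pc_neq0 m0.
  apply/eqP; rewrite eq_le triangle_ge0 andbT; apply: ereal_inf_lbound; exists l => //.
  by apply: (integral_on_flat w0 Aw) => x; rewrite lee_fin powR_ge0.
apply: ereal_cvg_sandwich => // b0 b00; exists 1%N => m m1; rewrite tri0// mule0; exact: ltW.
Qed.

Hypothesis f2 : C2plus_on O f.
Hypothesis lip : lipschitz_in O f.

Lemma interior_limit x0 : O x0 ->
  (fun m : nat => ((m%:R `^ al)%:E * triangle_p p u m)%E) @ \oo -->
  ((zador (1%:M : 'M[R]_n) p / 2 `^ p)%:E *
    (integral_on A (fun x => ((\det (hessian f x)) `^ (p / (n%:R + 2 * p)))%:E))
      `^ ((n%:R + 2 * p) / n%:R))%E.
Proof.
move=> x0A; have [C2 pos] := f2; have [uN _] := cu.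
have B0 : 0 <= B by apply: le_trans (AB (interior_subset x0A)).
have L0 : 0 < 2 * B + 1 by lra.
have AL : A `<=` cube (const_mx (- B)) (2 * B + 1).
  move=> x /AB xB i; have := le_trans (ler_coord x i) xB; rewrite ler_norml !mxE => /andP[h1 h2].
  by apply/andP; split; lra.
have h1 := gradient_subgradient cu C2.
have h2 := gradient_bounded C2 lip.
have opO := @open_interiorV R n A.
have hH := hessian_coercive opO C2 pos.
have h3 := bregman_hessian opO C2 pos.
have sym := hessian_sym opO C2.
have nR : 0 < n%:R :> R by rewrite ltr0n.
have np : 0 < n%:R + 2 * p by rewrite addr_gt0// mulr_gt0.
have E1 : (n%:R + 2 * p) / n%:R = 1 + al by field; rewrite gt_eqF.
have al1 : 0 < 1 + al by rewrite -E1 divr_gt0.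
pose z := zador (1%:M : 'M[R]_n) p.
have z0 : 0 <= z.
  by apply: zador_ge0 => v; apply: le_trans (qf1_ge v); rewrite exprn_ge0.
have := @core_limit R n p u (fun y => \row_i partial i f y) (hessian f)
  (const_mx (- B)) (2 * B + 1) x0 n0 p0 uN (convex_edom cu) L0 AL x0A h1 h2 hH h3.
have g0 x : 0 <= \det (hessian f x) `^ (p / (n%:R + 2 * p)) by exact: powR_ge0.
have scale := @integral_sigma_scale R n p u (fun y => \row_i partial i f y) (hessian f)
  (const_mx (- B)) (2 * B + 1) x0 n0 p0 (convex_edom cu) L0 AL x0A hH h3
  (z `^ (1 + al)^-1) (fun x => \det (hessian f x) `^ (p / (n%:R + 2 * p))) (powR_ge0 _ _) g0.
(* The determinant gets the exponent [(p / n) / (1 + al) = p / (n + 2 * p)], and the constant [z]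
   regains exponent 1 under the outer power. *)
rewrite scale; last first.
  move=> x Ox; rewrite /sigma (zador_det n0 p0 (sym x Ox) (pos x Ox)) -/z.
  rewrite powRM ?powR_ge0//; congr (_ * _); rewrite -powRrM; congr (_ `^ _).
  by rewrite -E1; field; rewrite !gt_eqF.
rewrite poweRM ?lee_fin ?powR_ge0//; last first.
  by apply: integral_Rn_ge0 => x; case: ifP => // _; rewrite lee_fin.
rewrite poweR_EFin -powRrM mulVf ?gt_eqF// powRr1// muleA -EFinM E1.
suff -> : (2^-1 : R) `^ p * z = z / 2 `^ p by [].
by rewrite mulrC -[2^-1]powR_inv1// -powRrM mulN1r powRN.
Qed.

End Final.

Theorem mainTheorem2 (R : realType) (n : nat) (p : R) :
  (1 <= n)%N -> 0 < p ->
  exists delta : R,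
  forall u : 'rV[R]_n -> \bar R,
    convex_ext u ->
    compact (edom u) ->
    lipschitz_in (interior (edom u)) (fun x => fine (u x)) ->
    C2plus_on (interior (edom u)) (fun x => fine (u x)) ->
    (fun m : nat => ((m%:R `^ (2 * p / n%:R))%:E * triangle_p p u m)%E)
      @ \oo -->
    ((delta / 2 `^ p)%:E *
      (integral_on (edom u)
         (fun x => ((\det (hessian (fun y => fine (u y)) x)) `^ (p / (n%:R + 2 * p)))%:E))
      `^ ((n%:R + 2 * p) / n%:R))%E.
Proof.
move=> n0 p0; exists (zador (1%:M : 'M[R]_n) p) => u cu cA lip f2.
have [B AB] : exists B : R, forall x, edom u x -> `|x| <= B.
  have [B [_ hB]] := compact_bounded cA.
  by exists (B + 1); apply: hB; rewrite ltrDl.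
have [[x0 Ox0]|nO] := pselect (exists x0, interiorV (edom u) x0).
  exact: (interior_limit n0 p0 cu AB f2 lip Ox0).
have [w [b [w0 Aw]]] : exists (w : 'rV[R]_n) (b : R),
    w != 0 /\ forall x, edom u x -> (x *m w^T) 0 0 = b.
  have [[x0 Ax0]|nA] := pselect (exists x0, edom u x0).
    by have [//|] := interior_or_flat (convex_edom cu) Ax0.
  (* An empty domain lies in every hyperplane; the all-ones vector is nonzero because [n >= 1]. *)
  exists (const_mx 1), 0; split; last by move=> x Ax; exfalso; apply: nA; exists x.
  apply/eqP => /matrixP /(_ 0 (Ordinal n0)); rewrite !mxE => /eqP; by rewrite oner_eq0.
rewrite (integral_on_flat w0 Aw); last by move=> x; rewrite lee_fin powR_ge0.
have np : 0 < n%:R + 2 * p by rewrite addr_gt0 ?mulr_gt0 ?ltr0n.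
rewrite poweR0r ?mule0; last by rewrite gt_eqF// divr_gt0// ltr0n.
exact: (@flat_limit R n p u cu B AB w b w0 Aw).
Qed.
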